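(* Let $\alpha\approx 1.763\ldots$ denote the root of $\alpha=\exp(1/\alpha)$. For all $\epsilon>0$ there exists $d_0$ such that for all $d>d_0$ and all integers $k\geq(\alpha+\epsilon)d$ the following holds: with probability $1-o(1)$ (as $n\to\infty$) over the choice of $G\sim G(n,d/n)$, the mixing time of the Glauber dynamics for proper $k$-colorings of $G$ is $O\left(n^{2+1/(\log d)}\right)$.
   Context: $G(n,d/n)$ is the Erdős–Rényi random graph on $n$ vertices in which each pair is an edge independently with probability $d/n$; $d$ is a constant independent of $n$. For a graph $G=(V,E)$, $\Omega$ is the set of proper vertex $k$-colorings of $G$ and $\pi$ the uniform distribution on $\Omega$. The (heat-bath) Glauber dynamics is the Markov chain $(X_t)$ on $\Omega$ which, from $X_t$, chooses a uniformly random vertex $v$ and a uniformly random color $c\in[k]\setminus X_t(N(v))$ (where $N(v)$ is the set of neighbors of $v$), sets $X_{t+1}(v)=c$ and $X_{t+1}(w)=X_t(w)$ for all $w\neq v$. The mixing time is the minimum number of steps $T$ such that, from the worst initial state $X_0$, the distribution of $X_T$ is within total variation distance $1/4$ of $\pi$. *)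

(* Defs.v *)
From HB Require Import structures.
From mathcomp Require Import all_boot all_order all_algebra.
From mathcomp Require Import all_classical all_reals all_analysis.
Set Implicit Arguments. Unset Strict Implicit. Unset Printing Implicit Defensive.
Import Order.TTheory GRing.Theory Num.Theory.
Local Open Scope ring_scope.

(* A simple graph on the vertex set [n] = 'I_n is encoded by its edge set E,
   a set of ordered pairs (u,v) with u < v (one pair per unordered edge). *)
Definition upper_pairs (n : nat) : {set 'I_n * 'I_n} :=
  [set e : 'I_n * 'I_n | (val e.1 < val e.2)%N].

Definition adj (n : nat) (E : {set 'I_n * 'I_n}) (u v : 'I_n) : bool :=
  ((u, v) \in E) || ((v, u) \in E).

Definition gnp_prob (R : realType) (n : nat) (p : R)
    (A : {set 'I_n * 'I_n} -> Prop) : R :=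
  \sum_(E : {set 'I_n * 'I_n} | E \subset upper_pairs n)
     (if `[< A E >] then p ^+ #|E| * (1 - p) ^+ (#|upper_pairs n| - #|E|)
      else 0).

Definition coloring (n k : nat) := {ffun 'I_n -> 'I_k}.

Definition proper (n k : nat) (E : {set 'I_n * 'I_n}) (x : coloring n k) : bool :=
  [forall u, forall v, adj E u v ==> (x u != x v)].

Definition avail (n k : nat) (E : {set 'I_n * 'I_n}) (x : coloring n k)
    (v : 'I_n) : {set 'I_k} :=
  ~: (x @: [set w | adj E v w]).

Definition glauber_P (R : realType) (n k : nat) (E : {set 'I_n * 'I_n})
    (x y : coloring n k) : R :=
  (n%:R)^-1 * \sum_(v : 'I_n)
     (if [forall w, (w != v) ==> (y w == x w)] && (y v \in avail E x v)
      then (#|avail E x v|%:R)^-1 else 0).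

Fixpoint glauber_dist (R : realType) (n k : nat) (E : {set 'I_n * 'I_n})
    (x0 : coloring n k) (t : nat) : {ffun coloring n k -> R} :=
  match t with
  | 0 => [ffun y => (y == x0)%:R]
  | t'.+1 => [ffun y => \sum_(x : coloring n k)
                          glauber_dist R E x0 t' x * glauber_P R E x y]
  end.

Definition unif_proper (R : realType) (n k : nat) (E : {set 'I_n * 'I_n})
    : {ffun coloring n k -> R} :=
  [ffun y => if proper E y then (#|[set z : coloring n k | proper E z]|%:R)^-1
             else 0].

Definition tv_dist (R : realType) (T : finType) (mu nu : {ffun T -> R}) : R :=
  2^-1 * \sum_(y : T) `|mu y - nu y|.

(* "mixing time <= b": the minimum T with worst-case (over proper X_0)
   total-variation distance <= 1/4 is at most b, i.e. some such T <= b exists. *)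
Definition mixing_time_le (R : realType) (n k : nat) (E : {set 'I_n * 'I_n})
    (b : R) : Prop :=
  exists T : nat, T%:R <= b /\
    forall x0 : coloring n k, proper E x0 ->
      tv_dist (glauber_dist R E x0 T) (unif_proper R k E) <= 4^-1.

Arguments gnp_prob R n p A : clear implicits.
Arguments glauber_P R {n k} E x y.
Arguments glauber_dist R {n k} E x0 t.
Arguments unif_proper R {n k} E.
Arguments mixing_time_le R n k E b : clear implicits.

(* Main.v *)
Require Import Defs.
From HB Require Import structures.
From mathcomp Require Import all_boot all_order all_algebra.
From mathcomp Require Import ring lra zify.
From mathcomp Require Import reals sequences exp.
Set Implicit Arguments.
Unset Strict Implicit.
Unset Printing Implicit Defensive.
Import Order.TTheory GRing.Theory Num.Theory.
Local Open Scope ring_scope.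

(** The mixing time follows from a Poincare inequality for proper colourings,
    [Dir V f <= A * sum_v Dir {v} f] with [A] of order [n ^ (c / ln d)].  Call
    a vertex heavy when its degree exceeds [D ~ k / (alpha + eps / 2)].  Around
    a light vertex without heavy neighbours there is at most one cycle, so the
    marginal of a colour there is at most [exp (deg / q) / q] with [q] free
    colours, and [alpha = exp (1 / alpha)] makes influences contract along
    self-avoiding walks; heavy vertices are too rare in connected sets to undo
    this.  Total influence [I = o(n)] lets a linear number of random vertices
    be revealed at the price of a factor [(1 - I / n) ^ -t] in the variance.
    The components of what remains contain [O(ln n)] vertices, and there one
    sweep of updates in a degenerate order couples any two colourings with
    probability [n ^ (- c / ln d)], which gives the Poincare inequality of the
    component.  In G(n, d/n) the needed sparsity of small connected sets and
    the rarity of heavy vertices follow from first moments over spanning trees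
    of connected sets. *)

(** * Conditional averages and variances *)

(** Heavy vertices are the obstacle: their degree may exceed [k], so colouring their neighbours
    could leave them without a colour. Hence only light vertices without heavy neighbours are ever
    revealed. A heavy vertex then keeps its whole neighbourhood in its component; this gives both
    the existence of colourings under the pinnings met along the walks and the persistence of a
    reserved colour during the sweep. Contraction is always shown for oscillations, by influence or
    by coupling, and carried over to L2 by log-convexity of the norms of the iterates of a symmetric
    operator; no spectrum is computed. The exponent is reached by taking [D] large. Up to constants
    depending on [alpha] and [eps], revealing takes [n * ln D] draws at influence [1 + ln n / D],
    hence costs the power [ln D / D] of [n]; the sweeps cost the power [(ln D) ^ 3 / D]. Both are
    far below [1 / ln d]. *)

Lemma log_convex_bound (R : realType) (a : nat -> R) (C r : R) :
  0 <= r -> (forall j, 0 <= a j) -> (forall j, a j.+1 ^+ 2 <= a j * a j.+2) ->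
  (forall j, a j <= C * r ^+ j) -> a 1%N <= r * a 0%N.
Proof.
move=> r0 a0 cvx bnd; rewrite leNgt; apply/negP => lt.
have a1 : 0 < a 1%N by apply: le_lt_trans lt; rewrite mulr_ge0.
have r_gt0 : 0 < r.
  rewrite lt_def r0 andbT; apply/eqP => rE.
  by have := bnd 1%N; rewrite rE expr1 mulr0 leNgt a1.
have a00 : 0 < a 0%N.
  rewrite lt_def a0 andbT; apply/eqP => E.
  by have := cvx 0%N; rewrite E mul0r leNgt exprn_gt0.
(* Log-convexity makes the ratios of consecutive terms increase, so all of them are at least
   [q > r]; Bernoulli's inequality for [q / r] then contradicts the bound [C * r ^ j]. *)
pose q := a 1%N / a 0%N.
have q0 : 0 < q by rewrite divr_gt0.
have rq : r < q by rewrite ltr_pdivlMr.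
have step j : 0 < a j /\ q * a j <= a j.+1.
  elim: j => [|j [aj IH]]; first by split=> //; rewrite divfK // gt_eqF.
  have aj1 : 0 < a j.+1 by apply: lt_le_trans IH; rewrite mulr_gt0.
  split=> //; rewrite -(ler_pM2l aj); apply: le_trans (cvx j).
  by rewrite mulrCA mulrA expr2 ler_pM2r.
have low j : q ^+ j * a 0%N <= a j.
  elim: j => [|j IH]; first by rewrite mul1r.
  apply: le_trans (proj2 (step j)).
  by rewrite exprS -mulrA ler_pM2l.
pose e := q / r - 1.
have e0 : 0 < e by rewrite subr_gt0 ltr_pdivlMr // mul1r.
have eE : q / r = 1 + e by rewrite /e addrCA subrr addr0.
clearbody e.
have bern (j : nat) : 1 + j%:R * e <= (q / r) ^+ j.
  elim: j => [|j IH]; first by rewrite mul0r addr0 expr0.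
  rewrite exprS eE.
  have h1 : (1 + e) * (1 + j%:R * e) <= (1 + e) * (1 + e) ^+ j.
    by rewrite ler_pM2l ?addr_gt0 //; rewrite eE in IH.
  apply: le_trans h1; rewrite -natr1.
  have : 0 <= j%:R * e * e by rewrite !mulr_ge0 ?ler0n // ltW.
  by lra.
have h j : 1 + j%:R * e <= C / a 0%N.
  apply: le_trans (bern j) _.
  rewrite expr_div_n ler_pdivrMr ?exprn_gt0 // mulrAC ler_pdivlMr //.
  exact: le_trans (low j) (bnd j).
have Ca : 0 <= C / a 0%N / e.
  have := h 0%N; rewrite mul0r addr0 => h0.
  by rewrite divr_ge0 ?(ltW e0) // (le_trans ler01 h0).
have := h (Num.bound (C / a 0%N / e)).
rewrite leNgt => /negP; apply.
have := archi_boundP Ca; rewrite ltr_pdivrMr // => /lt_trans; apply.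
by rewrite ltrDr.
Qed.

Lemma sum_sqr_eq0 (R : realDomainType) (I : finType) (P : pred I) (f : I -> R) :
  \sum_(i | P i) f i ^+ 2 = 0 -> forall i, P i -> f i = 0.
Proof.
move=> /eqP; rewrite psumr_eq0 => [|i _]; last exact: sqr_ge0.
by move=> /allP h i Pi; move: (h i (mem_index_enum i)); rewrite Pi sqrf_eq0 => /eqP.
Qed.

Lemma cauchy_schwarz (R : realFieldType) (I : finType) (P : pred I) (f g : I -> R) :
  (\sum_(i | P i) f i * g i) ^+ 2 <=
  (\sum_(i | P i) f i ^+ 2) * (\sum_(i | P i) g i ^+ 2).
Proof.
set a := \sum_(i | P i) f i ^+ 2; set b := \sum_(i | P i) f i * g i.
set c := \sum_(i | P i) g i ^+ 2.
have c0 : 0 <= c by apply: sumr_ge0 => i _; exact: sqr_ge0.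
have [cE|cn] := eqVneq c 0.
  have -> : b = 0.
    by apply: big1 => i Pi; rewrite (sum_sqr_eq0 cE Pi) mulr0.
  by rewrite cE mulr0 expr0n.
have cp : 0 < c by rewrite lt_def cn.
have : 0 <= \sum_(i | P i) (c * f i - b * g i) ^+ 2.
  by apply: sumr_ge0 => i _; exact: sqr_ge0.
have -> : \sum_(i | P i) (c * f i - b * g i) ^+ 2 = c * (c * a - b ^+ 2).
  transitivity (\sum_(i | P i) (c ^+ 2 * f i ^+ 2 - (c * b *+ 2) * (f i * g i)
                                 + b ^+ 2 * g i ^+ 2)).
    by apply: eq_bigr => i _; ring.
  rewrite big_split sumrB /= -!mulr_sumr -/a -/b -/c.
  by rewrite mulrBr !expr2 mulr2n; ring.
by rewrite pmulr_rge0 // subr_ge0 mulrC.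
Qed.

Lemma sqr_sum_le (R : realFieldType) (I : finType) (P : pred I) (f : I -> R) :
  (\sum_(i | P i) f i) ^+ 2 <= #|P|%:R * \sum_(i | P i) f i ^+ 2.
Proof.
have := cauchy_schwarz P (fun=> 1) f.
under eq_bigr do rewrite mul1r.
under [X in _ <= X * _]eq_bigr do rewrite expr1n.
by rewrite sumr_const.
Qed.

Section Conditioning.
Variables (R : realType) (V C : finType).
Local Notation coloring := {ffun V -> C}.
Implicit Types (x y z : coloring) (Om S : {set coloring}) (f g : coloring -> R) (A B : {set V}).

Definition agree A (x y : coloring) := [forall v in A, x v == y v].

Lemma agreeP A x y : reflect (forall v, v \in A -> x v = y v) (agree A x y).
Proof. by apply: (iffP forall_inP) => h v /h /eqP. Qed.

Lemma agree_refl A x : agree A x x. Proof. exact/agreeP. Qed.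

Lemma agree_sym A x y : agree A x y = agree A y x.
Proof. by apply: eq_forallb => v; rewrite eq_sym. Qed.

Lemma agree_trans A x y z : agree A x y -> agree A y z -> agree A x z.
Proof. by move=> /agreeP h /agreeP h'; apply/agreeP => v vA; rewrite h ?h'. Qed.

Lemma agree_sub A B x y : A \subset B -> agree B x y -> agree A x y.
Proof. by move=> /subsetP s /agreeP h; apply/agreeP => v /s; apply: h. Qed.

Definition avg S f : R := (\sum_(x in S) f x) / #|S|%:R.

Definition fiber Om A x := [set y in Om | agree A x y].

Definition cond Om A f x := avg (fiber Om A x) f.

Definition inner Om f g := \sum_(x in Om) f x * g x.

Definition norm2 Om f := \sum_(x in Om) f x ^+ 2.

(** Up to the factor [#|Om|], the mean conditional variance of [f] given the colours outside [A]:
    the Dirichlet form of the heat-bath update of the block [A]. Norms and forms are sums over [Om]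
    without normalisation. *)
Definition Dir Om A f := norm2 Om (fun x => f x - cond Om (~: A) f x).

Lemma fiber_eq Om A x y : agree A x y -> fiber Om A x = fiber Om A y.
Proof.
move=> h; apply/setP => z; rewrite !inE; congr (_ && _).
by apply/idP/idP; apply: agree_trans; rewrite // agree_sym.
Qed.

Lemma eq_avg S f g : {in S, f =1 g} -> avg S f = avg S g.
Proof. by move=> h; rewrite /avg; congr (_ / _); apply: eq_bigr. Qed.

Lemma avg_cst S c : S != set0 -> avg S (fun=> c) = c.
Proof.
move=> S0; rewrite /avg sumr_const -[c *+ _]mulr_natr mulfK //.
by rewrite pnatr_eq0 cards_eq0.
Qed.

Lemma avgB S f g : avg S (fun x => f x - g x) = avg S f - avg S g.
Proof. by rewrite /avg sumrB mulrBl. Qed.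

Lemma avg_sum S (I : finType) (P : pred I) (F : I -> coloring -> R) :
  avg S (fun x => \sum_(i | P i) F i x) = \sum_(i | P i) avg S (F i).
Proof. by rewrite /avg exchange_big mulr_suml. Qed.

Lemma eq_cond Om A f g x : {in Om, f =1 g} -> cond Om A f x = cond Om A g x.
Proof. by move=> h; apply: eq_avg => y; rewrite inE => /andP[/h]. Qed.

Lemma cond_agree Om A f x y : agree A x y -> cond Om A f x = cond Om A f y.
Proof. by move=> h; rewrite /cond (fiber_eq _ h). Qed.

Lemma mem_fiber Om A x : x \in Om -> x \in fiber Om A x.
Proof. by move=> xO; rewrite inE xO agree_refl. Qed.

Lemma fiber_n0 Om A x : x \in Om -> fiber Om A x != set0.
Proof. by move=> xO; apply/set0Pn; exists x; apply: mem_fiber. Qed.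

Lemma cond_id Om A f x : x \in Om ->
  (forall y, y \in Om -> agree A x y -> f y = f x) -> cond Om A f x = f x.
Proof.
move=> xO h; rewrite -[RHS](avg_cst (f x) (fiber_n0 A xO)).
by apply: eq_avg => y; rewrite inE => /andP[yO]; apply: h.
Qed.

Lemma cond_condl Om A B f x : x \in Om -> A \subset B ->
  cond Om B (cond Om A f) x = cond Om A f x.
Proof.
move=> xO AB; apply: cond_id => // y yO h.
by apply: cond_agree; rewrite agree_sym; apply: agree_sub h.
Qed.

Lemma cond_condr Om A B f x : A \subset B ->
  cond Om A (cond Om B f) x = cond Om A f x.
Proof.
move=> AB; rewrite /cond /avg; congr (_ / _).
under eq_bigr do rewrite mulr_suml.
rewrite (exchange_big_dep (mem (fiber Om A x))) /=; last first.
  move=> y z; rewrite !inE => /andP[_ xy] /andP[-> /(agree_sub AB)] /=.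
  exact: agree_trans.
apply: eq_bigr => z zx.
transitivity (\sum_(y in fiber Om B z) f z / #|fiber Om B z|%:R).
  apply: eq_big => y; last first.
    by move=> /andP[_]; rewrite inE => /andP[_ /(fiber_eq Om) ->].
  move: zx; rewrite !inE => /andP[zO xz].
  rewrite zO /= [agree B y z]agree_sym; apply/idP/idP => [/andP[/andP[-> _] ->]//|].
  move=> /andP[-> h]; rewrite h andbT /=.
  exact: agree_trans xz (agree_sub AB h).
rewrite sumr_const -[_ *+ _]mulr_natr divfK // pnatr_eq0 cards_eq0 fiber_n0 //.
by move: zx; rewrite inE => /andP[].
Qed.

(** Averaging over the classes of an equivalence relation on [Om] is an orthogonal projection for
    [inner]. *)
Lemma cond_sym Om A f g : inner Om (cond Om A f) g = inner Om f (cond Om A g).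
Proof.
rewrite /inner /cond /avg.
under eq_bigr do rewrite -mulrA mulr_suml.
under [RHS]eq_bigr do rewrite mulrA mulr_sumr mulr_suml.
rewrite (exchange_big_dep (mem Om)) /=; last by move=> x y _; rewrite inE => /andP[].
rewrite [RHS](eq_bigr (fun x => \sum_(y in fiber Om A x) f x * g y / #|fiber Om A x|%:R)) //.
apply: eq_bigr => x xO; apply: eq_big => y.
  by rewrite !inE xO agree_sym.
move=> /andP[_]; rewrite inE => /andP[_ /(fiber_eq Om) ->].
by ring.
Qed.

Lemma condB Om A f g x :
  cond Om A (fun y => f y - g y) x = cond Om A f x - cond Om A g x.
Proof. exact: avgB. Qed.

Lemma cond_sum Om A (I : finType) (P : pred I) (F : I -> coloring -> R) x :
  cond Om A (fun y => \sum_(i | P i) F i y) x = \sum_(i | P i) cond Om A (F i) x.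
Proof. exact: avg_sum. Qed.

Lemma innerC Om f g : inner Om f g = inner Om g f.
Proof. by apply: eq_bigr => x _; rewrite mulrC. Qed.

Lemma inner_suml Om (I : finType) (P : pred I) (F : I -> coloring -> R) g :
  inner Om (fun x => \sum_(i | P i) F i x) g = \sum_(i | P i) inner Om (F i) g.
Proof. by rewrite /inner exchange_big; apply: eq_bigr => x _; rewrite mulr_suml. Qed.

Lemma eq_inner Om f f' g g' :
  {in Om, f =1 f'} -> {in Om, g =1 g'} -> inner Om f g = inner Om f' g'.
Proof. by move=> h h'; apply: eq_bigr => x xO; rewrite h ?h'. Qed.

Lemma norm2E Om f : norm2 Om f = inner Om f f.
Proof. by []. Qed.

Lemma eq_norm2 Om f g : {in Om, f =1 g} -> norm2 Om f = norm2 Om g.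
Proof. by move=> h; apply: eq_bigr => x xO; rewrite h. Qed.

Lemma norm2_ge0 Om f : 0 <= norm2 Om f.
Proof. by apply: sumr_ge0 => x _; exact: sqr_ge0. Qed.

Lemma inner_sqr_le Om f g : inner Om f g ^+ 2 <= norm2 Om f * norm2 Om g.
Proof. exact: cauchy_schwarz. Qed.

Lemma norm2B Om f g :
  norm2 Om (fun x => f x - g x) = norm2 Om f - inner Om f g *+ 2 + norm2 Om g.
Proof.
rewrite /norm2 /inner -sumrMnl -sumrB -big_split /=.
by apply: eq_bigr => x _; rewrite sqrrB.
Qed.

Lemma inner_cond Om A f : inner Om f (cond Om A f) = norm2 Om (cond Om A f).
Proof.
rewrite norm2E [RHS]cond_sym; apply: eq_inner => // x xO.
by rewrite cond_condl.
Qed.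

Lemma norm2_condB Om A f :
  norm2 Om (fun x => f x - cond Om A f x) = norm2 Om f - norm2 Om (cond Om A f).
Proof. by rewrite norm2B inner_cond mulr2n opprD addrA subrK. Qed.

Lemma norm2_cond_le Om A f : norm2 Om (cond Om A f) <= norm2 Om f.
Proof. by rewrite -subr_ge0 -norm2_condB norm2_ge0. Qed.

Lemma norm2_cond_mono Om A B f : A \subset B ->
  norm2 Om (cond Om A f) <= norm2 Om (cond Om B f).
Proof.
move=> AB; rewrite -(eq_norm2 (fun x _ => cond_condr Om f x AB)).
exact: norm2_cond_le.
Qed.

Lemma DirE Om A f : Dir Om A f = norm2 Om f - norm2 Om (cond Om (~: A) f).
Proof. exact: norm2_condB. Qed.

Lemma Dir_ge0 Om A f : 0 <= Dir Om A f.
Proof. exact: norm2_ge0. Qed.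

Lemma Dir_mono Om A B f : A \subset B -> Dir Om A f <= Dir Om B f.
Proof. by move=> h; rewrite !DirE lerB // norm2_cond_mono // setCS. Qed.

(* A symmetric operator whose iterates on [f] grow at most like [r ^ j]
   contracts [f] by [r]: this turns sup-norm contraction into an L2 bound. *)
Lemma sym_iter_bound Om (T : (coloring -> R) -> coloring -> R) f (K r : R) :
  0 <= r ->
  (forall g h, inner Om (T g) h = inner Om g (T h)) ->
  (forall j, norm2 Om (iter j T f) <= K * r ^+ j) ->
  norm2 Om (T f) <= r * norm2 Om f.
Proof.
move=> r0 sym bnd.
apply: (@log_convex_bound _ (fun j => norm2 Om (iter j T f)) K r) => // j.
  exact: norm2_ge0.
rewrite /= {1}norm2E sym; apply: le_trans (inner_sqr_le _ _ _) _ => //.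
Qed.

End Conditioning.

(** * Influence of a colour change *)

Lemma mulr_card (R : pzRingType) (T : finType) (S : {set T}) (K : R) :
  K * #|S|%:R = \sum_(x in S) K.
Proof. by rewrite sumr_const mulr_natr. Qed.

Section Averages.
Variables (R : realType) (V C : finType).
Local Notation coloring := {ffun V -> C}.
Implicit Types (x y z : coloring) (S : {set coloring}) (f g : coloring -> R).

Lemma avg_sub_le S S' f (K : R) : S != set0 -> S' != set0 ->
  (forall x y, x \in S -> y \in S' -> `|f x - f y| <= K) ->
  `|avg S f - avg S' f| <= K.
Proof.
move=> S0 S0' h.
have h1 y : y \in S' -> `|avg S f - f y| <= K.
  move=> yS; rewrite -(avg_cst (f y) S0) -avgB /avg normrM normfV normr_nat.
  rewrite ler_pdivrMr ?ltr0n ?card_gt0 //; apply: le_trans (ler_norm_sum _ _ _) _.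
  by rewrite mulr_card; apply: ler_sum => x xS; apply: h.
rewrite -(avg_cst (avg S f) S0') -avgB /avg normrM normfV normr_nat.
rewrite ler_pdivrMr ?ltr0n ?card_gt0 //; apply: le_trans (ler_norm_sum _ _ _) _.
by rewrite mulr_card; apply: ler_sum => x xS; apply: h1.
Qed.

Definition site S w c := [set x in S | x w == c].
Definition offsite S w c := [set x in S | x w != c].

Lemma sum_site S w (h : coloring -> R) :
  \sum_(x in S) h x = \sum_c \sum_(x in site S w c) h x.
Proof.
rewrite (partition_big (fun x : coloring => x w) predT) //=.
by apply: eq_bigr => c _; apply: eq_bigl => x; rewrite inE.
Qed.

(* With [p], [q] the masses of [b] off [a] and of [a] off [b], the difference is
   [p (A_b - A_0) - q (A_a - A_0)]; the smaller mass is coupled with itself. *)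
Lemma avg_exclude S w a b f (mu K : R) : 0 <= K ->
  offsite S w a != set0 -> offsite S w b != set0 ->
  (forall c c', site S w c != set0 -> site S w c' != set0 ->
     `|avg (site S w c) f - avg (site S w c') f| <= K) ->
  #|site (offsite S w a) w b|%:R <= mu * #|offsite S w a|%:R ->
  #|site (offsite S w b) w a|%:R <= mu * #|offsite S w b|%:R ->
  `|avg (offsite S w a) f - avg (offsite S w b) f| <= mu * K.
Proof.
move=> K0 na nb hK hb ha.
have [<-|ab] := eqVneq a b.
  rewrite subrr normr0 mulr_ge0 //.
  have : 0 <= mu * #|offsite S w a|%:R by apply: le_trans hb.
  by rewrite pmulr_lge0 // ltr0n card_gt0.
pose S0 := [set x in S | (x w != a) && (x w != b)].
have split a' b' (h : coloring -> R) : a' != b' ->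
    [set x in S | (x w != a') && (x w != b')] = S0 ->
    \sum_(x in offsite S w a') h x =
    \sum_(x in S0) h x + \sum_(x in site S w b') h x.
  move=> ab' S0E; rewrite (bigID (fun x : coloring => x w != b')) /=.
  congr (_ + _); apply: eq_bigl => x; rewrite -?S0E !inE.
    by rewrite andbA.
  by rewrite negbK; case: (x w =P b') => [->|]; rewrite ?andbF ?andbT // eq_sym ab' andbT.
have S0a : [set x in S | (x w != a) && (x w != b)] = S0 by [].
have S0b : [set x in S | (x w != b) && (x w != a)] = S0.
  by apply/setP => x; rewrite !inE [X in _ && X]andbC.
have ba : b != a by rewrite eq_sym.
have cardE a' b' : a' != b' ->
    [set x in S | (x w != a') && (x w != b')] = S0 ->
    #|offsite S w a'|%:R = #|S0|%:R + #|site S w b'|%:R :> R.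
  move=> h h'; have := split a' b' (fun=> 1) h h'.
  by rewrite !sumr_const.
have siteE a' b' : a' != b' -> site (offsite S w a') w b' = site S w b'.
  move=> h; apply/setP => x; rewrite !inE.
  by case: (x w =P b') => [->|]; rewrite ?andbF ?andbT // eq_sym h andbT.
rewrite siteE // in hb; rewrite siteE // in ha.
set n0 : R := #|S0|%:R; set na' : R := #|site S w a|%:R; set nb' : R := #|site S w b|%:R.
have cA : #|offsite S w a|%:R = n0 + nb' by apply: cardE.
have cB : #|offsite S w b|%:R = n0 + na' by apply: cardE.
have pA : 0 < n0 + nb' by rewrite -cA ltr0n card_gt0.
have pB : 0 < n0 + na' by rewrite -cB ltr0n card_gt0.
rewrite cA -/nb' in hb; rewrite cB -/na' in ha.
have sumE (T : {set coloring}) : \sum_(x in T) f x = #|T|%:R * avg T f.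
  have [->|T0] := eqVneq T set0; first by rewrite cards0 mul0r big_set0.
  by rewrite mulrC divfK // pnatr_eq0 cards_eq0.
have mean c : site S w c != set0 -> S0 != set0 -> `|avg (site S w c) f - avg S0 f| <= K.
  move=> c0 s0.
  rewrite distrC -(avg_cst (avg (site S w c) f) s0) -avgB /avg normrM normfV normr_nat.
  rewrite ler_pdivrMr ?ltr0n ?card_gt0 // -/(avg _ f).
  rewrite (sum_site _ w); apply: le_trans (ler_norm_sum _ _ _) _.
  have -> : K * #|S0|%:R = \sum_d \sum_(x in site S0 w d) K.
    by rewrite -(sum_site _ w) mulr_card.
  apply: ler_sum => d _.
  rewrite sumrB !sumr_const sumE -[avg _ _ *+ _]mulr_natl -mulrBr normrM normr_nat.
  rewrite -[K *+ _]mulr_natl.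
  have [->|d0] := eqVneq (site S0 w d) set0; first by rewrite cards0 !mul0r.
  rewrite ler_wpM2l //.
  have E : site S0 w d = site S w d.
    apply/setP => x; rewrite !inE; case: (x w =P d) => [->|]; rewrite ?andbF // !andbT.
    move: d0 => /set0Pn [y]; rewrite !inE => /andP[/and3P[_ ya yb] /eqP E].
    by rewrite -E ya yb !andbT.
  by rewrite E; apply: hK => //; rewrite -E.
rewrite /avg cA cB (split a b) // (split b a) // !sumE -/n0 -/na' -/nb'.
set A0 := avg S0 f; set Aa := avg (site S w a) f; set Ab := avg (site S w b) f.
pose p := nb' / (n0 + nb'); pose q := na' / (n0 + na').
have pmu : p <= mu by rewrite ler_pdivrMr.
have qmu : q <= mu by rewrite ler_pdivrMr.
have p0 : 0 <= p by rewrite divr_ge0 // ltW.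
have q0 : 0 <= q by rewrite divr_ge0 // ltW.
have E1 : (n0 * A0 + nb' * Ab) / (n0 + nb') = A0 + p * (Ab - A0).
  by rewrite /p; field; rewrite gt_eqF.
have E2 : (n0 * A0 + na' * Aa) / (n0 + na') = A0 + q * (Aa - A0).
  by rewrite /q; field; rewrite gt_eqF.
rewrite E1 E2.
have hab : 0 < p -> 0 < q -> `|Ab - Aa| <= K.
  move=> pp qp; apply: hK; apply/eqP => E; [move: pp|move: qp].
    by rewrite /p /nb' E cards0 mul0r ltxx.
  by rewrite /q /na' E cards0 mul0r ltxx.
(* Without a third colour both masses equal 1, and [A0], then the default value of an empty average,
   cancels. *)
have n0_0 : S0 = set0 -> p = q.
  move=> E; have n00 : n0 = 0 by rewrite /n0 E cards0.
  rewrite n00 add0r in pA; rewrite n00 add0r in pB.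
  by rewrite /p /q n00 !add0r !divff // gt_eqF.
have hb0 : 0 < p -> p != q -> `|Ab - A0| <= K.
  move=> pp pq; apply: mean; apply/eqP => E; first move: pp.
    by rewrite /p /nb' E cards0 mul0r ltxx.
  by move: pq; rewrite n0_0 // eqxx.
have ha0 : 0 < q -> p != q -> `|Aa - A0| <= K.
  move=> qp pq; apply: mean; apply/eqP => E; first move: qp.
    by rewrite /q /na' E cards0 mul0r ltxx.
  by move: pq; rewrite n0_0 // eqxx.
have main (p' q' Ab' Aa' : R) : 0 <= q' -> q' <= p' -> p' <= mu ->
    (0 < q' -> `|Ab' - Aa'| <= K) -> (0 < p' -> p' != q' -> `|Ab' - A0| <= K) ->
    `|p' * (Ab' - A0) - q' * (Aa' - A0)| <= mu * K.
  move=> q0' qp pm h1 h2.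
  have -> : p' * (Ab' - A0) - q' * (Aa' - A0) = q' * (Ab' - Aa') + (p' - q') * (Ab' - A0).
    by ring.
  apply: le_trans (ler_normD _ _) _; rewrite !normrM (ger0_norm q0').
  rewrite (@ger0_norm _ (p' - q')) ?subr_ge0 //.
  have k1 : q' * `|Ab' - Aa'| <= q' * K.
    move: q0'; rewrite le_eqVlt => /predU1P[<-|qp']; first by rewrite !mul0r.
    by rewrite ler_pM2l // h1.
  have k2 : (p' - q') * `|Ab' - A0| <= (p' - q') * K.
    have [->|ne] := eqVneq p' q'; first by rewrite subrr !mul0r.
    have lt' : q' < p' by rewrite lt_def ne.
    by rewrite ler_pM2l ?subr_gt0 // h2 // (le_lt_trans q0').
  apply: le_trans (lerD k1 k2) _; rewrite -mulrDl addrC subrK.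
  by rewrite ler_wpM2r.
have -> : A0 + p * (Ab - A0) - (A0 + q * (Aa - A0)) = p * (Ab - A0) - q * (Aa - A0).
  by ring.
have [qp|pq] := leP q p.
  by apply: main => // h; apply: hab => //; apply: lt_le_trans h qp.
rewrite distrC; apply: main => //; first exact: ltW.
  by move=> h; rewrite distrC; apply: hab => //; apply: lt_trans pq.
by move=> h ne; apply: ha0; rewrite // eq_sym.
Qed.

End Averages.

(** * List colourings of a set of vertices with the rest frozen *)

Section ListColorings.
Variables (V C : finType) (e : rel V).
Hypotheses (e_sym : symmetric e) (e_irr : irreflexive e).
Local Notation coloring := {ffun V -> C}.
Implicit Types (x y z : coloring) (F : {set V}) (L : V -> {set C}).

Definition nb v := [set w | e v w].

Definition upd z u (a : C) : coloring := [ffun v => if v == u then a else z v].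

(* Colourings that agree with [z] off [F], use the lists [L] on [F] and are
   proper inside [F]. *)
Definition lcol F L z := [set x : coloring |
  [&& agree (~: F) z x, [forall v in F, x v \in L v] &
      [forall u in F, forall v in F, e u v ==> (x u != x v)]]].

(** A list has lost at most one colour for each neighbour outside [F], as if these neighbours were
    coloured. The invariant survives pinning a vertex of [F]. *)
Definition lists_ok F L := forall v, v \in F -> (#|C| <= #|L v| + #|nb v :\: F|)%N.

Lemma lcolP F L z x :
  reflect [/\ forall v, v \notin F -> x v = z v,
              forall v, v \in F -> x v \in L v &
              forall u v, u \in F -> v \in F -> e u v -> x u != x v]
          (x \in lcol F L z).
Proof.
rewrite inE; apply: (iffP and3P) => [[/agreeP h1 /forall_inP h2 /forall_inP h3]|[h1 h2 h3]].
  split=> // [v vF|u v uF vF]; first by rewrite h1 // inE.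
  by move/(_ _ uF): h3 => /forall_inP/(_ _ vF)/implyP.
split.
- by apply/agreeP => v; rewrite inE => /h1.
- exact/forall_inP.
- by apply/forall_inP => u uF; apply/forall_inP => v vF; apply/implyP; apply: h3.
Qed.

Definition pin_lists L u a w := if e u w then L w :\ a else L w.

Lemma lcol_pin F L z u a : u \in F -> a \in L u ->
  site (lcol F L z) u a = lcol (F :\ u) (pin_lists L u a) (upd z u a).
Proof.
move=> uF aL; apply/setP => x; rewrite inE.
apply/andP/idP => [[/lcolP[h1 h2 h3] /eqP xu]|/lcolP[h1 h2 h3]].
  apply/lcolP; split=> [v|v|v w].
  - by rewrite !inE ffunE negb_and negbK; case: eqP => [->|_ /=] // /h1.
  - rewrite !inE => /andP[vu vF]; rewrite /pin_lists; case: ifP => [uv|_]; last exact: h2.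
    by rewrite !inE h2 // andbT -xu eq_sym h3.
  - by rewrite !inE => /andP[_ vF] /andP[_ wF]; apply: h3.
have xu : x u = a by rewrite h1 ?ffunE ?eqxx // !inE eqxx.
have h2' v : v \in F -> v != u -> x v \in pin_lists L u a v.
  by move=> vF vu; apply: h2; rewrite !inE vu.
split; last by rewrite xu.
apply/lcolP; split=> [v vF|v vF|v w vF wF vw].
- rewrite h1 ?ffunE; last by rewrite !inE negb_and vF orbT.
  by case: eqP => // E; rewrite E uF in vF.
- have [->|vu] := eqVneq v u; first by rewrite xu.
  by have := h2' v vF vu; rewrite /pin_lists; case: ifP => // _; rewrite inE => /andP[].
- have [vu|vu] := eqVneq v u.
    subst v; have wu : w != u by apply: contraTneq vw => ->; rewrite e_irr.
    have := h2' w wF wu; rewrite /pin_lists vw !inE xu => /andP[+ _].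
    by rewrite eq_sym.
  have [wu|wu] := eqVneq w u.
    subst w; have := h2' v vF vu; rewrite /pin_lists e_sym vw !inE xu.
    by move=> /andP[].
  by apply: h3 => //; rewrite !inE ?vu ?wu.
Qed.

Lemma site_lcol_out F L z u a : u \in F -> a \notin L u -> site (lcol F L z) u a = set0.
Proof.
move=> uF aL; apply/eqP; apply: contraNT aL => /set0Pn[x].
by rewrite inE => /andP[/lcolP[_ h _] /eqP <-]; apply: h.
Qed.

Lemma lists_ok_pin F L u a : u \in F -> lists_ok F L ->
  lists_ok (F :\ u) (pin_lists L u a).
Proof.
move=> uF ok v; rewrite !inE => /andP[vu vF].
apply: leq_trans (ok v vF) _; rewrite /pin_lists; case: ifP => [uv|_].
  have -> : nb v :\: (F :\ u) = u |: nb v :\: F.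
    apply/setP => w; rewrite !inE; case: (eqVneq w u) => [->|] //=.
    by rewrite e_sym uv.
  rewrite cardsU1 !inE uF /= (cardsD1 a (L v)).
  by case: (a \in L v); lia.
rewrite leq_add2l; apply/subset_leq_card/subsetP => w; rewrite !inE.
by case: (w \in F) => //=; rewrite andbF.
Qed.

Definition ex_lists L w a v := if v == w then L v :\ a else L v.

Lemma lcol_exclude F L z w a : w \in F ->
  offsite (lcol F L z) w a = lcol F (ex_lists L w a) z.
Proof.
move=> wF; apply/setP => x; rewrite inE.
apply/andP/lcolP => [[/lcolP[h1 h2 h3] xw]|[h1 h2 h3]]; split=> //.
- move=> v vF; rewrite /ex_lists; case: eqP => [E|_]; last exact: h2.
  by rewrite !inE h2 // E xw.
- apply/lcolP; split=> // v vF; have := h2 v vF.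
  by rewrite /ex_lists; case: ifP => // _; rewrite inE => /andP[].
- by have := h2 w wF; rewrite /ex_lists eqxx !inE => /andP[].
Qed.

Lemma eq_lcol F L L' z : (forall v, v \in F -> L v = L' v) -> lcol F L z = lcol F L' z.
Proof.
move=> h; apply/setP => x; apply/lcolP/lcolP => -[h1 h2 h3]; split=> // v vF.
  by rewrite -h // h2.
by rewrite h // h2.
Qed.

Lemma upd_lcol F L z u a b x : u \notin F ->
  x \in lcol F L (upd z u a) -> upd x u b \in lcol F L (upd z u b).
Proof.
move=> uF /lcolP[h1 h2 h3].
have E v : v \in F -> upd x u b v = x v.
  by move=> vF; rewrite ffunE; case: eqP => // vu; rewrite vu (negPf uF) in vF.
apply/lcolP; split=> [v vF|v vF|v w vF wF vw].
- by rewrite !ffunE; case: eqP => // vu; rewrite h1 // ffunE; case: eqP.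
- by rewrite E // h2.
- by rewrite !E // h3.
Qed.

End ListColorings.

(** * Influence bounded by weighted self-avoiding walks *)

Section Influence.
Variables (R : realType) (V C : finType) (e : rel V).
Hypotheses (e_sym : symmetric e) (e_irr : irreflexive e).
Local Notation coloring := {ffun V -> C}.
Implicit Types (x y z : coloring) (F : {set V}) (L : V -> {set C}) (f : coloring -> R).

Definition lipschitz (lam : R) f := forall x v c, `|f x - f (upd x v c)| <= lam.

Lemma lipschitz_seq lam f (s : seq V) x y : lipschitz lam f ->
  (forall v, v \notin s -> x v = y v) -> `|f x - f y| <= (size s)%:R * lam.
Proof.
move=> lip; elim: s x => [|v s IH] x h.
  have -> : x = y by apply/ffunP => v; apply: h.
  by rewrite subrr normr0 mul0r.
rewrite -(subrK (f (upd x v (y v))) (f x)) -addrA /= -natr1 mulrDl mul1r addrC.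
apply: le_trans (ler_normD _ _) _; apply: lerD; last exact: lip.
apply: IH => w ws; rewrite ffunE; case: eqP => [->//|/eqP wv].
by apply: h; rewrite inE negb_or wv.
Qed.

Lemma lipschitz_card lam f x y : lipschitz lam f -> `|f x - f y| <= #|V|%:R * lam.
Proof.
by move=> lip; rewrite cardE; apply: lipschitz_seq => // v; rewrite mem_enum.
Qed.

Variable m : {set V} -> V -> R.
Hypothesis m_ge0 : forall F v, 0 <= m F v.

(* The weight of the self-avoiding-walk tree of depth [j] rooted at [u]. *)
Fixpoint infl (B : R) j F u : R :=
  if j is j'.+1 then
    1 + \sum_(w in nb e u :&: (F :\ u)) m (F :\ u) w * infl B j' (F :\ u) w
  else B.

Lemma infl_ge0 B j F u : 0 <= B -> 0 <= infl B j F u.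
Proof.
move=> B0; elim: j F u => [|j IH] F u //=.
by rewrite addr_ge0 // sumr_ge0 // => w _; rewrite mulr_ge0.
Qed.

(** Interpolates between the lists left by pinning [u] to [a] and to [b]: the neighbours of [u] in
    [s] already have [b] forbidden, the others still have [a]. *)
Definition swap_lists L u a b (s : seq V) v : {set C} :=
  if e u v then (if v \in s then L v :\ b else L v :\ a) else L v.

Variables (adm : nat -> {set V} -> V -> Prop) (lam : R) (f : coloring -> R) (B : R).
Hypothesis adm_feasible : forall j F u, adm j F u -> u \in F ->
  forall L z, lists_ok e (F :\ u) L -> lcol e (F :\ u) L z != set0.
Hypothesis adm_step : forall j F u w, adm j.+1 F u -> u \in F ->
  w \in nb e u :&: (F :\ u) ->
  adm j (F :\ u) w /\ forall L z c, lists_ok e (F :\ u) L ->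
    #|site (lcol e (F :\ u) L z) w c|%:R <= m (F :\ u) w * #|lcol e (F :\ u) L z|%:R.
Hypothesis lip : lipschitz lam f.
Hypothesis cardB : #|V|%:R <= B.

Lemma lipschitz_ge0 : forall (x0 : coloring) (v0 : V), 0 <= lam.
Proof. by move=> x0 v0; apply: le_trans (lip x0 v0 (x0 v0)). Qed.

Lemma avg_upd_le F L z u a b : u \notin F -> lcol e F L (upd z u a) != set0 ->
  `|avg (lcol e F L (upd z u a)) f - avg (lcol e F L (upd z u b)) f| <= lam.
Proof.
move=> uF n0.
pose S := lcol e F L (upd z u a); pose S' := lcol e F L (upd z u b).
pose h x : coloring := upd x u b.
pose h' x : coloring := upd x u a.
have xu c x : x \in lcol e F L (upd z u c) -> x u = c.
  by move=> /lcolP[-> //]; rewrite ffunE eqxx.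
have K1 x : x \in S -> h' (h x) = x.
  move=> /xu E; apply/ffunP => v; rewrite !ffunE.
  by case: eqP => [->|].
have K2 x : x \in S' -> h (h' x) = x.
  move=> /xu E; apply/ffunP => v; rewrite !ffunE.
  by case: eqP => [->|].
have hS x : x \in S -> h x \in S' by apply: upd_lcol.
have hS' x : x \in S' -> h' x \in S by apply: upd_lcol.
have sumE (g : coloring -> R) : \sum_(y in S') g y = \sum_(x in S) g (h x).
  rewrite (reindex_onto h h') /=; last by move=> y; exact: K2.
  apply: eq_bigl => x; apply/andP/idP => [[/hS' + /eqP E]|xS]; first by rewrite E.
  by rewrite hS // K1.
have -> : avg S' f = avg S (fun x => f (h x)).
  rewrite /avg sumE; congr (_ / _).
  by have := sumE (fun=> 1); rewrite !sumr_const.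
rewrite -avgB /avg normrM normfV normr_nat ler_pdivrMr ?ltr0n ?card_gt0 //.
apply: le_trans (ler_norm_sum _ _ _) _.
by rewrite mulr_card; apply: ler_sum => x _; apply: lip.
Qed.

(** After [u] is pinned to [a] or to [b], the two instances on [F :\ u] differ only in the lists of
    the neighbours of [u]. The forbidden colour is exchanged at one neighbour [w] at a time, and by
    [avg_exclude] each exchange costs the marginal at [w] times the influence of [w], which is the
    recursion of [infl]. The colour of [u] itself costs [lam]. At depth 0 any two colourings are
    compared, at cost [#|V| * lam]. *)
Lemma influence_le j F u L z a b : adm j F u -> u \in F -> lists_ok e F L ->
  a \in L u -> b \in L u ->
  `|avg (site (lcol e F L z) u a) f - avg (site (lcol e F L z) u b) f|
    <= lam * infl B j F u.
Proof.
elim: j F u L z a b => [|j IH] F u L z a b ad uF ok aL bL.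
  have h c : c \in L u -> site (lcol e F L z) u c != set0.
    by move=> cL; rewrite lcol_pin //; apply: adm_feasible ad _ _ _ _ => //; apply: lists_ok_pin.
  have l0 : 0 <= lam by apply: lipschitz_ge0 z u.
  apply: avg_sub_le; rewrite ?h // => x y _ _.
  by apply: le_trans (lipschitz_card _ _ lip) _; rewrite mulrC ler_wpM2l.
have B0 : 0 <= B by apply: le_trans cardB.
have l0 : 0 <= lam by apply: lipschitz_ge0 z u.
rewrite !lcol_pin //; set F' := F :\ u.
have uF' : u \notin F' by rewrite !inE eqxx.
have oka : lists_ok e F' (pin_lists e L u a) by apply: lists_ok_pin.
have na := adm_feasible ad uF (upd z u a) oka.
rewrite /= -/F' mulrDr mulr1.
rewrite -(subrK (avg (lcol e F' (pin_lists e L u a) (upd z u b)) f)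
  (avg (lcol e F' (pin_lists e L u a) (upd z u a)) f)) -addrA.
apply: le_trans (ler_normD _ _) _; apply: lerD; first exact: avg_upd_le.
set z' := upd z u b.
have swap (s : seq V) : uniq s -> {subset s <= nb e u :&: F'} ->
    lists_ok e F' (swap_lists L u a b s) /\
    `|avg (lcol e F' (pin_lists e L u a) z') f - avg (lcol e F' (swap_lists L u a b s) z') f|
     <= lam * \sum_(w <- s) m F' w * infl B j F' w.
  elim: s => [|w s IHs] /=.
    move=> _ _; rewrite (@eq_lcol _ _ _ _ (swap_lists L u a b [::]) (pin_lists e L u a)) //.
    by rewrite subrr normr0 big_nil mulr0.
  move=> /andP[ws us] sub.
  have subs : {subset s <= nb e u :&: F'} by move=> v vs; apply: sub; rewrite inE vs orbT.
  have [oks les] := IHs us subs.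
  have wN : w \in nb e u :&: F' by apply: sub; rewrite inE eqxx.
  have /setIP[euw wF'] := wN; rewrite inE in euw.
  have [adw mw] := adm_step ad uF wN.
  (* [Lp] restores the full list at [w]; both neighbouring instances of the interpolation arise from
     it by excluding one colour at [w], as [avg_exclude] demands. *)
  pose Lp v := if v == w then L v else swap_lists L u a b s v.
  have Ea v : ex_lists Lp w a v = swap_lists L u a b s v.
    rewrite /ex_lists /Lp /swap_lists; case: eqP => [->|//].
    by rewrite euw (negPf ws).
  have Eb v : ex_lists Lp w b v = swap_lists L u a b (w :: s) v.
    rewrite /ex_lists /Lp /swap_lists inE; case: eqP => [->|//].
    by rewrite euw.
  have okL v : v \in F' -> (#|C| <= #|L v :\ b| + #|nb e v :\: F'|)%N ->
      (#|C| <= #|L v :\ a| + #|nb e v :\: F'|)%N -> (#|C| <= #|L v| + #|nb e v :\: F'|)%N.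
    by move=> _ h _; apply: leq_trans h _; rewrite leq_add2r subset_leq_card // subD1set.
  have okc c : lists_ok e F' (fun v => if e u v then L v :\ c else L v).
    exact: lists_ok_pin.
  have okb : lists_ok e F' (swap_lists L u a b (w :: s)).
    move=> v vF; rewrite /swap_lists.
    have := okc a v vF; have := okc b v vF.
    by case: (e u v) => //; case: ifP.
  split=> //.
  have okLp : lists_ok e F' Lp.
    move=> v vF; rewrite /Lp; case: eqP => [->|_]; last exact: oks.
    by have := okc a w wF'; have := okc b w wF'; rewrite euw; apply: okL.
  rewrite -(subrK (avg (lcol e F' (swap_lists L u a b s) z') f)
    (avg (lcol e F' (pin_lists e L u a) z') f)) -addrA big_cons mulrDr addrC.
  apply: le_trans (ler_normD _ _) _; apply: lerD; last exact: les.
  rewrite mulrCA.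
  have EEa : lcol e F' (swap_lists L u a b s) z' = offsite (lcol e F' Lp z') w a.
    by rewrite lcol_exclude //; apply: eq_lcol => v _; rewrite Ea.
  have EEb : lcol e F' (swap_lists L u a b (w :: s)) z' = offsite (lcol e F' Lp z') w b.
    by rewrite lcol_exclude //; apply: eq_lcol => v _; rewrite Eb.
  rewrite EEa EEb; apply: avg_exclude.
  - by rewrite mulr_ge0 // infl_ge0.
  - by rewrite -EEa; apply: (adm_feasible ad).
  - by rewrite -EEb; apply: (adm_feasible ad).
  - move=> c c' nc nc'; apply: IH => //.
      by apply: contraNT nc => h; rewrite site_lcol_out.
    by apply: contraNT nc' => h; rewrite site_lcol_out.
  - by rewrite -EEa; apply: mw.
  - by rewrite -EEb; apply: mw.
have sub_enum : {subset enum (nb e u :&: F') <= nb e u :&: F'}.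
  by move=> v; rewrite mem_enum.
have [_] := swap (enum (nb e u :&: F')) (enum_uniq _) sub_enum.
rewrite big_enum /= => h; apply: le_trans h.
rewrite le_eqVlt; apply/orP; left; apply/eqP; congr (`| _ - avg _ f|).
apply: eq_lcol => v vF; rewrite /swap_lists /pin_lists mem_enum in_setI vF andbT inE.
by case: (e u v).
Qed.

End Influence.

(** * Marginals of light vertices *)

Section Marginals.
Variables (R : realType) (V C : finType) (e : rel V).
Hypotheses (e_sym : symmetric e) (e_irr : irreflexive e).
Local Notation coloring := {ffun V -> C}.
Implicit Types (x y z : coloring) (F K I : {set V}) (L : V -> {set C}).

Lemma sum_cond (Om : {set coloring}) A (f : coloring -> R) :
  \sum_(x in Om) cond Om A f x = \sum_(x in Om) f x.
Proof.
have := cond_sym Om A f (fun=> 1); rewrite /inner.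
under eq_bigr do rewrite mulr1; move=> ->.
by apply: eq_bigr => x xO; rewrite /cond avg_cst ?mulr1 // fiber_n0.
Qed.

Definition res_lists F K L x v : {set C} := L v :\: (x @: (nb e v :&: (F :\: K))).

Lemma fiber_lcol F K L z x : K \subset F -> x \in lcol e F L z ->
  fiber (lcol e F L z) (~: K) x = lcol e K (res_lists F K L x) x.
Proof.
move=> /subsetP KF /lcolP[x1 x2 x3]; apply/setP => y; rewrite inE.
apply/andP/lcolP => [[/lcolP[y1 y2 y3] /agreeP xy]|[y1 y2 y3]].
  split=> [v vK|v vK|u v /KF uF /KF vF]; last exact: y3.
    by rewrite xy // inE.
  rewrite !inE y2 ?KF // andbT; apply/imsetP => -[u].
  rewrite !inE => /and3P[vu uK uF] E.
  by have := y3 _ _ (KF _ vK) uF vu; rewrite E xy ?eqxx // inE.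
split; last by apply/agreeP => v; rewrite inE => /y1.
apply/lcolP; split=> [v vF|v vF|u v uF vF uv].
- by rewrite y1 ?x1 //; apply: contra vF; apply: KF.
- have [vK|vK] := boolP (v \in K); last by rewrite y1 // x2.
  by have := y2 _ vK; rewrite inE => /andP[].
- have aux u' v' : u' \in F -> v' \in K -> u' \notin K -> e v' u' -> y v' != y u'.
    move=> uF' vK' uK' vu'; rewrite (y1 _ uK').
    have := y2 _ vK'; rewrite inE => /andP[+ _]; apply: contra => /eqP ->.
    by apply: imset_f; rewrite !inE vu' uK'.
  have [uK|uK] := boolP (u \in K); have [vK|vK] := boolP (v \in K).
  + exact: y3.
  + exact: aux.
  + by rewrite eq_sym aux // e_sym.
  + by rewrite !y1 // x3.
Qed.

Lemma lists_ok_res F K L x : K \subset F -> lists_ok e F L ->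
  lists_ok e K (res_lists F K L x).
Proof.
move=> /subsetP KF ok v vK; apply: leq_trans (ok v (KF _ vK)) _.
have h1 : (#|L v| <= #|res_lists F K L x v| + #|nb e v :&: (F :\: K)|)%N.
  rewrite /res_lists -(cardsID (x @: (nb e v :&: (F :\: K))) (L v)) addnC.
  rewrite leq_add2l; apply: leq_trans (leq_imset_card _ _).
  exact: subset_leq_card (subsetIr _ _).
have h2 : (#|nb e v :&: (F :\: K)| + #|nb e v :\: F| <= #|nb e v :\: K|)%N.
  rewrite -(cardsID F (nb e v :\: K)) leq_add //.
    by apply/subset_leq_card/subsetP => u; rewrite !inE => /and3P[-> -> ->].
  apply/subset_leq_card/subsetP => u; rewrite !inE => /andP[uF ->].
  by rewrite uF (contra (KF u)).
by lia.
Qed.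

Lemma site_card_fiber F K L z w c (mu : R) : K \subset F -> w \in K ->
  (forall x, x \in lcol e F L z ->
    #|site (lcol e K (res_lists F K L x) x) w c|%:R
      <= mu * #|lcol e K (res_lists F K L x) x|%:R) ->
  #|site (lcol e F L z) w c|%:R <= mu * #|lcol e F L z|%:R.
Proof.
move=> KF wK h; set Om := lcol e F L z.
have E (S : {set coloring}) : #|site S w c|%:R = \sum_(x in S) (x w == c)%:R :> R.
  rewrite -sum1_card natr_sum big_mkcond [RHS]big_mkcond /=.
  by apply: eq_bigr => x _; rewrite inE; case: (x \in S) => //=; case: eqP.
rewrite E -(sum_cond Om (~: K)) mulr_card; apply: ler_sum => x xO.
have n0 := fiber_n0 (~: K) xO.
rewrite /cond /avg -E ler_pdivrMr ?ltr0n ?card_gt0 //.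
by rewrite fiber_lcol // h.
Qed.

Lemma card_lcol_indep I L z : {in I &, forall u v, ~~ e u v} ->
  #|lcol e I L z| = (\prod_(v in I) #|L v|)%N.
Proof.
move=> ind.
pose G v := if v \in I then L v else [set z v].
have -> : #|lcol e I L z| = #|(family G : simpl_pred coloring)|.
  apply: eq_card => x; apply/lcolP/familyP => [[h1 h2 _] v|h].
    by rewrite /G; case: ifP => vI; [apply: h2|rewrite inE h1 ?vI].
  split=> [v vI|v vI|u v uI vI].
  - by have := h v; rewrite /G (negPf vI) inE => /eqP.
  - by have := h v; rewrite /G vI.
  - by rewrite (negPf (ind u v uI vI)).
rewrite card_family foldrE big_map big_enum [RHS]big_mkcond /=.
by apply: eq_bigr => v _; rewrite /G; case: ifP => // _; rewrite cards1.
Qed.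

Lemma one_sub_inv_ge (l : R) : 1 < l -> expR (- (l - 1)^-1) <= 1 - l^-1.
Proof.
move=> l1; have l0 : 0 < l - 1 by rewrite subr_gt0.
have lp : 0 < l by lra.
rewrite expRN -[1 - l^-1]invrK lef_pV2 ?posrE ?expR_gt0 ?invr_gt0 //; last first.
  by rewrite subr_gt0 invf_lt1.
apply: le_trans (expR_ge1Dx _).
have -> : 1 - l^-1 = (l - 1) / l by field; rewrite gt_eqF.
rewrite invf_div le_eqVlt; apply/orP; left; apply/eqP.
by field; rewrite gt_eqF.
Qed.

Lemma jensen_expR (J : finType) (Q : {set J}) (s : J -> R) :
  (0 < #|Q|)%N ->
  #|Q|%:R * expR ((\sum_(i in Q) s i) / #|Q|%:R) <= \sum_(i in Q) expR (s i).
Proof.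
move=> Q0; set M := _ / _.
have q0 : #|Q|%:R != 0 :> R by rewrite pnatr_eq0 -lt0n.
have -> : #|Q|%:R * expR M = \sum_(i in Q) expR M * (1 + (s i - M)).
  rewrite -mulr_sumr big_split /= sumrB !sumr_const -[M *+ _]mulr_natl.
  by rewrite /M mulrC [_%:R * _]mulrC divfK // subrr addr0.
apply: ler_sum => i _.
rewrite -{2}(subrK M (s i)) expRD mulrC ler_pM2r ?expR_gt0 //.
exact: expR_ge1Dx.
Qed.

(* The count with [w = c'] is a product over the leaves; AM-GM over [c'] turns
   the sum of these products into [q * exp (- r |I| / q)]. *)
Lemma star_marginal I w L z c (N0 : nat) : w \notin I -> (1 < N0)%N ->
  {in I &, forall u v, ~~ e u v} -> (forall v, v \in I -> e w v) ->
  (forall v, v \in I -> (N0 <= #|L v|)%N) -> (0 < #|L w|)%N ->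
  #|site (lcol e (w |: I) L z) w c|%:R * #|L w|%:R <=
  expR (N0%:R / (N0%:R - 1) * #|I|%:R / #|L w|%:R) * #|lcol e (w |: I) L z|%:R :> R.
Proof.
move=> wI N1 ind star big q0; set r : R := N0%:R / (N0%:R - 1).
have wK : w \in w |: I by rewrite !inE eqxx.
have KI : (w |: I) :\ w = I.
  by apply/setP => v; rewrite !inE; case: eqP => [->|] //=; rewrite (negPf wI).
pose P : R := \prod_(v in I) #|L v|%:R.
have lg v : v \in I -> 1 < #|L v|%:R :> R.
  by move=> vI; rewrite ltr1n (leq_trans N1) // big.
have P0 : 0 < P by apply: prodr_gt0 => v vI; apply: lt_trans ltr01 (lg v vI).
have cardE c' : c' \in L w ->
    #|site (lcol e (w |: I) L z) w c'|%:R = P * \prod_(v in I) (1 - (c' \in L v)%:R / #|L v|%:R) :> R.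
  move=> cL; rewrite lcol_pin // KI card_lcol_indep // natr_prod -big_split /=.
  apply: eq_bigr => v vI; rewrite /pin_lists star //.
  have l0 : #|L v|%:R != 0 :> R by rewrite gt_eqF // (lt_trans ltr01) ?lg.
  rewrite mulrBr mulr1 mulrCA divff // mulr1.
  by rewrite (cardsD1 c' (L v)) natrD addrC addKr.
(* [1 - 1 / l >= exp (- 1 / (l - 1))], and passing from [l - 1] to [l] costs at most the factor [r]
   because [l >= N0]. *)
have fac c' v : v \in I ->
    expR (- (c' \in L v)%:R / (#|L v|%:R - 1)) <= 1 - (c' \in L v)%:R / #|L v|%:R :> R.
  move=> vI; case: (c' \in L v); last by rewrite oppr0 !mul0r expR0 subr0.
  by rewrite mulNr !mul1r; apply: one_sub_inv_ge; apply: lg.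
have siteP : #|site (lcol e (w |: I) L z) w c|%:R <= P.
  have [cL|cL] := boolP (c \in L w); last by rewrite site_lcol_out // cards0 ltW.
  rewrite cardE // ger_pMr // prodr_ile1 // => v vI.
  have : 0 <= (c \in L v)%:R / #|L v|%:R :> R by rewrite divr_ge0.
  have : (c \in L v)%:R / #|L v|%:R <= 1 :> R.
    rewrite ler_pdivrMr ?mul1r; last exact: lt_trans (lg v vI).
    by apply: le_trans (ltW (lg v vI)); case: (_ \in _).
  by rewrite subr_ge0 gerBl => -> -> .
have tot : P * (#|L w|%:R * expR (- (r * #|I|%:R / #|L w|%:R))) <= #|lcol e (w |: I) L z|%:R.
  have -> : #|lcol e (w |: I) L z|%:R = \sum_c' #|site (lcol e (w |: I) L z) w c'|%:R :> R.
    have := @sum_site R V C (lcol e (w |: I) L z) w (fun=> 1).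
    by rewrite sumr_const => ->; apply: eq_bigr => c' _; rewrite sumr_const.
  rewrite (bigID (mem (L w))) /= [X in _ <= _ + X]big1 ?addr0; last first.
    by move=> c' cL; rewrite site_lcol_out // cards0.
  under eq_bigr => c' cL do rewrite cardE //.
  rewrite -mulr_sumr ler_pM2l //.
  pose s c' : R := \sum_(v in I) - (c' \in L v)%:R / (#|L v|%:R - 1).
  apply: (@le_trans _ _ (\sum_(c' in L w) expR (s c'))); last first.
    apply: ler_sum => c' _; rewrite expR_sum.
    by apply: ler_prod => v vI; rewrite expR_ge0 fac.
  apply: le_trans (jensen_expR s q0).
  rewrite ler_pM2l ?ltr0n // ler_expR -mulNr ler_pM2r ?invr_gt0 ?ltr0n //.
  rewrite /s exchange_big /= mulr_card -sumrN; apply: ler_sum => v vI.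
  have N1' : 0 < N0%:R - 1 :> R by rewrite subr_gt0 ltr1n.
  have l1 : 0 < #|L v|%:R - 1 :> R by rewrite subr_gt0 lg.
  rewrite -mulr_suml sumrN mulNr lerN2.
  have -> : \sum_(c' in L w) (c' \in L v)%:R = #|L w :&: L v|%:R :> R.
    rewrite -sum1_card natr_sum big_mkcond [RHS]big_mkcond /=.
    by apply: eq_bigr => c' _; rewrite in_setI; do 2!case: (_ \in _).
  apply: (@le_trans _ _ (#|L v|%:R / (#|L v|%:R - 1))).
    by rewrite ler_wpM2r ?invr_ge0 ?(ltW l1) // ler_nat subset_leq_card // subsetIr.
  rewrite /r ler_pdivrMr // mulrAC ler_pdivlMr //.
  have : N0%:R <= #|L v|%:R :> R by rewrite ler_nat big.
  by move=> h; lra.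
rewrite -ler_pdivrMl ?expR_gt0 // -expRN.
apply: le_trans tot; set E := expR _; rewrite [E * _]mulrC -mulrA.
by rewrite ler_wpM2r // mulr_ge0 // expR_ge0.
Qed.

End Marginals.

(** * Marginal bounds in terms of degrees *)

Section MarginalRate.
Variables (R : realType) (V C : finType) (e : rel V).
Hypotheses (e_sym : symmetric e) (e_irr : irreflexive e).
Local Notation coloring := {ffun V -> C}.
Implicit Types (x z : coloring) (F : {set V}) (L : V -> {set C}).
Variables (D N0 : nat) (t1 q : R).
Hypotheses (N0_gt1 : (1 < N0)%N) (colors : (D + N0 <= #|C|)%N).

Definition heavy := [set v | (D < #|nb e v|)%N].

Lemma site_le F L z w c : lists_ok e F L -> w \in F -> w \notin heavy ->
  #|site (lcol e F L z) w c|%:R <= N0%:R^-1 * #|lcol e F L z|%:R :> R.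
Proof.
move=> ok wF; rewrite inE -leqNgt => dw.
have KF : [set w] \subset F by rewrite sub1set.
apply: (site_card_fiber e_sym KF); rewrite ?inE // => x xl.
set L' := res_lists e F [set w] L x.
have okL : lists_ok e [set w] L' by apply: lists_ok_res.
have q0 : (N0 <= #|L' w|)%N.
  have := okL w; rewrite inE eqxx => /(_ isT).
  have : (#|nb e w :\: [set w]| <= #|nb e w|)%N by apply/subset_leq_card/subsetDl.
  by lia.
have w0 : w \notin (set0 : {set V}) by rewrite inE.
have := @star_marginal R V C e e_sym e_irr set0 w L' x c N0 w0 N0_gt1.
rewrite setU0 cards0 mulr0 mul0r expR0 mul1r => h.
have N0p : 0 < N0%:R :> R by rewrite ltr0n ltnW.
rewrite -ler_pdivrMl ?invr_gt0 // invrK mulrC.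
apply: le_trans (h _ _ _ _) => //.
- by rewrite ler_wpM2l // ler_nat.
- by move=> u v; rewrite inE.
- by move=> v; rewrite inE.
- by move=> v; rewrite inE.
- by apply: leq_trans q0; rewrite ltnW.
Qed.

Hypothesis t1_ge : D%:R <= t1 * (#|C|%:R - 1).
Hypothesis t1_contr : t1 * expR (N0%:R / (N0%:R - 1) * t1) <= q.

(** Conditioning on all but the star of [w] and its neighbours in [F] outside [P] leaves [w] at
    least [#|C| - D + a - 1] colours, the 1 paying for the vertex of [P]. The ratio of [a] to this
    number increases with [a] and is at most [t1] at [a = D]; [star_marginal] then turns it into
    [t1 * exp (r * t1)]. *)
Lemma site_light_le F L z w c (P : {set V}) : lists_ok e F L -> w \in F -> w \notin heavy ->
  nb e w :&: (F :&: heavy) = set0 -> (#|P| <= 1)%N ->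
  {in nb e w :\: P &, forall u v, ~~ e u v} ->
  #|nb e w :&: F|%:R * #|site (lcol e F L z) w c|%:R <= q * #|lcol e F L z|%:R :> R.
Proof.
move=> ok wF wH noH P1 ind.
have dw : (#|nb e w| <= D)%N by move: wH; rewrite inE -leqNgt.
set a := #|nb e w :&: F|.
have [a0|a0] := posnP a.
  rewrite a0 mul0r mulr_ge0 //; apply: le_trans t1_contr.
  rewrite mulr_ge0 ?expR_ge0 //.
  have k1 : 0 < #|C|%:R - 1 :> R.
    by rewrite subr_gt0 ltr1n; apply: leq_trans colors; rewrite (leq_trans N0_gt1) // leq_addl.
  by rewrite -(pmulr_lge0 _ k1) (le_trans _ t1_ge).
have ap : 0 < a%:R :> R by rewrite ltr0n.
pose I := (nb e w :&: F) :\: P.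
pose K := w |: I.
have wI : w \notin I by rewrite !inE e_irr andbF.
have KF : K \subset F.
  by apply/subsetP => v; rewrite !inE => /orP[/eqP ->//|/and3P[]].
rewrite mulrC -ler_pdivlMr // mulrAC.
apply: (site_card_fiber e_sym KF); rewrite ?setU11 // => x xl.
set L' := res_lists e F K L x.
have okL : lists_ok e K L' by apply: lists_ok_res.
have IK v : v \in I -> v \in K by move=> vI; rewrite inE vI orbT.
have star v : v \in I -> e w v by rewrite !inE => /and3P[].
have bigI v : v \in I -> (N0 <= #|L' v|)%N.
  move=> vI; have := okL v (IK v vI).
  have dv : (#|nb e v| <= D)%N.
    rewrite leqNgt; apply/negP => h.
    have : v \in nb e w :&: (F :&: heavy).
      by move: vI; rewrite !inE h => /and3P[_ -> ->].
    by rewrite noH inE.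
  have : (#|nb e v :\: K| <= #|nb e v|)%N by apply/subset_leq_card/subsetDl.
  by move: dv colors; clear; lia.
have bigw' : (#|C| + a <= #|L' w| + D + 1)%N.
  have := okL w (setU11 _ _).
  have h1 : (#|nb e w :\: K| <= #|nb e w :\: F| + #|P|)%N.
    apply: leq_trans (leq_card_setU _ _); apply/subset_leq_card/subsetP => v.
    rewrite !inE negb_or => /andP[/andP[_ +] wv].
    by rewrite wv /= !andbT negb_and negbK orbC.
  move: (cardsID F (nb e w)) (okL w (setU11 _ _)) h1 dw P1; rewrite -/a.
  by clear; lia.
have bigw : (N0 + a - 1 <= #|L' w|)%N by move: bigw' colors; clear; lia.
have q0 : (0 < #|L' w|)%N by move: bigw a0 N0_gt1; clear; lia.
have qp : 0 < #|L' w|%:R :> R by rewrite ltr0n.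
have at1 : a%:R / #|L' w|%:R <= t1.
  have C1 : (1 < #|C|)%N by move: colors N0_gt1; clear; lia.
  have k1 : 0 < #|C|%:R - 1 :> R by rewrite subr_gt0 ltr1n.
  rewrite ler_pdivrMr // -(ler_pM2r k1) mulrAC.
  apply: (@le_trans _ _ (D%:R * #|L' w|%:R)); last by rewrite ler_wpM2r.
  have aD : (a <= D)%N.
    by apply: leq_trans dw; apply/subset_leq_card/subsetIl.
  have : (a * (#|C| - 1) <= D * #|L' w|)%N.
    apply: leq_trans (_ : D * (#|C| - 1 - D + a) <= _)%N.
      by move: aD C1 colors N0_gt1; clear; nia.
    rewrite leq_mul2l; apply/orP; right.
    by move: bigw' aD colors N0_gt1; clear; lia.
  by rewrite -(ler_nat R) !natrM natrB // ltnW.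
have Ia : #|I|%:R <= a%:R :> R by rewrite ler_nat; apply/subset_leq_card/subsetDl.
have indI : {in I &, forall u v, ~~ e u v}.
  by move=> u v; rewrite !inE => /and3P[uP wu _] /and3P[vP wv _]; apply: ind; rewrite !inE ?uP ?vP.
have := @star_marginal R V C e e_sym e_irr I w L' x c N0 wI N0_gt1 indI star bigI q0.
set r : R := _ / (_ - 1); set S : R := #|site _ _ _|%:R; set T : R := #|lcol _ _ _ _|%:R => h.
rewrite -/T mulrAC ler_pdivlMr // mulrC.
have r0 : 0 <= r by rewrite divr_ge0 // subr_ge0 ler1n ltnW.
have t10 : 0 <= t1 by apply: le_trans at1; rewrite divr_ge0.
have h2 : S * #|L' w|%:R <= expR (r * t1) * T.
  apply: le_trans h _; rewrite ler_wpM2r // ler_expR -mulrA ler_wpM2l //.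
  by apply: le_trans at1; rewrite ler_wpM2r ?invr_ge0.
have -> : a%:R * S = a%:R / #|L' w|%:R * (S * #|L' w|%:R).
  by field; rewrite gt_eqF.
apply: (@le_trans _ _ (t1 * (expR (r * t1) * T))).
  by rewrite ler_pM ?divr_ge0 ?mulr_ge0.
by rewrite mulrA ler_wpM2r.
Qed.

(** The contracting rate needs leaves with long lists, which a heavy neighbour in [F] need not have;
    in its presence a light vertex only gets [1 / N0]. A heavy vertex gets the trivial bound. *)
Definition mrate F w : R :=
  if w \in heavy then 1
  else if (nb e w :&: (F :&: heavy) == set0) && (nb e w :&: F != set0)
  then Num.min N0%:R^-1 (q / #|nb e w :&: F|%:R) else N0%:R^-1.

Hypothesis q_ge0 : 0 <= q.
Hypothesis locally_sparse : forall w, w \notin heavy ->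
  exists2 P : {set V}, (#|P| <= 1)%N & {in nb e w :\: P &, forall u v, ~~ e u v}.

Lemma mrate_ge0 F w : 0 <= mrate F w.
Proof.
by rewrite /mrate; do 2?case: ifP => // _; rewrite ?ler01 ?le_min ?invr_ge0 ?divr_ge0 ?ler0n.
Qed.

Lemma mrate_heavy F w : w \in heavy -> mrate F w = 1.
Proof. by rewrite /mrate => ->. Qed.

Lemma mrate_le F w : w \notin heavy -> mrate F w <= N0%:R^-1.
Proof.
by rewrite /mrate => /negPf ->; case: ifP => // _; rewrite ge_min lexx.
Qed.

Lemma mrate_light F w : w \notin heavy -> nb e w :&: (F :&: heavy) = set0 ->
  mrate F w * #|nb e w :&: F|%:R <= q.
Proof.
rewrite /mrate => /negPf -> ->; rewrite eqxx /=.
have [->|n0] := eqVneq (nb e w :&: F) set0; first by rewrite cards0 mulr0.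
have p : 0 < #|nb e w :&: F|%:R :> R by rewrite ltr0n card_gt0.
by rewrite -ler_pdivlMr // ge_min lexx orbT.
Qed.

Lemma marginal_le F L z w c : lists_ok e F L -> w \in F ->
  #|site (lcol e F L z) w c|%:R <= mrate F w * #|lcol e F L z|%:R :> R.
Proof.
move=> ok wF; rewrite /mrate; case: ifP => [_|/negbT wH].
  by rewrite mul1r ler_nat; apply/subset_leq_card/subsetP => x; rewrite inE => /andP[].
have h1 := site_le z c ok wF wH.
case: ifP => // /andP[/eqP noH n0].
have [P P1 ind] := locally_sparse wH.
have := site_light_le z c ok wF wH noH P1 ind.
have p : 0 < #|nb e w :&: F|%:R :> R by rewrite ltr0n card_gt0.
rewrite mulrC -ler_pdivlMr // mulrAC => h2.
by rewrite minr_pMl ?ler0n // le_min h1 h2.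
Qed.

End MarginalRate.

(** * Connected sets and self-avoiding walks *)

Section Connected.
Variables (V : finType) (e : rel V).
Hypotheses (e_sym : symmetric e) (e_irr : irreflexive e).
Implicit Types (A B K T : {set V}) (u v w : V).
Local Open Scope nat_scope.

(** Connectedness by growth, one adjacent vertex at a time, so that a spanning tree can be read off
    a derivation. Such sets are non-empty. *)
Inductive conn : {set V} -> Prop :=
| conn1 v : conn [set v]
| conn_add T u v : conn T -> u \in T -> v \notin T -> e u v -> conn (v |: T).

(* Twice the number of edges inside [T]. *)
Definition edges2 T := \sum_(u in T) #|nb e u :&: T|.

Lemma conn_n0 T : conn T -> T != set0.
Proof. by case=> [v|T' u v _ _ _ _]; apply/set0Pn; exists v; rewrite !inE eqxx. Qed.

Lemma conn_boundary T A x y : conn T -> x \in T -> x \in A -> y \in T -> y \notin A ->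
  exists u v, [/\ u \in T, u \in A, v \in T, v \notin A & e u v].
Proof.
move=> cT; elim: cT x y => {T} [v|T u v _ IH uT vT uv] x y.
  by rewrite !inE => /eqP -> vA /eqP ->; rewrite vA.
move=> xT xA yT yA.
have [/exists_inP[x' x'T x'A]|noA] := boolP [exists x' in T, x' \in A].
  have [/exists_inP[y' y'T y'A]|allA] := boolP [exists y' in T, y' \notin A].
    have [u' [v' [h1 h2 h3 h4 h5]]] := IH _ _ x'T x'A y'T y'A.
    by exists u', v'; split=> //; rewrite inE ?h1 ?h3 orbT.
  have TA z : z \in T -> z \in A.
    by move=> zT; apply: contraR allA => zA; apply/exists_inP; exists z.
  exists u, v; split=> //; rewrite ?inE ?eqxx ?uT ?orbT //; first exact: TA.
  move: yT; rewrite !inE => /predU1P[<- //|/TA yA'].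
  by rewrite yA' in yA.
have TA z : z \in T -> z \notin A.
  by move=> zT; apply: contra noA => zA; apply/exists_inP; exists z.
exists v, u; split; rewrite ?inE ?eqxx ?uT ?orbT //; last by rewrite e_sym.
  move: xT; rewrite !inE => /predU1P[<- //|/TA xA'].
  by rewrite xA in xA'.
exact: TA.
Qed.

Lemma conn_grow A K : conn A -> A \subset K ->
  (forall B, A \subset B -> B \proper K -> exists u v,
     [/\ u \in B, v \in K, v \notin B & e u v]) -> conn K.
Proof.
move: {2}(#|K| - #|A|) (erefl (#|K| - #|A|)) => n.
elim: n A => [|n IH] A nE cA AK h.
  suff -> : K = A by [].
  by apply/eqP; rewrite eq_sym eqEcard AK /=; lia.
have [u [v [uA vK vA uv]]] : exists u v, [/\ u \in A, v \in K, v \notin A & e u v].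
  by apply: h => //; rewrite properEcard AK; lia.
apply: (IH (v |: A)).
- by rewrite cardsU1 vA; lia.
- exact: conn_add uA vA uv.
- by rewrite subUset sub1set vK.
- by move=> B sB; apply: h; apply: subset_trans sB; apply: subsetUr.
Qed.

Lemma conn_setU A B : conn A -> conn B -> A :&: B != set0 -> conn (A :|: B).
Proof.
move=> cA cB /set0Pn[w /setIP[wA wB]].
apply: (conn_grow cA (subsetUl _ _)) => S AS /properP[SU [y yU yS]].
have yB : y \in B.
  move: yU; rewrite inE => /orP[yA|//].
  by move/subsetP: AS => /(_ _ yA); rewrite (negPf yS).
have wS : w \in S by apply: (subsetP AS).
have [u [v [uB uS vB vS uv]]] := conn_boundary cB wB wS yB yS.
by exists u, v; split=> //; rewrite inE vB orbT.
Qed.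

Lemma conn_path u p : path e u p -> conn [set x in u :: p].
Proof.
elim: p u => [|v p IH] u /=.
  move=> _; have -> : [set x in [:: u]] = [set u]; last exact: conn1.
  by apply/setP => x; rewrite !inE.
move=> /andP[uv pv]; have cp := IH _ pv.
have [up|up] := boolP (u \in [set x in v :: p]).
  suff -> : [set x in [:: u, v & p]] = [set x in v :: p] by [].
  apply/setP => x; rewrite !inE; case: eqP => [->|//].
  by move: up; rewrite !inE => ->.
suff -> : [set x in [:: u, v & p]] = u |: [set x in v :: p].
  by apply: (conn_add cp _ up (u := v)); [rewrite inE mem_head|rewrite e_sym].
by apply/setP => x; rewrite !inE.
Qed.

Lemma edges2U1 v T : v \notin T -> edges2 (v |: T) = edges2 T + 2 * #|nb e v :&: T|.
Proof.
move=> vT; rewrite /edges2 big_setU1 //=.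
have -> : #|nb e v :&: (v |: T)| = #|nb e v :&: T|.
  by apply: eq_card => x; rewrite !inE; case: eqP => [->|//]; rewrite e_irr.
have -> : \sum_(u in T) #|nb e u :&: (v |: T)| = \sum_(u in T) (#|nb e u :&: T| + e v u).
  apply: eq_bigr => u uT; rewrite setIUr.
  rewrite cardsU.
  have -> : nb e u :&: [set v] :&: (nb e u :&: T) = set0.
    apply/setP => x; rewrite !inE; case: (x =P v) => [->|]; rewrite ?andbF //.
    by rewrite (negPf vT) !andbF.
  rewrite cards0 subn0 addnC; congr (_ + _)%N.
  rewrite e_sym; case uv: (e u v).
    have -> : nb e u :&: [set v] = [set v]; last by rewrite cards1.
    by apply/setP => x; rewrite !inE; case: eqP => [->|]; rewrite ?andbF ?uv.
  apply/eqP; rewrite cards_eq0; apply/eqP/setP => x; rewrite !inE.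
  by case: eqP => [->|]; rewrite ?andbF ?uv.
rewrite big_split /=.
have -> : \sum_(i in T) e v i = #|nb e v :&: T|.
  rewrite -sum1_card big_mkcond [RHS]big_mkcond /=; apply: eq_bigr => x _.
  by rewrite !inE; case: (x \in T); rewrite ?andbF ?andbT //; case: (e v x).
lia.
Qed.

(** In a connected [K] every proper non-empty subset has an edge leaving it inside [K], so it can be
    enlarged vertex by vertex with at least one new edge each time. *)
Lemma excess_mono A K : conn K -> A \subset K -> A != set0 ->
  edges2 A + 2 * #|K| <= edges2 K + 2 * #|A|.
Proof.
move=> cK; move: {2}(#|K| - #|A|) (erefl (#|K| - #|A|)) => n.
elim: n A => [|n IH] A nE AK A0.
  suff -> : K = A by [].
  by apply/eqP; rewrite eq_sym eqEcard AK /=; lia.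
have /properP[_ [y yK yA]] : A \proper K by rewrite properEcard AK; lia.
have /set0Pn[x xA] := A0; have xK := subsetP AK x xA.
have [u [v [uK uA vK vA uv]]] := conn_boundary cK xK xA yK yA.
have s : v |: A \subset K by rewrite subUset sub1set vK.
have := IH (v |: A); rewrite cardsU1 vA => /(_ _ s) IH1.
have n0 : v |: A != set0 by apply/set0Pn; exists v; rewrite !inE eqxx.
have := IH1 _ n0; rewrite edges2U1 // => IH2.
have n1 : 0 < #|nb e v :&: A| by rewrite card_gt0; apply/set0Pn; exists u; rewrite !inE uA e_sym uv.
by have := IH2 ltac:(lia); lia.
Qed.

Lemma conn_edges2_ge K : conn K -> 2 * #|K| <= edges2 K + 2.
Proof.
move=> cK; have /set0Pn[x xK] := conn_n0 cK.
have := @excess_mono [set x] K cK; rewrite sub1set xK cards1 => /(_ isT).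
have n0 : [set x] != set0 by apply/set0Pn; exists x; rewrite inE.
by move=> /(_ n0); lia.
Qed.

Definition saw u v (p : seq V) := [&& path e u p, uniq (u :: p) & last u p == v].

Definition supp u (P : seq (seq V)) := [set x | has (fun p => x \in u :: p) P].

Lemma suppP u P x : reflect (exists2 p, p \in P & x \in u :: p) (x \in supp u P).
Proof. by rewrite inE; apply: hasP. Qed.

Lemma conn_supp u P : P != [::] -> (forall p, p \in P -> path e u p) -> conn (supp u P).
Proof.
elim: P => // p P IH _ h.
have cp : conn [set x in u :: p] by apply: conn_path; apply: h; rewrite inE eqxx.
have [PE|Pn0] := eqVneq P [::].
  suff -> : supp u (p :: P) = [set x in u :: p] by [].
  by apply/setP => x; rewrite PE !inE /= orbF inE.
have cP : conn (supp u P) by apply: IH => // q qP; apply: h; rewrite inE qP orbT.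
suff -> : supp u (p :: P) = [set x in u :: p] :|: supp u P.
  apply: conn_setU => //; apply/set0Pn; exists u; rewrite !inE eqxx /=.
  by case: (P) Pn0 => //= q Q _; rewrite inE eqxx.
by apply/setP => x; rewrite !inE.
Qed.

Lemma sqr_le_4exp c : c ^ 2 * 4 <= 4 ^ c.
Proof.
case: c => [|[|c]] //; elim: c => [|c IH] //.
rewrite [4 ^ _]expnS; have : c.+3 ^ 2 <= 4 * c.+2 ^ 2 by rewrite !expnS !expn0; nia.
by lia.
Qed.

Lemma exp_shift n a b a' b' : b <= b' -> a + 2 * b' <= a' + 2 * b ->
  n * 4 ^ b <= 2 ^ (a + 2) -> n * 4 ^ b' <= 2 ^ (a' + 2).
Proof.
move=> /subnK <-; set d := b' - b => h1 h2.
have -> : a' + 2 = (a + 2) + 2 * d + (a' - a - 2 * d) by lia.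
rewrite [d + b]addnC expnD mulnA (expnD _ (a + 2 + 2 * d)).
apply: leq_trans (leq_pmulr _ _); last by rewrite expn_gt0.
by rewrite expnD (expnM 2 2) leq_mul2r h2 orbT.
Qed.

(* Deleting the common root [u], the walks split according to their second
   vertex; the [c] branches contribute [c] edges at [u], and [c <= 2 ^ (c - 1)]. *)
Lemma saw_count u v P : uniq P -> P != [::] -> all (saw u v) P ->
  (size P) ^ 2 * 4 ^ #|supp u P| <= 2 ^ (edges2 (supp u P) + 2).
Proof.
move: {2}(\max_(p <- P) size p) (leqnn (\max_(p <- P) size p)) => n.
elim: n u P => [|n IH] u P sz uP P0 /allP sP.
  have PE p : p \in P -> p = [::].
    by move=> pP; apply/nilP; rewrite /nilp -leqn0 (leq_trans _ sz) // leq_bigmax_seq.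
  have -> : P = [:: [::]].
    case: P P0 uP PE {sz sP} => // p P _ /= /andP[pP _] PE.
    have pE : p = [::] by apply: PE; rewrite inE eqxx.
    subst p; congr (_ :: _); case: P pP PE => // q P; rewrite inE negb_or => /andP[/eqP nq _] PE.
    by case: nq; rewrite (PE q) // !inE eqxx orbT.
  have -> : supp u [:: [::]] = [set u] by apply/setP => x; rewrite !inE /= orbF inE.
  rewrite cards1 /= exp1n mul1n.
  by have := @conn_edges2_ge _ (conn1 u); rewrite cards1; apply: (@leq_pexp2l 2 2).
have [uv|uv] := eqVneq u v.
  have PE p : p \in P -> p = [::].
    move=> /sP /and3P[_ up /eqP lp].
    case: p up lp => // a p; rewrite [uniq _]/= => /andP[+ _] lp.
    by rewrite uv -lp [last _ _]/= mem_last.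
  apply: IH => //; last exact/allP.
  by apply/bigmax_leqP_seq => p pP _; rewrite (PE p pP).
have pn0 p : p \in P -> p != [::].
  by move=> /sP /and3P[_ _ /eqP lp]; apply: contraNneq uv => pE; rewrite -lp pE.
have headE p : p \in P -> p = head u p :: behead p.
  by move=> /pn0; case: p.
pose Q c := [seq behead p | p <- P & head u p == c].
pose Cs := [set c | has (fun p => head u p == c) P].
have QP c q : q \in Q c -> c :: q \in P.
  move=> /mapP[p]; rewrite mem_filter => /andP[/eqP <- pP] ->.
  by rewrite -headE.
have uQ c : uniq (Q c).
  rewrite map_inj_in_uniq ?filter_uniq // => p p'; rewrite !mem_filter.
  move=> /andP[/eqP h pP] /andP[/eqP h' pP'] E.
  by rewrite (headE p) // (headE p') // h h' E.
have sQ c : all (saw c v) (Q c).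
  apply/allP => q /QP /sP /and3P[/= /andP[_ pq] /andP[_ uq] lq].
  by apply/and3P.
have szQ c : \max_(q <- Q c) size q <= n.
  apply/bigmax_leqP_seq => q /QP qP _.
  have := leq_trans (@leq_bigmax_seq _ P predT size _ qP isT) sz.
  by rewrite /= ltnS.
have Qn0 c : c \in Cs -> Q c != [::].
  rewrite inE => /hasP[p pP hp].
  have : behead p \in Q c by apply: map_f; rewrite mem_filter hp.
  by case: (Q c).
pose K' := supp u P :\ u.
have suppQ c : supp c (Q c) \subset K'.
  apply/subsetP => x /suppP[q /QP qP xq]; rewrite !inE.
  have /and3P[_ /andP[nu _] _] := sP _ qP.
  apply/andP; split; first by apply: contraNneq nu => <-.
  by apply/hasP; exists (c :: q) => //; rewrite inE xq orbT.
have uS : u \in supp u P.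
  by case: P P0 {IH sz uP sP pn0 headE Q Cs QP uQ sQ szQ Qn0 K' suppQ} => //= p P _; rewrite inE /= inE eqxx.
have vS c : c \in Cs -> v \in supp c (Q c).
  move=> cC; case E : (Q c) (Qn0 c cC) => [//|q Q'] _.
  have /and3P[_ _ /eqP <-] : saw c v q by apply: (allP (sQ c)); rewrite E inE eqxx.
  by apply/suppP; exists q; [rewrite ?E mem_head|exact: mem_last].
have pathQ c q : q \in Q c -> path e c q.
  by move=> /(allP (sQ c)) /and3P[].
have Cn0 : exists c, c \in Cs.
  case: P P0 headE @Cs {IH sz uP sP pn0 Q QP uQ sQ szQ Qn0 K' suppQ uS vS pathQ} => // p P _ _.
  by exists (head u p); rewrite inE /= eqxx.
have K'E x : x \in K' -> exists2 c, c \in Cs & x \in supp c (Q c).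
  rewrite !inE => /andP[xu /hasP[p pP]]; rewrite inE (negPf xu) /= => xp.
  exists (head u p); first by rewrite inE; apply/hasP; exists p.
  apply/suppP; exists (behead p); last by rewrite -headE.
  by apply: map_f; rewrite mem_filter eqxx.
have cK' : conn K'.
  have [c0 c0C] := Cn0.
  have cc c : c \in Cs -> conn (supp c (Q c)) by move=> cC; apply: conn_supp; [exact: Qn0|exact: pathQ].
  apply: (conn_grow (cc _ c0C) (suppQ _)) => B sB /properP[BK [y yK yB]].
  have [c cC yc] := K'E _ yK.
  have vB : v \in B by apply: (subsetP sB); apply: vS.
  have [a [b [_ aB bK bB ab]]] := conn_boundary (cc _ cC) (vS _ cC) vB yc yB.
  by exists a, b; split=> //; apply: (subsetP (suppQ c)).
have SE : supp u P = u |: K' by rewrite setD1K.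
have uK' : u \notin K' by rewrite !inE eqxx.
have CN : Cs \subset nb e u :&: K'.
  apply/subsetP => c cC; have := cC; rewrite !inE => /hasP[p pP /eqP hp].
  have /and3P[pp up _] := sP _ pP; move: pp up; rewrite (headE p) // hp /= => /andP[-> _].
  rewrite inE negb_or eq_sym => /andP[/andP[-> _] _] /=.
  by apply/hasP; exists p => //; rewrite (headE p) // hp !inE eqxx orbT.
(* By [excess_mono] the bound for the support of a branch can be restated with [K'], which is common
   to all branches. *)
have cntc c : c \in Cs -> (size (Q c)) ^ 2 * 4 ^ #|K'| <= 2 ^ (edges2 K' + 2).
  move=> cC; have := IH c (Q c) (szQ c) (uQ c) (Qn0 c cC) (sQ c).
  have n0 : supp c (Q c) != set0 by apply/set0Pn; exists v; apply: vS.
  have := excess_mono cK' (suppQ c) n0.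
  by move=> h1 h2; apply: exp_shift h2; first exact: subset_leq_card.
have szP : size P = \sum_(c in Cs) size (Q c).
  have -> : size P = \sum_(p <- P) 1 by rewrite sum1_size.
  rewrite big_seq (partition_big (head u) (mem Cs)) /=; last first.
    by move=> p pP; rewrite inE; apply/hasP; exists p.
  apply: eq_bigr => c _; rewrite size_map size_filter -sum1_count.
  by rewrite [RHS]big_seq_cond.
have [M hM] : exists M, (forall c, c \in Cs -> size (Q c) <= M) /\ M ^ 2 * 4 ^ #|K'| <= 2 ^ (edges2 K' + 2).
  have [c0 c0C] := Cn0.
  have [c cC cM] := @eq_bigmax_cond _ (mem Cs) (fun c => size (Q c)) ltac:(by apply/card_gt0P; exists c0).
  exists (size (Q c)); split; last exact: cntc.
  by move=> c' c'C; rewrite -cM; apply: leq_bigmax_cond.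
case: hM => hM1 hM2.
have szM : size P <= #|Cs| * M.
  by rewrite szP -sum_nat_const; apply: leq_sum.
rewrite SE edges2U1 // cardsU1 uK' add1n.
have cN : #|Cs| <= #|nb e u :&: K'| by apply: subset_leq_card.
apply: leq_trans (_ : 2 ^ (edges2 K' + 2 + 2 * #|Cs|) <= _); last first.
  by apply: leq_pexp2l => //; lia.
rewrite (expnD 2) (expnM 2 2).
apply: leq_trans (_ : (#|Cs| ^ 2 * M ^ 2) * (4 * 4 ^ #|K'|) <= _).
  by rewrite (expnS 4) leq_mul2r -expnMn leq_exp2r // szM orbT.
have -> : #|Cs| ^ 2 * M ^ 2 * (4 * 4 ^ #|K'|) = (#|Cs| ^ 2 * 4) * (M ^ 2 * 4 ^ #|K'|) by lia.
by rewrite [X in _ <= X]mulnC leq_mul // sqr_le_4exp.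
Qed.

(** Three such walks lie in a connected set [K] of at most [3 * s] vertices, which sparsity leaves
    with at most [#|K|] edges; [saw_count] would then give [9 * 4 ^ #|K| <= 4 * 4 ^ #|K|]. *)
Lemma saw_le2 s u v P : uniq P -> all (saw u v) P ->
  (forall p, p \in P -> (size p).+1 <= s) ->
  (forall T, conn T -> #|T| <= 3 * s -> edges2 T <= 2 * #|T|) -> size P <= 2.
Proof.
move=> uP sP szP sparse; rewrite leqNgt; apply/negP => P3.
pose Q := take 3 P.
have QP p : p \in Q -> p \in P by apply: mem_take.
have uQ : uniq Q by apply: take_uniq.
have sQ : all (saw u v) Q by apply/allP => p /QP /(allP sP).
have szQ : size Q = 3 by rewrite size_takel.
have Q0 : Q != [::] by apply/eqP => E; rewrite E in szQ.
have := saw_count uQ Q0 sQ; rewrite szQ.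
have cS : conn (supp u Q) by apply: conn_supp => // p /(allP sQ) /and3P[].
have card : #|supp u Q| <= 3 * s.
  have -> : supp u Q = [set x in flatten [seq u :: p | p <- Q]].
    apply/setP => x; rewrite !inE; apply/hasP/flatten_mapP => -[p pQ xp]; by exists p.
  apply: leq_trans (_ : size (flatten [seq u :: p | p <- Q]) <= _).
    by rewrite cardsE; apply: card_size.
  rewrite size_flatten /shape -map_comp sumnE big_map.
  apply: leq_trans (_ : \sum_(p <- Q) s <= _).
    rewrite big_seq_cond [leqLHS]big_seq_cond; apply: leq_sum => p.
    by rewrite andbT => /QP /szP.
  by rewrite big_const_seq count_predT szQ iter_addn_0 mulnC.
have h := sparse _ cS card.
have : 2 ^ (edges2 (supp u Q) + 2) <= 4 * 4 ^ #|supp u Q|.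
  by rewrite addnC expnD leq_mul2l /= -(expnM 2 2) leq_pexp2l.
have : 0 < 4 ^ #|supp u Q| by rewrite expn_gt0.
by lia.
Qed.

End Connected.

(** * A potential for the heavy vertices met by self-avoiding walks *)

Section Potential.
Variables (R : realType) (V : finType) (e : rel V).
Hypotheses (e_sym : symmetric e) (e_irr : irreflexive e).
Variables (h : V -> R) (gam : R).
Implicit Types (F T : {set V}) (w : V).

(* The maximum of [sum (h - gam)] over the subtrees, rooted at [w], of the tree
   of self-avoiding walks of length at most [j] in [F]. *)
Fixpoint phi j F w : R :=
  Num.max 0 (h w - gam +
    if j is j'.+1 then \sum_(c in nb e w :&: (F :\ w)) phi j' (F :\ w) c else 0).

Lemma phi_ge0 j F w : 0 <= phi j F w.
Proof. by case: j => [|j] /=; rewrite le_max lexx. Qed.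

Lemma phi_ge j F w : h w - gam +
  \sum_(c in nb e w :&: (F :\ w)) phi j (F :\ w) c <= phi j.+1 F w.
Proof. by rewrite /= le_max lexx orbT. Qed.

Lemma phi0_ge F w : h w - gam <= phi 0 F w.
Proof. by rewrite /= addr0 le_max lexx orbT. Qed.

Lemma phi_ge_root j F w : h w - gam <= phi j F w.
Proof.
case: j => [|j]; first exact: phi0_ge.
by apply: le_trans (phi_ge _ _ _); rewrite lerDl sumr_ge0 // => c _; apply: phi_ge0.
Qed.

Definition ends w (P : seq (seq V)) := [set x | x \in map (last w) P].

Lemma phi_walks j F w : 0 < phi j F w -> exists P : seq (seq V),
  [/\ uniq P, forall p, p \in P -> [/\ path e w p, uniq (w :: p), (size p <= j)%N &
                                     {subset p <= F}],
      conn e (ends w P), w \in ends w P &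
      phi j F w = \sum_(p <- P) (h (last w p) - gam)].
Proof.
elim: j F w => [|j IH] F w.
  rewrite /= addr0 => pos; exists [:: [::]]; split=> //.
  - by move=> p; rewrite inE => /eqP ->.
  - have -> : ends w [:: [::]] = [set w] by apply/setP => x; rewrite !inE.
    exact: conn1.
  - by rewrite inE mem_head.
  - by move: pos; rewrite big_seq1 lt_max ltxx /= => /ltW /max_r.
move=> pos.
have phiE : phi j.+1 F w =
    h w - gam + \sum_(c in nb e w :&: (F :\ w)) phi j (F :\ w) c.
  by move: pos; rewrite /= lt_max ltxx /= => /ltW /max_r.
have branch (s : seq V) : uniq s -> {subset s <= nb e w :&: (F :\ w)} ->
    exists Q : seq (seq V),
    [/\ uniq Q, forall q, q \in Q -> [/\ path e w q, uniq (w :: q), (size q <= j.+1)%N &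
                                     {subset q <= F}] /\ exists2 c, c \in s & q = c :: behead q,
      conn e (w |: ends w Q) &
      \sum_(c <- s) phi j (F :\ w) c = \sum_(q <- Q) (h (last w q) - gam)].
  elim: s => [|c s IHs] /=.
    move=> _ _; exists [::]; split=> //; last by rewrite !big_nil.
    have -> : w |: ends w [::] = [set w] by apply/setP => x; rewrite !inE orbF.
    exact: conn1.
  move=> /andP[cs us] sub.
  have [v vs|Q [uQ hQ cQ sQ]] := IHs us; first by apply: sub; rewrite inE vs orbT.
  have := phi_ge0 j (F :\ w) c; rewrite le_eqVlt => /predU1P[p0|pp].
    exists Q; split=> //; last by rewrite big_cons -p0 add0r.
    by move=> q /hQ[h1 [d ds qE]]; split=> //; exists d => //; rewrite inE ds orbT.
  have [P [uP hP cP wP sP]] := IH _ _ pp.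
  have /setIP[wc cF] : c \in nb e w :&: (F :\ w) by apply: sub; rewrite inE eqxx.
  rewrite inE in wc; move: (cF); rewrite !inE => /andP[cw cF'].
  exists (map (cons c) P ++ Q); split.
  - rewrite cat_uniq uQ map_inj_uniq ?uP /=; last by move=> p q [].
    rewrite andbT; apply/hasPn => q /hQ[_ [d ds qE]]; apply/mapP => -[p _].
    by rewrite qE => -[dc _]; rewrite -dc ds in cs.
  - move=> q; rewrite mem_cat => /orP[/mapP[p /hP[p1 p2 p3 p4] ->]|/hQ[h1 [d ds qE]]]; last first.
      by split=> //; exists d => //; rewrite inE ds orbT.
    split; last by exists c; rewrite ?inE ?eqxx.
    have pF x : x \in p -> x != w /\ x \in F by move=> /p4; rewrite !inE => /andP[].
    split=> //; first by rewrite /= wc.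
      apply/andP; split=> //; rewrite inE negb_or eq_sym cw /=.
      by apply/negP => /pF[]; rewrite eqxx.
    by move=> x; rewrite inE => /predU1P[->//|/pF[]].
  - have wT : w \notin ends c P.
      rewrite inE; apply/mapP => -[p /hP[_ _ _ p4] E].
      have := mem_last c p; rewrite -E inE eq_sym (negPf cw) /= => /p4.
      by rewrite !inE eqxx.
    have cw' : conn e (w |: ends c P) by apply: (conn_add cP wP wT); rewrite e_sym.
    suff -> : w |: ends w (map (cons c) P ++ Q) = (w |: ends c P) :|: (w |: ends w Q).
      by apply: conn_setU => //; apply/set0Pn; exists w; rewrite !inE eqxx.
    apply/setP => x; rewrite !inE map_cat mem_cat -map_comp.
    by rewrite orbACA orbb.
  - by rewrite big_cons sQ sP big_cat big_map.
have [v|Q [uQ hQ cQ sQ]] := branch (enum (nb e w :&: (F :\ w))) (enum_uniq _).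
  by rewrite mem_enum.
exists ([::] :: Q); split.
- by rewrite /= uQ andbT; apply/negP => /hQ[_ [d _]].
- by move=> q; rewrite inE => /predU1P[->|/hQ[]].
- suff -> : ends w ([::] :: Q) = w |: ends w Q by [].
  by apply/setP => x; rewrite !inE.
- by rewrite inE mem_head.
- by rewrite phiE big_cons -sQ big_enum.
Qed.

Variables (l : nat) (beta : R).
Hypothesis h_ge0 : forall v, 0 <= h v.
Hypothesis beta_ge0 : 0 <= beta.
Hypothesis gam_ge0 : 0 <= gam.
Hypothesis sparse : forall T, conn e T -> (#|T| <= 3 * l.+1)%N -> (edges2 e T <= 2 * #|T|)%N.
Hypothesis light_sum : forall T, conn e T -> \sum_(v in T) h v <= gam / 2 * #|T|%:R + beta.

(** By [saw_le2] a vertex ends at most two walks of the optimal subtree, so [h] sums over the walks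
    to at most twice its sum over their endpoints, that is to [gam * #|T| + 2 * beta]. The charge
    [gam] per walk absorbs the first term. *)
Lemma phi_le F w : phi l F w <= 2 * beta.
Proof.
have := phi_ge0 l F w; rewrite le_eqVlt => /predU1P[<-|pos]; first by rewrite mulr_ge0.
have [P [uP hP cP wP ->]] := phi_walks pos.
set T := ends w P.
have cardT : #|T|%:R <= (size P)%:R :> R.
  by rewrite ler_nat /T /ends cardsE -(size_map (last w)) card_size.
have mult v : (count (fun p => last w p == v) P <= 2)%N.
  rewrite -size_filter; apply: (@saw_le2 _ _ e_sym e_irr l.+1 w v).
  - exact: filter_uniq.
  - by apply/allP => p; rewrite mem_filter => /andP[pv /hP[p1 p2 _ _]]; apply/and3P.
  - by move=> p; rewrite mem_filter => /andP[_ /hP[]].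
  - exact: sparse.
have sumh : \sum_(p <- P) h (last w p) <= 2 * \sum_(v in T) h v.
  rewrite big_seq (partition_big (last w) (mem T)) /=; last first.
    by move=> p pP; rewrite inE map_f.
  rewrite mulr_sumr; apply: ler_sum => v vT.
  rewrite (eq_bigr (fun=> h v)); last by move=> p /andP[_ /eqP ->].
  rewrite -big_seq_cond big_const_seq iter_addr addr0 -[h v *+ _]mulr_natl.
  by rewrite ler_wpM2r // ler_nat mult.
have sumg : \sum_(p <- P) gam = gam * (size P)%:R.
  by rewrite big_const_seq count_predT iter_addr addr0 mulr_natr.
have := light_sum cP; rewrite -/T sumrB sumg => lT.
have : gam * #|T|%:R <= gam * (size P)%:R by rewrite ler_wpM2l.
by lra.
Qed.

End Potential.

(** * Decay of influence *)

Section InfluenceArithmetic.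
Variable R : realFieldType.
Implicit Types m y x u a b p : R.

Lemma light_arith m y x u s s' p a : y <= x + s + s' -> m <= u ->
  s <= 2 * u -> s' <= 2 * (16^-1 * p) -> 3 * u <= a - x -> 0 <= p ->
  m + y <= a + p :> R.
Proof. lra. Qed.

Lemma super_arith x a A b bS bg bP : x <= 16^-1 * (1 + 2 * (A + bS)) -> 0 <= a ->
  bS - bg <= bP -> b * (3 / 4) <= bS -> b = A + 2 -> bg <= 1 -> 2 <= A ->
  x <= a + bP :> R.
Proof. lra. Qed.

Lemma block_arith bh bg bS b2 N A : bh - bg + bS <= b2 -> N <= bh -> bg <= 1 ->
  2 <= A -> N + bS <= A + 1 + b2 :> R.
Proof. lra. Qed.

Lemma block_arith0 bg bS b2 N A : 0 - bg + bS <= b2 -> N <= A -> bg <= 1 ->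
  N + bS <= A + b2 + 1 :> R.
Proof. lra. Qed.

End InfluenceArithmetic.

(** * Contraction along walks in the presence of heavy vertices *)

Section InfluenceBound.
Variables (R : realType) (V : finType) (e : rel V).
Hypotheses (e_sym : symmetric e) (e_irr : irreflexive e).
Variables (m : {set V} -> V -> R) (H : {set V}).
Implicit Types (F T X : {set V}) (w : V).
Hypothesis m_ge0 : forall F w, 0 <= m F w.

Lemma infl_comp (B B' : R) i j F u :
  (forall F' c, c \in F' -> infl e m B j F' c <= B') -> u \in F ->
  infl e m B (i + j) F u <= infl e m B' i F u.
Proof.
move=> h; elim: i F u => [|i IH] F u uF /=; first exact: h.
rewrite lerD2l; apply: ler_sum => w /setIP[_ wF].
by rewrite ler_wpM2l // IH.
Qed.

Variables (D l G0 : nat) (kap q sig A b gam beta : R).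
Hypothesis m_heavy : forall F w, w \in H -> m F w = 1.
Hypothesis m_le : forall F w, w \notin H -> m F w <= kap.
Hypothesis m_light : forall F w, w \notin H -> nb e w :&: (F :&: H) = set0 ->
  m F w * #|nb e w :&: F|%:R <= q.
Hypothesis degH : forall w, w \in H -> (D < #|nb e w|)%N.
Hypothesis degL : forall w, w \notin H -> (#|nb e w| <= D)%N.
Hypothesis D_ge : (32 <= D)%N.
Hypothesis kapD : kap * D%:R <= 2.
Hypotheses (sig_ge1 : 1 <= sig) (sig_le2 : sig <= 2).
Hypothesis A_ge : 6 <= (1 - sig * q) * A.
Hypothesis A_ge2 : 2 <= A.
Hypothesis b_eq : b = A + 2.
Hypotheses (gam_ge0 : 0 <= gam) (gam_le : gam <= 4^-1) (b_gam : b * gam <= 1).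

(** The degree in units of [D]: at a heavy vertex it is at least 1 and measures how strongly the
    walks branch there. *)
Definition hw v : R := if v \in H then #|nb e v|%:R / D%:R else 0.

Lemma hw_ge0 v : 0 <= hw v.
Proof. by rewrite /hw; case: ifP => // _; rewrite divr_ge0. Qed.

(** The weight of the walk tree inflated by [sig] at each light vertex that is passed. If the
    inflated weight is still bounded, the true weight decays geometrically in the number of light
    vertices. *)
Fixpoint tree_weight j F w : R :=
  m F w * (1 + if j is j'.+1 then (if w \in H then 1 else sig) *
     \sum_(c in nb e w :&: (F :\ w)) tree_weight j' (F :\ w) c else 0).

Lemma tree_weight_ge0 j F w : 0 <= tree_weight j F w.
Proof.
elim: j F w => [|j IH] F w /=; rewrite mulr_ge0 // addr_ge0 // mulr_ge0 ?sumr_ge0 //.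
by case: ifP => _ //; apply: le_trans sig_ge1.
Qed.

Let D_gt0 : 0 < D%:R :> R.
Proof. by rewrite ltr0n; apply: leq_trans D_ge. Qed.

Let b_ge0 : 0 <= b.
Proof. by have h := b_eq; have h' := A_ge2; lra. Qed.

Lemma nb_setD1 w F : nb e w :&: (F :\ w) = nb e w :&: F.
Proof.
by apply/setP => x; rewrite !inE; case: eqP => [->|//]; rewrite e_irr.
Qed.

(** Induction on the depth, with [phi] paying for heavy vertices. A heavy vertex has [D * hw]
    children, whose shares [A / D] sum to [A * hw], covered by [b * hw]. A light vertex with a heavy
    neighbour in [F] has rate at most 1/16, and the potential of that neighbour, at least [1 - gam],
    pays for it. A light vertex without heavy neighbours in [F] contracts by [sig * q < 1], and the
    gap times [A] covers the errors. *)
Lemma tree_weight_le j F w :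
  tree_weight j F w <= (if w \in H then 0 else A / D%:R) + b * phi e hw gam j F w.
Proof.
have Dp := D_gt0; have b0 := b_ge0; have bE := b_eq; have A2 := A_ge2.
have s1 := sig_ge1; have s2 := sig_le2; have g0 := gam_ge0; have g4 := gam_le.
have bg := b_gam.
have D32 : 32 <= D%:R :> R by rewrite (ler_nat R 32).
have h1 w' : w' \in H -> 1 <= hw w'.
  by move=> wH; rewrite /hw wH ler_pdivlMr // mul1r ler_nat ltnW // degH.
have kap0 w' : w' \notin H -> 0 <= kap by move=> wH; apply: le_trans (m_le set0 wH).
have kapE : kap <= 2 / D%:R by rewrite ler_pdivlMr.
have Dinv : 2 / D%:R <= 16^-1 :> R by rewrite ler_pdivrMr //; lra.
elim: j F w => [|j IH] F w.
  rewrite /= !addr0 mulr1; case: ifP => wH.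
    have := phi0_ge e hw gam F w; rewrite /= addr0 => h2.
    have h3 := h1 _ wH; rewrite m_heavy // add0r.
    apply: (@le_trans _ _ (b * (1 - gam))); first by lra.
    by rewrite ler_wpM2l // (le_trans _ h2) // lerD2r.
  apply: le_trans (m_le F (negbT wH)) _; apply: le_trans kapE _.
  apply: (@le_trans _ _ (A / D%:R)); first by rewrite ler_pM2r ?invr_gt0.
  by rewrite lerDl mulr_ge0 // le_max lexx.
set S := \sum_(c in nb e w :&: (F :\ w)) phi e hw gam j (F :\ w) c.
have S0 : 0 <= S by apply: sumr_ge0 => c _; apply: phi_ge0.
have Phi := phi_ge e hw gam j F w; rewrite -/S in Phi.
set Ph := phi _ _ _ _ _ _ in Phi *.
have Ph0 : 0 <= Ph by apply: phi_ge0.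
have sumE : \sum_(c in nb e w :&: (F :\ w)) tree_weight j (F :\ w) c <=
    #|nb e w :&: F|%:R * (A / D%:R) + b * S.
  rewrite -(nb_setD1 w F) [_%:R * _]mulrC mulr_card /S mulr_sumr -big_split /=.
  apply: ler_sum => c _; apply: le_trans (IH _ _) _.
  by rewrite lerD2r; case: ifP => // _; rewrite divr_ge0 // ltW // (lt_le_trans _ A2).
have nbF : #|nb e w :&: F|%:R <= #|nb e w|%:R :> R by rewrite ler_nat subset_leq_card // subsetIl.
have AD0 : 0 <= A / D%:R :> R by rewrite divr_ge0 ?(ltW Dp) // (le_trans _ A2).
rewrite [tree_weight _ _ _]/=; set W := \sum_(c in _) _ in sumE *.
have W0 : 0 <= W by apply: sumr_ge0 => c _; apply: tree_weight_ge0.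
case: ifP => [wH|/negbT wH].
  rewrite m_heavy // !mul1r add0r.
  have hE : #|nb e w|%:R * (A / D%:R) = hw w * A by rewrite /hw wH mulrA mulrAC.
  have h2 := h1 _ wH.
  have : #|nb e w :&: F|%:R * (A / D%:R) <= hw w * A by rewrite -hE ler_wpM2r.
  have : b * (hw w - gam + S) <= b * Ph by rewrite ler_wpM2l.
  by rewrite bE; rewrite bE in bg sumE; nra.
have hw0 : hw w = 0 by rewrite /hw (negPf wH).
rewrite hw0 in Phi.
have mk := m_le F wH; have m0 := m_ge0 F w; have k0 := kap0 w wH.
have [noH|/set0Pn[c]] := eqVneq (nb e w :&: (F :&: H)) set0.
  have ml := m_light wH noH.
  have [mW] : m F w * W <= q * (A / D%:R) + m F w * (b * S).
    apply: (@le_trans _ _ (m F w * (#|nb e w :&: F|%:R * (A / D%:R) + b * S))).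
      by rewrite ler_wpM2l.
    by rewrite mulrDr lerD2r mulrA ler_wpM2r.
  have mS : m F w * (b * S) <= 2 / D%:R * (b * (Ph + gam)).
    apply: ler_pM; rewrite ?mulr_ge0 //; first exact: le_trans kapE.
    by rewrite ler_wpM2l //; lra.
  have Dbg : 2 / D%:R * (b * gam) <= 2 / D%:R by rewrite ger_pMr // divr_gt0.
  have DbP : 2 / D%:R * (b * Ph) <= 16^-1 * (b * Ph) by rewrite ler_wpM2r // mulr_ge0.
  have bP0 : 0 <= b * Ph by rewrite mulr_ge0.
  (* The 6 of [A_ge] is three times the 2 of [kapD]: one share [2 / D] for [m F w] and two for the
     term in [gam], as [sig <= 2]. *)
  have key : 6 / D%:R <= (1 - sig * q) * A / D%:R by rewrite ler_pM2r ?invr_gt0 // A_ge.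
  have DE : 6 / D%:R = 3 * (2 / D%:R) :> R by ring.
  have qE : (1 - sig * q) * A / D%:R = A / D%:R - sig * (q * (A / D%:R)) by ring.
  rewrite DE qE in key.
  have sW : sig * (m F w * W) <= sig * (q * (A / D%:R) + 2 / D%:R + 16^-1 * (b * Ph)).
    rewrite ler_wpM2l ?(le_trans ler01) //; apply: le_trans mW _.
    rewrite -addrA lerD2l; apply: le_trans mS _.
    by rewrite !mulrDr addrC lerD.
  have mk2 : m F w <= 2 / D%:R by apply: le_trans kapE.
  have -> : m F w * (1 + sig * W) = m F w + sig * (m F w * W) by ring.
  have sD : sig * (2 / D%:R) <= 2 * (2 / D%:R) by rewrite ler_wpM2r // divr_ge0 // ltW.
  have sP : sig * (16^-1 * (b * Ph)) <= 2 * (16^-1 * (b * Ph)).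
    by rewrite ler_wpM2r // mulr_ge0 ?invr_ge0.
  rewrite !mulrDr in sW.
  exact: light_arith sW mk2 sD sP key bP0.
rewrite inE => /andP[wc /setIP[cF cH]].
have S1 : 1 - gam <= S.
  have cN : c \in nb e w :&: (F :\ w) by rewrite (nb_setD1 w F) inE wc.
  rewrite /S (bigD1 c) //=; apply: (@le_trans _ _ (phi e hw gam j (F :\ w) c)).
    by apply: le_trans (phi_ge_root _ _ _ _ _ _); rewrite lerD2r h1.
  by rewrite lerDl sumr_ge0 // => c' _; apply: phi_ge0.
have WA : W <= A + b * S.
  apply: le_trans sumE _; rewrite lerD2r mulrCA ger_pMr; last by lra.
  rewrite ler_pdivrMr // mul1r; apply: le_trans nbF _.
  by rewrite ler_nat degL.
have bP : b * (S - gam) <= b * Ph by rewrite ler_wpM2l //; lra.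
have bS0 : 0 <= b * S by rewrite mulr_ge0.
have sW : sig * W <= 2 * (A + b * S).
  by apply: ler_pM => //; apply: le_trans sig_ge1.
have m16 : m F w <= 16^-1 by apply: le_trans mk (le_trans kapE Dinv).
have : m F w * (1 + sig * W) <= 16^-1 * (1 + 2 * (A + b * S)).
  have sW0 : 0 <= sig * W by rewrite mulr_ge0 // (le_trans ler01).
  by apply: ler_pM; rewrite ?lerD2l ?addr_ge0.
have bS2 : b * (3 / 4) <= b * S by rewrite ler_wpM2l //; lra.
rewrite mulrBr in bP.
by move=> h; apply: super_arith h AD0 bP bS2 bE bg A2.
Qed.

Hypothesis few_heavy : forall T, conn e T -> (#|T| <= l.+2)%N -> (#|T :&: H| <= G0)%N.

Lemma infl_tree_weight (B : R) j F w X : 0 <= B ->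
  w \in F -> [disjoint F & X] -> conn e (w |: X) -> (#|X| + j < l.+2)%N ->
  m F w * infl e m B j F w <=
  (1 + B * sig ^+ (G0 - #|X :&: H|) * sig ^- j) * tree_weight j F w.
Proof.
move=> B0; have sp : 0 < sig by apply: lt_le_trans sig_ge1.
elim: j F w X => [|j IH] F w X wF FX cX szX.
  rewrite /= addr0 mulr1 expr0 invr1 mulr1 mulrC ler_wpM2r //.
  apply: (@le_trans _ _ (B * sig ^+ (G0 - #|X :&: H|))).
    by rewrite -{1}[B]mulr1 ler_wpM2l // exprn_ege1.
  by rewrite lerDr.
have wX : w \notin X by move: FX => /pred0P/(_ w) /=; rewrite wF /= => ->.
rewrite [infl _ _ _ _ _ _]/= [tree_weight _ _ _]/=.
set g := #|X :&: H|.
have gG : (#|(w |: X) :&: H| <= G0)%N.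
  apply: few_heavy => //; rewrite cardsU1 wX add1n.
  by apply: leq_trans szX; rewrite ltnS leq_addr.
set Y := B * sig ^+ (G0 - #|(w |: X) :&: H|) * sig ^- j.
have Y0 : 0 <= Y by rewrite !mulr_ge0 ?invr_ge0 ?exprn_ge0 // ltW.
set W := \sum_(c in _) tree_weight j _ c.
have W0 : 0 <= W by apply: sumr_ge0 => c _; apply: tree_weight_ge0.
have step : \sum_(c in nb e w :&: (F :\ w)) m (F :\ w) c * infl e m B j (F :\ w) c <=
    (1 + Y) * W.
  rewrite mulr_sumr; apply: ler_sum => c; rewrite inE => /andP[wc cF].
  apply: IH => //.
  - rewrite disjoint_subset; apply/subsetP => x; rewrite !inE => /andP[xw xF].
    by rewrite (negPf xw) /=; move: FX => /pred0P/(_ x) /=; rewrite xF /= => ->.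
  - apply: (conn_add cX (setU11 w X)); last by move: wc; rewrite inE.
    move: cF; rewrite !inE => /andP[cw cF]; rewrite negb_or cw /=.
    by move: FX => /pred0P/(_ c) /=; rewrite cF /= => ->.
  - by rewrite cardsU1 wX add1n addSnnS.
have sj : sig ^- j.+1 = sig ^- j / sig by rewrite exprSr invfM.
case: ifP => wH.
  have gE : #|(w |: X) :&: H| = g.+1.
    rewrite setIUl; have -> : [set w] :&: H = [set w].
      by apply/setP => x; rewrite !inE; case: eqP => [->|].
    by rewrite cardsU1 inE (negPf wX).
  have YE : B * sig ^+ (G0 - g) * sig ^- j.+1 = Y.
    rewrite /Y gE sj; have -> : (G0 - g = (G0 - g.+1).+1)%N by rewrite subnSK // -gE.
    have sn : sig != 0 by rewrite gt_eqF.
    by rewrite exprS; field; rewrite ?expf_neq0 ?sn.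
  rewrite YE m_heavy // !mul1r; apply: (@le_trans _ _ (1 + (1 + Y) * W)).
    by rewrite lerD2l.
  by rewrite mulrDr mulr1 lerD2r lerDl.
have gE : #|(w |: X) :&: H| = g.
  rewrite setIUl; have -> : [set w] :&: H = set0.
    by apply/setP => x; rewrite !inE; case: eqP => [->|].
  by rewrite set0U.
have YE : B * sig ^+ (G0 - g) * sig ^- j.+1 = Y / sig.
  by rewrite /Y gE sj mulrA.
rewrite YE mulrCA ler_wpM2l //.
apply: (@le_trans _ _ (1 + (1 + Y) * W)); first by rewrite lerD2l.
have -> : (1 + Y / sig) * (1 + sig * W) = 1 + Y / sig + (sig + Y) * W.
  by field; rewrite gt_eqF.
have Ys : 0 <= Y / sig by rewrite divr_ge0 // ltW.
have : (1 + Y) * W <= (sig + Y) * W by rewrite ler_wpM2r // lerD2r.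
by apply: lerD; rewrite lerDl.
Qed.

Hypothesis beta_ge0 : 0 <= beta.
Hypothesis sparse : forall T, conn e T -> (#|T| <= 3 * l.+2)%N -> (edges2 e T <= 2 * #|T|)%N.
Hypothesis light_sum : forall T, conn e T -> \sum_(v in T) hw v <= gam / 2 * #|T|%:R + beta.

Lemma infl_block B F u : 0 <= B -> u \in F ->
  infl e m B l.+1 F u <= 1 + (1 + B * (sig ^+ G0 * sig ^- l)) * (A + 1 + b * (2 * beta)).
Proof.
move=> B0 uF; rewrite /= lerD2l.
set Q := 1 + B * _.
have sp : 0 < sig by apply: lt_le_trans sig_ge1.
have Q0 : 0 <= Q by rewrite addr_ge0 // !mulr_ge0 ?invr_ge0 ?exprn_ge0 // ltW.
apply: (@le_trans _ _ (Q * \sum_(c in nb e u :&: (F :\ u)) tree_weight l (F :\ u) c)).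
  rewrite mulr_sumr; apply: ler_sum => c /setIP[uc cF].
  have cu : c != u by move: cF; rewrite !inE => /andP[].
  apply: le_trans (@infl_tree_weight B l (F :\ u) c [set u] B0 cF _ _ _) _.
  - by rewrite disjoint_sym disjoints1 !inE eqxx.
  - apply: (conn_add (conn1 e u) (set11 u)); first by rewrite inE.
    by move: uc; rewrite inE.
  - by rewrite cards1.
  - rewrite ler_wpM2r ?tree_weight_ge0 // lerD2l -mulrA ler_wpM2l //.
    by rewrite ler_wpM2r ?invr_ge0 ?exprn_ge0 ?(ltW sp) // ler_weXn2l // leq_subr.
rewrite ler_wpM2l //.
have Dp := D_gt0; have A2 := A_ge2; have b0 := b_ge0; have bg := b_gam.
set S := \sum_(c in nb e u :&: (F :\ u)) phi e hw gam l (F :\ u) c.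
apply: (@le_trans _ _ (#|nb e u :&: F|%:R * (A / D%:R) + b * S)).
  rewrite -(nb_setD1 u F) [_%:R * _]mulrC mulr_card /S mulr_sumr -big_split /=.
  apply: ler_sum => c _; apply: le_trans (tree_weight_le _ _ _) _.
  by rewrite lerD2r; case: ifP => // _; rewrite divr_ge0 //; lra.
have Phi := phi_ge e hw gam l F u; rewrite -/S in Phi.
have Phi2 : phi e hw gam l.+1 F u <= 2 * beta by apply: phi_le => //; exact: hw_ge0.
have nbF : #|nb e u :&: F|%:R <= #|nb e u|%:R :> R by rewrite ler_nat subset_leq_card // subsetIl.
have AD0 : 0 <= A / D%:R :> R by rewrite divr_ge0 //; lra.
have bP : b * (hw u - gam + S) <= b * (2 * beta) by rewrite ler_wpM2l // (le_trans Phi).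
have NA : #|nb e u :&: F|%:R * (A / D%:R) <= #|nb e u|%:R * (A / D%:R) by rewrite ler_wpM2r.
have [uH|uH] := boolP (u \in H).
  have hE : #|nb e u|%:R * (A / D%:R) = hw u * A by rewrite /hw uH mulrA mulrAC.
  have h0 := hw_ge0 u; have bE := b_eq.
  have : hw u * A <= b * hw u by rewrite bE mulrC ler_wpM2r //; lra.
  rewrite hE in NA; move: bP; rewrite mulrDr mulrBr => bP hb.
  exact: block_arith bP (le_trans NA hb) bg A2.
have : #|nb e u|%:R * (A / D%:R) <= A.
  by rewrite mulrCA ger_pMr ?ler_pdivrMr ?mul1r ?ler_nat ?degL // (lt_le_trans _ A2).
have hw0 : hw u = 0 by rewrite /hw (negPf uH).
move: bP; rewrite hw0 mulrDr mulrBr mulr0 => bP hA.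
rewrite addrAC; exact: block_arith0 bP (le_trans NA hA) bg.
Qed.

End InfluenceBound.

(** * Revealing random vertices *)

Section RevealStep.
Variables (R : realType) (V C : finType).
Local Notation coloring := {ffun V -> C}.
Variables (Om : {set coloring}) (La W : {set V}) (I : R).
Implicit Types (x y z : coloring) (f g h : coloring -> R).
Hypothesis I_ge1 : 1 <= I.
Hypothesis influence : forall x f lam u a b, x \in Om -> lipschitz lam f -> u \in W ->
  site (fiber Om La x) u a != set0 -> site (fiber Om La x) u b != set0 ->
  `|avg (site (fiber Om La x) u a) f - avg (site (fiber Om La x) u b) f| <= lam * I.

(** The operator whose quadratic form at [g] is the sum over [u] in [W] of the variance of [g]
    explained by the colour of [u], for [g] of mean 0 given [La]. *)
Definition cond_total h x := \sum_(u in W) cond Om (u |: La) h x.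

Definition osc_le K h := forall x y u, x \in Om -> y \in Om -> agree La x y -> u \in W ->
  `|cond Om (u |: La) h x - cond Om (u |: La) h y| <= K.

Lemma fiber_setU1 u x y : x \in Om -> y \in fiber Om La x ->
  fiber Om (u |: La) y = site (fiber Om La x) u (y u).
Proof.
move=> xO; rewrite inE => /andP[yO /agreeP xy]; apply/setP => z; rewrite !inE -andbA.
congr (_ && _); apply/agreeP/andP => [h|[/agreeP h /eqP zu] v].
  split; last by rewrite -h // !inE eqxx.
  by apply/agreeP => v vL; rewrite xy // h // !inE vL orbT.
by rewrite !inE => /predU1P[->//|vL]; rewrite -xy // h.
Qed.

Lemma cond_setU1 u h x y : x \in Om -> y \in fiber Om La x ->
  cond Om (u |: La) h y = avg (site (fiber Om La x) u (y u)) h.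
Proof. by move=> xO yx; rewrite /cond (fiber_setU1 u xO yx). Qed.

Lemma osc_cond_le K h x u : osc_le K h -> x \in Om -> u \in W -> cond Om La h x = 0 ->
  `|cond Om (u |: La) h x| <= K.
Proof.
move=> osc xO uW c0; rewrite -[X in `|X|]subr0 -c0 -(cond_condr Om h x (subsetUr [set u] La)).
rewrite -[X in X - _](avg_cst (cond Om (u |: La) h x) (fiber_n0 La xO)).
rewrite /cond -avgB /avg normrM normfV normr_nat.
rewrite ler_pdivrMr ?ltr0n ?card_gt0 ?fiber_n0 //; apply: le_trans (ler_norm_sum _ _ _) _.
rewrite mulr_card; apply: ler_sum => y; rewrite inE => /andP[yO xy].
exact: osc.
Qed.

Lemma cond_total_mean0 h : {in Om, cond Om La h =1 fun=> 0} ->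
  {in Om, cond Om La (cond_total h) =1 fun=> 0}.
Proof.
move=> h0 x xO; rewrite /cond_total cond_sum big1 // => u _.
by rewrite cond_condr ?h0 // subsetUr.
Qed.

(** On a fibre [cond_total h] is a sum of functions of one colour each, of oscillation at most [K],
    hence is [K]-Lipschitz; the influence hypothesis then bounds the oscillation of its conditional
    means. *)
Lemma cond_total_osc K h : 0 <= K -> {in Om, cond Om La h =1 fun=> 0} ->
  osc_le K h -> osc_le (K * I) (cond_total h).
Proof.
move=> K0 h0 osc x y u xO yO xy uW.
pose S := fiber Om La x.
have xS : x \in S by apply: mem_fiber.
have yS : y \in S by rewrite inE yO xy.
pose F z := \sum_(w in W) avg (site S w (z w)) h.
have FE z : z \in S -> cond_total h z = F z.
  by move=> zS; apply: eq_bigr => w _; rewrite (cond_setU1 w h xO zS).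
have siteP w c : site S w c = set0 \/ exists z, [/\ z \in S, z \in Om, agree La x z & z w = c].
  have [->|/set0Pn[z]] := eqVneq (site S w c) set0; first by left.
  rewrite inE => /andP[zS /eqP zc]; right; exists z; split=> //.
    by move: zS; rewrite inE => /andP[].
  by move: zS; rewrite inE => /andP[].
have E0 w c : site S w c = set0 -> avg (site S w c) h = 0.
  by move=> ->; rewrite /avg big_set0 mul0r.
(* [F] has to be Lipschitz on all colourings, also where a site of the fibre is empty and its
   average is the default 0. The other average is then at most [K] in absolute value since [h] has
   conditional mean 0. *)
have lipF : lipschitz K F.
  move=> z v c; have [vW|vW] := boolP (v \in W); last first.
    rewrite /F [X in _ - X](eq_bigr (fun w => avg (site S w (z w)) h)) ?subrr ?normr0 //.
    by move=> w wW; rewrite ffunE; case: eqP => // wv; rewrite -wv wW in vW.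
  rewrite /F (bigD1 v) //= [X in _ - X](bigD1 v) //=.
  rewrite [X in _ - (_ + X)](eq_bigr (fun w => avg (site S w (z w)) h)); last first.
    by move=> w /andP[_ wv]; rewrite ffunE (negPf wv).
  rewrite opprD addrACA subrr addr0 ffunE eqxx.
  have [E1|[z1 [z1S z1O xz1 <-]]] := siteP v (z v); have [E2|[z2 [z2S z2O xz2 <-]]] := siteP v c.
  - by rewrite !E0 // subrr normr0.
  - rewrite (E0 _ _ E1) sub0r normrN -(cond_setU1 v h xO z2S).
    by apply: osc_cond_le => //; apply: h0.
  - rewrite (E0 _ _ E2) subr0 -(cond_setU1 v h xO z1S).
    by apply: osc_cond_le => //; apply: h0.
  - rewrite -(cond_setU1 v h xO z1S) -(cond_setU1 v h xO z2S); apply: osc => //.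
    by apply: agree_trans xz2; rewrite agree_sym.
have avgE z : z \in S -> cond Om (u |: La) (cond_total h) z = avg (site S u (z u)) F.
  move=> zS; rewrite (cond_setU1 u _ xO zS); apply: eq_avg => w.
  by rewrite inE => /andP[wS _]; apply: FE.
rewrite !avgE //; apply: influence => //; apply/set0Pn; first by exists x; rewrite inE xS eqxx.
by exists y; rewrite inE yS eqxx.
Qed.

Lemma cond_total_sym g h : inner Om (cond_total g) h = inner Om g (cond_total h).
Proof.
rewrite inner_suml [RHS]innerC inner_suml; apply: eq_bigr => u _.
by rewrite cond_sym innerC.
Qed.

(** Each application multiplies oscillations by at most [I], so squared norms of iterates grow at
    most like [I ^ (2 * j)], and [sym_iter_bound] gives the same rate for one step. *)
Lemma cond_total_bound g : {in Om, cond Om La g =1 fun=> 0} ->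
  norm2 Om (cond_total g) <= I ^+ 2 * norm2 Om g.
Proof.
move=> g0.
pose K := \sum_(u in W) \sum_(x in Om) `|cond Om (u |: La) g x| *+ 2.
have K0 : 0 <= K by apply: sumr_ge0 => u _; apply: sumr_ge0 => x _; rewrite mulrn_wge0.
have I0 : 0 <= I by apply: le_trans I_ge1.
have iter_ok j : {in Om, cond Om La (iter j cond_total g) =1 fun=> 0} /\
    osc_le (K * I ^+ j) (iter j cond_total g).
  elim: j => [|j [IH1 IH2]].
    split=> // x y u xO yO _ uW; rewrite expr0 mulr1.
    have bnd z : z \in Om -> `|cond Om (u |: La) g z| *+ 2 <= K.
      move=> zO; rewrite /K (bigD1 u) //= (bigD1 z) //=.
      rewrite -addrA lerDl addr_ge0 //; apply: sumr_ge0 => v _; rewrite ?mulrn_wge0 //.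
      by apply: sumr_ge0 => ? _; rewrite mulrn_wge0.
    apply: le_trans (ler_normB _ _) _.
    by have := bnd x xO; have := bnd y yO; rewrite !mulr2n; lra.
  split; first exact: cond_total_mean0.
  rewrite exprSr mulrA iterS; apply: cond_total_osc => //.
  by rewrite mulr_ge0 // exprn_ge0.
pose B := norm2 Om g + #|Om|%:R * (#|W|%:R * K) ^+ 2.
apply: (@sym_iter_bound R V C Om cond_total g B); first exact: sqr_ge0.
  exact: cond_total_sym.
have r1 j : 1 <= (I ^+ 2) ^+ j by rewrite exprn_ege1 // exprn_ege1.
case=> [|j].
  by rewrite expr0 mulr1 lerDl mulr_ge0 // sqr_ge0.
have [h1 h2] := iter_ok j.
apply: (@le_trans _ _ (#|Om|%:R * (#|W|%:R * (K * I ^+ j)) ^+ 2)).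
  rewrite mulrC mulr_card iterS; apply: ler_sum => x xO.
  rewrite -[leLHS]real_normK ?num_real // ler_sqr ?nnegrE //; last first.
    by rewrite !mulr_ge0 // exprn_ge0.
  apply: le_trans (ler_norm_sum _ _ _) _.
  rewrite mulrC mulr_card; apply: ler_sum => u uW.
  by apply: osc_cond_le => //; apply: h1.
have -> : (#|W|%:R * (K * I ^+ j)) ^+ 2 = (#|W|%:R * K) ^+ 2 * (I ^+ 2) ^+ j.
  by rewrite mulrA exprMn -!exprM mulnC.
rewrite mulrA; apply: (@le_trans _ _ (B * (I ^+ 2) ^+ j)).
  by rewrite ler_wpM2r ?(le_trans ler01) // lerDr norm2_ge0.
rewrite ler_wpM2l ?addr_ge0 ?norm2_ge0 ?mulr_ge0 ?sqr_ge0 //.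
by rewrite ler_weXn2l ?exprn_ege1.
Qed.

Lemma reveal_sum_le f :
  \sum_(u in W) norm2 Om (cond Om (u |: La) (fun x => f x - cond Om La f x)) <=
  I * norm2 Om (fun x => f x - cond Om La f x).
Proof.
set g := fun x => f x - cond Om La f x.
have g0 : {in Om, cond Om La g =1 fun=> 0}.
  by move=> x xO; rewrite condB cond_condl // subrr.
have -> : \sum_(u in W) norm2 Om (cond Om (u |: La) g) = inner Om g (cond_total g).
  rewrite innerC inner_suml; apply: eq_bigr => u _.
  by rewrite -inner_cond innerC.
have I0 : 0 <= I by apply: le_trans I_ge1.
have n0 := norm2_ge0 Om g.
apply: le_trans (ler_norm _) _.
rewrite -ler_sqr ?nnegrE ?mulr_ge0 // real_normK ?num_real //.
apply: le_trans (inner_sqr_le _ _ _) _.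
rewrite exprMn [I ^+ 2 * _]mulrC expr2 -mulrA ler_wpM2l // mulrC.
exact: cond_total_bound.
Qed.

(** Revealing [u] lowers the mean conditional variance by the part that [u] explains, and by
    [reveal_sum_le] these parts sum over [W] to at most [I] times the variance. *)
Lemma reveal_step f : W \subset ~: La ->
  \sum_(u in W) Dir Om (~: (u |: La)) f >= (#|W|%:R - I) * Dir Om (~: La) f.
Proof.
move=> WLa; have h := reveal_sum_le f; set g := (fun x => _ - _) in h.
have E u : u \in W -> Dir Om (~: (u |: La)) f = Dir Om (~: La) f - norm2 Om (cond Om (u |: La) g).
  move=> uW; rewrite !DirE !setCK.
  have -> : norm2 Om (cond Om (u |: La) g) =
      norm2 Om (cond Om (u |: La) f) - norm2 Om (cond Om La f).
    have s : La \subset u |: La by apply: subsetUr.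
    rewrite -(eq_norm2 (fun x _ => cond_condr Om f x s)) -norm2_condB.
    apply: eq_norm2 => x xO; rewrite condB cond_condl //.
    by rewrite cond_condr.
  by rewrite opprB addrA subrK.
rewrite (eq_bigr _ E) sumrB -mulr_card mulrBl [Dir _ _ _ * _]mulrC lerB //.
by move: h; rewrite /Dir setCK.
Qed.

End RevealStep.

(** * Random draws with replacement *)

Section Draws.
Variables (R : realType) (V : finType) (M : {set V}).
Implicit Types (La U L : {set V}) (F G : {set V} -> R).

Definition add_draw La u := if u \in M then u |: La else La.

(* Expectation of [F] after [t] uniform draws from [V], only those in [M] being
   recorded. *)
Fixpoint edraw t F La : R :=
  if t is t'.+1 then #|V|%:R^-1 * \sum_u edraw t' F (add_draw La u) else F La.

Lemma add_draw_sub La u : La \subset M -> add_draw La u \subset M.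
Proof.
by move=> h; rewrite /add_draw; case: ifP => // uM; rewrite subUset sub1set uM.
Qed.

Lemma edraw_le t F G La : La \subset M ->
  (forall L, L \subset M -> F L <= G L) -> edraw t F La <= edraw t G La.
Proof.
move=> LM h; elim: t La LM => [|t IH] La LM /=; first exact: h.
by rewrite ler_wpM2l ?invr_ge0 //; apply: ler_sum => u _; apply: IH; apply: add_draw_sub.
Qed.

Lemma edrawD t F G La : edraw t (fun L => F L + G L) La = edraw t F La + edraw t G La.
Proof.
elim: t La => [|t IH] La //=; under eq_bigr do rewrite IH.
by rewrite big_split mulrDr.
Qed.

Lemma edrawZ t c F La : edraw t (fun L => c * F L) La = c * edraw t F La.
Proof.
elim: t La => [|t IH] La //=; under eq_bigr do rewrite IH.
by rewrite -mulr_sumr mulrCA.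
Qed.

Lemma edraw_sum t (J : Type) (s : seq J) (P : pred J) (F : J -> {set V} -> R) La :
  edraw t (fun L => \sum_(i <- s | P i) F i L) La = \sum_(i <- s | P i) edraw t (F i) La.
Proof.
elim: t La => [|t IH] La //=; under eq_bigr do rewrite IH.
by rewrite exchange_big mulr_sumr.
Qed.

Hypothesis V_gt0 : (0 < #|V|)%N.

Lemma edraw_cst t c La : edraw t (fun=> c) La = c.
Proof.
elim: t La => [|t IH] La //=; under eq_bigr do rewrite IH.
rewrite sumr_const -[c *+ _]mulr_natl mulrA mulVf ?mul1r //.
by rewrite pnatr_eq0 -lt0n.
Qed.

Lemma draw_avoid t U La : U \subset M ->
  edraw t (fun L => (U :&: L == set0)%:R) La <= (1 - #|U|%:R / #|V|%:R) ^+ t.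
Proof.
move=> UM.
have Vp : 0 < #|V|%:R :> R by rewrite ltr0n.
have q0 : 0 <= 1 - #|U|%:R / #|V|%:R :> R.
  by rewrite subr_ge0 ler_pdivrMr // mul1r ler_nat max_card.
elim: t La => [|t IH] La /=; first by rewrite expr0; case: eqP.
have avoid0 t' L u : u \in U -> u \in L -> edraw t' (fun L => (U :&: L == set0)%:R : R) L = 0.
  move=> uU; elim: t' L => [|t' IH'] L uL /=.
    by case: eqP => // E; have : u \in U :&: L by [rewrite inE uU uL]; rewrite E inE.
  by rewrite big1 ?mulr0 // => v _; rewrite IH' // /add_draw; case: ifP => // _; rewrite inE uL orbT.
rewrite (bigID (mem U)) /= big1 ?add0r; last first.
  move=> u uU; apply: (avoid0 _ _ u) => //.
  by rewrite /add_draw (subsetP UM) // !inE eqxx.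
apply: (@le_trans _ _ (#|V|%:R^-1 * \sum_(u in ~: U) (1 - #|U|%:R / #|V|%:R) ^+ t)).
  rewrite ler_wpM2l ?invr_ge0 //.
  rewrite [X in X <= _](eq_bigl (mem (~: U))); last by move=> u; rewrite !inE.
  by apply: ler_sum => u _; apply: IH.
rewrite -mulr_card mulrCA exprSr ler_wpM2l ?exprn_ge0 //.
rewrite cardsCs setCK natrB ?max_card //.
by rewrite mulrC mulrBl divff ?gt_eqF.
Qed.

End Draws.

Section RevealFinal.
Variables (R : realType) (V C : finType) (Om : {set {ffun V -> C}}) (M : {set V}) (I : R).
Hypothesis V_gt0 : (0 < #|V|)%N.
Hypothesis I_ge1 : 1 <= I.
Hypothesis I_le : I <= #|V|%:R.
Hypothesis influence : forall (La : {set V}), La \subset M ->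
  forall x (f : {ffun V -> C} -> R) lam u a b,
  x \in Om -> lipschitz lam f -> u \in M :\: La ->
  site (fiber Om La x) u a != set0 -> site (fiber Om La x) u b != set0 ->
  `|avg (site (fiber Om La x) u a) f - avg (site (fiber Om La x) u b) f| <= lam * I.

Lemma edraw_Dir_ge t f (La : {set V}) : La \subset M ->
  (1 - I / #|V|%:R) ^+ t * Dir Om (~: La) f <= edraw M t (fun L => Dir Om (~: L) f) La.
Proof.
have Vp : 0 < #|V|%:R :> R by rewrite ltr0n.
have q0 : 0 <= 1 - I / #|V|%:R by rewrite subr_ge0 ler_pdivrMr // mul1r.
elim: t La => [|t IH] La LM /=; first by rewrite mul1r.
apply: (@le_trans _ _ (#|V|%:R^-1 * \sum_u (1 - I / #|V|%:R) ^+ t * Dir Om (~: add_draw M La u) f)).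
  rewrite -mulr_sumr mulrCA exprSr -mulrA ler_wpM2l ?exprn_ge0 //.
  rewrite -(ler_pM2l Vp) !mulrA divff ?gt_eqF // mul1r mulrBr mulr1 mulrCA divff ?gt_eqF // mulr1.
  pose W := M :\: La.
  have WLa : W \subset ~: La by apply/subsetP => u; rewrite !inE => /andP[].
  have := reveal_step I_ge1 (influence LM) f WLa; rewrite -/W => h.
  rewrite (bigID (mem W)) /=.
  have -> : \sum_(u in W) Dir Om (~: add_draw M La u) f = \sum_(u in W) Dir Om (~: (u |: La)) f.
    by apply: eq_bigr => u; rewrite !inE /add_draw => /andP[_ ->].
  have -> : \sum_(u | u \notin W) Dir Om (~: add_draw M La u) f = #|~: W|%:R * Dir Om (~: La) f.
    rewrite mulrC mulr_card; apply: eq_big => [u|u]; first by rewrite !inE.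
    rewrite !inE negb_and negbK /add_draw; case: ifP => //= uM; rewrite orbF => uL.
    by rewrite (setUidPr _) // sub1set.
  apply: le_trans (lerD h (lexx _)); rewrite -mulrDl ler_wpM2r ?Dir_ge0 //.
  by rewrite -(cardsC W) natrD addrAC.
rewrite ler_wpM2l ?invr_ge0 //; apply: ler_sum => u _.
by apply: IH; apply: add_draw_sub.
Qed.

(** Where the revealed set is not nice, only the monotonicity of [Dir] is available. The probability
    of this is at most half of the surviving fraction of the variance, so the other half must come
    from nice sets. *)
Lemma reveal_final t (f : {ffun V -> C} -> R) (nice : {set V} -> bool) (K : R) :
  (forall La : {set V}, La \subset M -> nice La -> Dir Om (~: La) f <= K) ->
  edraw M t (fun L => (~~ nice L)%:R) set0 <= 2^-1 * (1 - I / #|V|%:R) ^+ t ->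
  0 <= K ->
  (1 - I / #|V|%:R) ^+ t * Dir Om setT f <= 2 * K.
Proof.
move=> hK bad K0.
have := edraw_Dir_ge t f (sub0set M); rewrite setC0 => h1.
have h2 : edraw M t (fun L => Dir Om (~: L) f) set0 <=
    edraw M t (fun L => Dir Om setT f * (~~ nice L)%:R + K) set0.
  apply: edraw_le; first exact: sub0set.
  move=> L LM; case: (boolP (nice L)) => nL /=; first by rewrite mulr0 add0r hK.
  by rewrite mulr1 ler_wpDr // Dir_mono // subsetT.
rewrite edrawD edrawZ edraw_cst // in h2.
have := Dir_ge0 Om setT f; set DT := Dir _ _ _ in h1 h2 *; move=> D0.
have := ler_wpM2l D0 bad; rewrite mulrCA => h3.
set q := (1 - _) ^+ t in h1 h3 *.
have := le_trans h1 h2; rewrite [q * DT]mulrC in h3 *; lra.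
Qed.

End RevealFinal.

(** * Coupling by one pass of updates *)

Section Coupling.
Variables (R : realType) (T : finType).
Implicit Types (A G : {set T}) (g : T -> R).

Definition mean A g := (\sum_(c in A) g c) / #|A|%:R.

(** Uniform choices from [A] and [A'] share the mass [1 / N] at each point of [G], where [N] is the
    larger size. There the gap is [(1 - p) * K], elsewhere it is at most [K]. *)
Lemma mean_couple1 A A' G g g' (K p s : R) : A != set0 -> A' != set0 ->
  G \subset A -> G \subset A' -> 0 <= K -> 0 <= p ->
  s * #|A|%:R <= #|G|%:R -> s * #|A'|%:R <= #|G|%:R ->
  (forall c c', c \in A -> c' \in A' -> g c - g' c' <= K) ->
  (forall c, c \in G -> g c - g' c <= (1 - p) * K) ->
  mean A g - mean A' g' <= (1 - s * p) * K.
Proof.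
move=> A0 A0' GA GA' K0 p0 sA sA' hK hG.
have [c0 c0A] := set0Pn _ A0'.
(* Off the common mass everything is compared with the least value [mu] of [g'], which avoids
   writing down a joint law. *)
case: (arg_minP g' c0A) => c1 c1A min; set mu := g' c1 in min.
pose N : R := (maxn #|A| #|A'|)%:R.
have Np : 0 < N by rewrite ltr0n leq_max card_gt0 A0.
have part (S : {set T}) (h : T -> R) : S != set0 -> G \subset S -> (#|S| <= maxn #|A| #|A'|)%N ->
    mean S h = \sum_(c in G) h c / N + \sum_(c in S) (#|S|%:R^-1 - (c \in G)%:R / N) * h c.
  move=> S0 GS _; rewrite /mean mulr_suml.
  under [X in _ = _ + X]eq_bigr do rewrite mulrBl.
  rewrite sumrB addrCA -[LHS]addr0; congr (_ + _).
    by apply: eq_bigr => c _; rewrite mulrC.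
  apply/esym/eqP; rewrite subr_eq0; apply/eqP.
  rewrite [RHS](bigID (mem G)) /= [X in _ = _ + X]big1 ?addr0; last first.
    by move=> c /andP[_ /negPf ->]; rewrite !mul0r.
  apply: eq_big => c; last by move=> ->; rewrite mul1r mulrC.
  by case cG: (c \in G); rewrite ?andbF // (subsetP GS).
have wge (S : {set T}) c : S != set0 -> (#|S| <= maxn #|A| #|A'|)%N ->
    0 <= #|S|%:R^-1 - (c \in G)%:R / N.
  move=> S0 le; have Sp : 0 < #|S|%:R :> R by rewrite ltr0n card_gt0.
  rewrite subr_ge0; case: (c \in G); last by rewrite mul0r invr_ge0.
  by rewrite mul1r lef_pV2 ?posrE // ler_nat.
have wsum (S : {set T}) : S != set0 -> G \subset S ->
    \sum_(c in S) (#|S|%:R^-1 - (c \in G)%:R / N) = 1 - #|G|%:R / N.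
  move=> S0 GS; rewrite sumrB -mulr_card mulVf ?pnatr_eq0 ?cards_eq0 //.
  congr (_ - _); rewrite -mulr_suml; congr (_ / _).
  rewrite -sum1_card natr_sum [RHS]big_mkcond [LHS]big_mkcond /=.
  apply: eq_bigr => c _; case cG: (c \in G); first by rewrite (subsetP GS).
  by case: ifP.
have w0 : 0 <= 1 - #|G|%:R / N.
  rewrite subr_ge0 ler_pdivrMr // mul1r ler_nat leq_max.
  by rewrite subset_leq_card.
have up : mean A g <= \sum_(c in G) g c / N + (1 - #|G|%:R / N) * (K + mu).
  rewrite (part A) ?leq_maxl // lerD2l -(wsum A) // mulr_suml.
  apply: ler_sum => c cA; rewrite ler_wpM2l ?wge ?leq_maxl //.
  by rewrite -lerBlDr; apply: hK.
have lo : \sum_(c in G) g' c / N + (1 - #|G|%:R / N) * mu <= mean A' g'.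
  rewrite (part A') ?leq_maxr // lerD2l -(wsum A') // mulr_suml.
  by apply: ler_sum => c cA; rewrite ler_wpM2l ?wge ?leq_maxr // min.
have mid : \sum_(c in G) g c / N - \sum_(c in G) g' c / N <= #|G|%:R / N * ((1 - p) * K).
  have -> : #|G|%:R / N * ((1 - p) * K) = \sum_(c in G) (1 - p) * K / N.
    by rewrite -mulr_card; ring.
  rewrite -sumrB.
  apply: ler_sum => c cG; rewrite -mulrBl ler_wpM2r ?invr_ge0 ?(ltW Np) //.
  exact: hG.
have sN : s <= #|G|%:R / N.
  rewrite ler_pdivlMr // /N.
  by case: (leqP #|A| #|A'|) => _.
have : s * (p * K) <= #|G|%:R / N * (p * K) by rewrite ler_wpM2r // mulr_ge0.
move: up lo mid; rewrite mulrDr; set x := _ / N; nra.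
Qed.

Lemma mean_couple A A' G g g' (K p s : R) : A != set0 -> A' != set0 ->
  G \subset A -> G \subset A' -> 0 <= K -> 0 <= p ->
  s * #|A|%:R <= #|G|%:R -> s * #|A'|%:R <= #|G|%:R ->
  (forall c c', c \in A -> c' \in A' -> `|g c - g' c'| <= K) ->
  (forall c, c \in G -> `|g c - g' c| <= (1 - p) * K) ->
  `|mean A g - mean A' g'| <= (1 - s * p) * K.
Proof.
move=> A0 A0' GA GA' K0 p0 sA sA' hK hG; rewrite ler_norml lerNl opprB.
apply/andP; split.
  apply: (mean_couple1 A0' A0 GA' GA) => // [c c' cA c'A|c cG].
    by apply: le_trans (ler_norm _) _; rewrite distrC hK.
  by apply: le_trans (ler_norm _) _; rewrite distrC hG.
apply: (mean_couple1 A0 A0' GA GA') => // [c c' cA c'A|c cG].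
  by apply: le_trans (ler_norm _) _; apply: hK.
by apply: le_trans (ler_norm _) _; apply: hG.
Qed.

End Coupling.

(** * Coalescence of two colourings during a sweep *)

Section Pass.
Variables (R : realType) (V C : finType) (e : rel V).
Hypotheses (e_sym : symmetric e) (e_irr : irreflexive e).
Local Notation coloring := {ffun V -> C}.
Implicit Types (x y z : coloring) (f g : coloring -> R) (vs : seq V).

Definition pcol : {set coloring} := [set x : coloring | [forall u, forall v, e u v ==> (x u != x v)]].

Lemma pcolP x : reflect (forall u v, e u v -> x u != x v) (x \in pcol).
Proof.
rewrite inE; apply: (iffP forallP) => [h u v|h u].
  by move/forallP: (h u) => /(_ v)/implyP.
by apply/forallP => v; apply/implyP; apply: h.
Qed.

Definition free x v : {set C} := ~: (x @: nb e v).

Lemma freeP x v c : reflect (forall w, e v w -> x w != c) (c \in free x v).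
Proof.
rewrite inE; apply: (iffP idP) => [h w vw|h].
  by apply: contraNneq h => <-; apply: imset_f; rewrite inE.
by apply/imsetP => -[w]; rewrite inE => /h hw E; rewrite E eqxx in hw.
Qed.

Lemma upd_pcol x v c : x \in pcol -> c \in free x v -> upd x v c \in pcol.
Proof.
move=> /pcolP xp /freeP cf; apply/pcolP => a b ab; rewrite !ffunE.
case: (a =P v) => [av|_]; case: (b =P v) => [bv|_].
- by move: ab; rewrite av bv e_irr.
- by rewrite eq_sym cf // -av.
- by rewrite cf // -bv e_sym.
- exact: xp.
Qed.

Lemma own_free x v : x \in pcol -> x v \in free x v.
Proof. by move=> /pcolP xp; apply/freeP => w vw; rewrite eq_sym xp. Qed.

Lemma cond_site x v f : x \in pcol ->
  cond pcol (~: [set v]) f x = mean (free x v) (fun c => f (upd x v c)).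
Proof.
move=> xp; rewrite /cond /avg /mean.
have -> : fiber pcol (~: [set v]) x = [set upd x v c | c in free x v].
  apply/setP => y; rewrite inE; apply/andP/imsetP => [[yp /agreeP xy]|[c cf ->]].
    exists (y v).
      apply/freeP => w vw; have wv : w != v by apply: contraTneq vw => ->; rewrite e_irr.
      by rewrite xy ?inE //; move/pcolP: yp; apply; rewrite e_sym.
    by apply/ffunP => w; rewrite ffunE; case: eqP => [->//|/eqP wv]; rewrite xy // !inE.
  split; first exact: upd_pcol.
  by apply/agreeP => w; rewrite !inE ffunE => /negPf ->.
have inj : {in free x v &, injective (upd x v)}.
  by move=> c c' _ _ /ffunP/(_ v); rewrite !ffunE eqxx.
by rewrite big_imset // card_in_imset.
Qed.

Fixpoint pass vs f x : R := if vs is v :: vs' then cond pcol (~: [set v]) (pass vs' f) x else f x.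

Variables (B : {set V}) (D N0 D0 : nat).

Definition osc_on K f := forall x y, x \in pcol -> y \in pcol -> agree (~: B) x y -> `|f x - f y| <= K.

Lemma cond_osc K (A : {set V}) f : 0 <= K -> ~: B \subset A -> osc_on K f -> osc_on K (cond pcol A f).
Proof.
move=> K0 BA osc x y xp yp xy; apply: avg_sub_le; rewrite ?fiber_n0 //.
move=> x' y'; rewrite inE => /andP[x'p xx']; rewrite inE => /andP[y'p yy'].
apply: osc => //; apply: agree_trans (_ : agree _ _ x) (agree_trans xy (agree_sub BA yy')).
by rewrite agree_sym; apply: agree_sub xx'.
Qed.

Lemma pass_osc K vs f : 0 <= K -> {subset vs <= B} -> osc_on K f -> osc_on K (pass vs f).
Proof.
move=> K0; elim: vs => //= v vs IH sub osc; apply: cond_osc => //.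
  by rewrite setCS sub1set sub // inE eqxx.
by apply: IH => // u uv; apply: sub; rewrite inE uv orbT.
Qed.

Fixpoint degenerate vs : bool :=
  if vs is v :: vs' then (#|nb e v :&: [set u in vs']| <= D0)%N && degenerate vs' else true.

(** A lower bound for the chance that both copies take the same harmless colour at [v]. Of the [N0]
    or more colours free at a light vertex, at most [D0] are blocked by later neighbours, which may
    still disagree, and at most [D0] are reserved for later heavy neighbours. A heavy vertex must
    take its one reserved colour. *)
Definition site_prob v : R := if v \in heavy e D then #|C|%:R^-1 else 1 - (D0%:R *+ 2) / N0%:R.

Definition pass_prob vs := \prod_(v <- vs) site_prob v.

Hypothesis N0_gt0 : (0 < N0)%N.
Hypothesis colors : (D + N0 <= #|C|)%N.
Hypothesis D0_small : (3 * D0 < N0)%N.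

Lemma site_prob_ge0 v : 0 <= site_prob v.
Proof.
rewrite /site_prob; case: ifP => _; first by rewrite invr_ge0.
by rewrite subr_ge0 ler_pdivrMr ?ltr0n // mul1r -mulrnA ler_nat; move: D0_small; clear; lia.
Qed.

Lemma pass_prob_ge0 vs : 0 <= pass_prob vs.
Proof. by apply: prodr_ge0 => v _; apply: site_prob_ge0. Qed.

(** [tau] is chosen backwards along [vs]: a vertex has at most [D0] later neighbours, whose colours
    in [x], [y] and [tau] exclude at most [3 * D0] colours. *)
Lemma tau_ex vs x y : uniq vs -> degenerate vs -> exists tau : coloring,
  forall v w, v \in vs -> w \in vs -> (index v vs < index w vs)%N -> e v w ->
    [/\ x w != tau v, y w != tau v & tau w != tau v].
Proof.
elim: vs => [|v vs IH] /=; first by exists x.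
move=> /andP[vvs uvs] /andP[dv dvs]; have [tau ht] := IH uvs dvs.
pose N := nb e v :&: [set u in vs].
have : exists c, c \notin (x @: N) :|: (y @: N) :|: (tau @: N).
  apply/existsP; rewrite -negb_forall; apply/negP => /forallP h.
  have : (#|C| <= #|N| + #|N| + #|N|)%N; last first.
    by move: dv colors D0_small; rewrite -/N; clear; lia.
  rewrite -cardsT; apply: leq_trans (_ : #|(x @: N) :|: (y @: N) :|: (tau @: N)| <= _)%N.
    by apply/subset_leq_card/subsetP => c _; apply: h.
  apply: leq_trans (leq_card_setU _ _) _; apply: leq_add; last exact: leq_imset_card.
  by apply: leq_trans (leq_card_setU _ _) _; apply: leq_add; exact: leq_imset_card.
move=> [c]; rewrite !inE !negb_or -andbA => /and3P[cx cy ct].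
exists (upd tau v c) => a b; rewrite !inE.
have [->|av] := eqVneq a v.
  have [->|bv] := eqVneq b v; first by rewrite e_irr.
  move=> _ /= bvs _ vb; rewrite !ffunE eqxx (negPf bv).
  have bN : b \in N by rewrite !inE vb.
  by split; [apply: contraNneq cx|apply: contraNneq cy|apply: contraNneq ct] => <-; apply: imset_f.
move=> /= avs.
have [->|bv] := eqVneq b v; first by rewrite ?eqxx.
rewrite /= ltnS => bvs lt ab.
by rewrite !ffunE (negPf av) (negPf bv); apply: ht.
Qed.

(* [tau h] is a colour that stays available at the heavy vertex [h] until its
   turn: the updates of its neighbours avoid it. *)
Lemma pass_coalesce_aux (tau : coloring) K f vs x y : uniq vs -> degenerate vs -> {subset vs <= B} ->
  0 <= K -> osc_on K f -> x \in pcol -> y \in pcol -> agree (~: [set u in vs]) x y ->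
  (forall v w, v \in heavy e D -> w \in heavy e D -> v \in vs -> w \in vs -> e v w -> tau w != tau v) ->
  (forall h w, h \in heavy e D -> h \in vs -> e h w -> (index h vs <= index w vs)%N ->
     x w != tau h /\ y w != tau h) ->
  `|pass vs f x - pass vs f y| <= (1 - pass_prob vs) * K.
Proof.
move=> + + + K0 osc; elim: vs x y => [|v vs IH] x y.
  move=> _ _ _ _ _ xy _ _; have -> : x = y.
    by apply/ffunP => v; move/agreeP: xy; apply; rewrite !inE.
  by rewrite subrr normr0 /pass_prob big_nil subrr mul0r.
rewrite [uniq _]/= [degenerate _]/= => /andP[vvs uvs] /andP[dv dvs] sub xp yp /agreeP xy ht inv.
have subs : {subset vs <= B} by move=> u uvs'; apply: sub; rewrite inE uvs' orbT.
have vB : v \in B by apply: sub; rewrite inE eqxx.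
have xyE w : w != v -> w \notin vs -> x w = y w.
  by move=> wv wvs; apply: xy; rewrite !inE negb_or wv.
rewrite [pass _ _ x]/= [pass _ _ y]/= !cond_site // /pass_prob big_cons -/(pass_prob vs).
pose Tv := tau @: (nb e v :&: [set u in vs] :&: heavy e D).
pose G := if v \in heavy e D then [set tau v] else free x v :&: free y v :\: Tv.
have tau_ok h : v \in heavy e D -> h \in vs -> h \in heavy e D -> e v h -> tau h != tau v.
  by move=> vH hvs hH vh; apply: ht; rewrite // !inE ?eqxx ?hvs ?orbT.
have GfG : G \subset free x v :&: free y v.
  rewrite /G; case: ifP => vH; last exact: subsetDl.
  rewrite sub1set inE; apply/andP; split; apply/freeP => w vw.
    by have [] := inv v w vH (mem_head _ _) vw; rewrite //= eqxx.
  by have [] := inv v w vH (mem_head _ _) vw; rewrite //= eqxx.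
have Gx : G \subset free x v by apply: subset_trans GfG (subsetIl _ _).
have Gy : G \subset free y v by apply: subset_trans GfG (subsetIr _ _).
have fn0 z : z \in pcol -> free z v != set0.
  by move=> zp; apply/set0Pn; exists (z v); apply: own_free.
have Gtau c h : c \in G -> h \in heavy e D -> h \in vs -> e v h -> c != tau h.
  rewrite /G; case: ifP => vH.
    by rewrite inE => /eqP -> hH hvs vh; rewrite eq_sym; apply: tau_ok.
  rewrite in_setD => /andP[+ _] hH hvs vh; apply: contraNneq => ->.
  by apply: imset_f; rewrite !inE vh hvs /=; move: hH; rewrite inE.
have Gcard z z' : ((z = x) /\ (z' = y)) \/ ((z = y) /\ (z' = x)) ->
    site_prob v * #|free z v|%:R <= #|G|%:R.
  move=> zz; rewrite /site_prob /G; case: ifP => vH.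
    rewrite cards1 mulrC ler_pdivrMr ?mul1r ?ler_nat ?max_card // ltr0n.
    by apply: leq_trans colors; rewrite (leq_trans N0_gt0) // leq_addl.
  have dN : (#|nb e v :&: [set u in vs]| <= D0)%N by [].
  have lossA : (#|free z v| <= #|free x v :&: free y v :\: Tv| + (D0 + D0))%N.
    have s1 : free z v \subset (free x v :&: free y v :\: Tv) :|: (z' @: (nb e v :&: [set u in vs]) :|: Tv).
      apply/subsetP => c cz; rewrite in_setU in_setD !inE.
      case cT: (c \in Tv); first by rewrite /= !orbT.
      rewrite /= orbF; case cz' : (c \in free z' v).
        by case: zz => -[zE z'E]; move: cz cz'; rewrite zE z'E !inE => -> ->.
      move/negbT: cz'; rewrite inE negbK => /imsetP[w vw cE].
      apply/orP; right; rewrite cE; apply: imset_f; rewrite inE vw inE.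
      apply: contraT => wvs.
      have wv : w != v by apply: contraTneq vw => ->; rewrite inE e_irr.
      have := xyE w wv wvs; move/freeP: cz => /(_ w); rewrite inE in vw => /(_ vw).
      by rewrite cE; case: zz => -[-> ->] => [+ E|+ E]; rewrite E eqxx.
    apply: leq_trans (subset_leq_card s1) _.
    apply: leq_trans (leq_card_setU _ _) _; rewrite leq_add2l.
    apply: leq_trans (leq_card_setU _ _) _; apply: leq_add.
      exact: leq_trans (leq_imset_card _ _) dN.
    apply: leq_trans (leq_imset_card _ _) _; apply: leq_trans dN.
    exact: subset_leq_card (subsetIl _ _).
  have fN : (N0 <= #|free z v|)%N.
    rewrite /free cardsCs setCK; have : (#|z @: nb e v| <= D)%N.
      by apply: leq_trans (leq_imset_card _ _) _; move/negbT: vH; rewrite inE -leqNgt.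
    by move: colors; clear; lia.
  rewrite mulrBl mul1r lerBlDr.
  apply: (@le_trans _ _ (#|free x v :&: free y v :\: Tv| + (D0 + D0))%:R).
    by rewrite ler_nat.
  rewrite natrD lerD2l natrD -mulr2n mulrAC ler_pdivlMr ?ltr0n //.
  by rewrite ler_wpM2l ?mulrn_wge0 // ler_nat.
apply: (mean_couple (G := G) (s := site_prob v)) => //; try exact: fn0.
- exact: pass_prob_ge0.
- by apply: Gcard; left.
- by apply: (Gcard y x); right.
- move=> c c' cx cy; apply: (pass_osc K0 subs osc); rewrite ?upd_pcol //.
  apply/agreeP => w; rewrite inE => wB; rewrite !ffunE.
  have wv : w != v by apply: contraNneq wB => ->.
  by rewrite (negPf wv) xyE //; apply: contra wB; apply: subs.
- move=> c cG; apply: IH => //.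
  + by apply: upd_pcol => //; apply: (subsetP Gx).
  + by apply: upd_pcol => //; apply: (subsetP Gy).
  + apply/agreeP => w; rewrite !inE => wvs; rewrite !ffunE.
    by case: eqP => // /eqP wv; apply: xyE.
  + by move=> a b aH bH avs bvs; apply: ht; rewrite // inE ?avs ?bvs orbT.
  + move=> h w hH hvs hw ind; rewrite !ffunE.
    case: (w =P v) => [wv|/eqP wv].
      by split; apply: Gtau; rewrite // e_sym -wv.
    apply: inv => //; first by rewrite inE hvs orbT.
    have hv : h != v by apply: contraNneq vvs => <-.
    by rewrite /= ![v == _]eq_sym (negPf wv) (negPf hv) ltnS.
Qed.

(** As [B] contains all neighbours of its heavy vertices, a neighbour of a heavy [h] is updated
    either before [h], and then avoids [tau h], or after it, and then its initial colours differ
    from [tau h] by the choice of [tau]. *)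
Lemma pass_coalesce K f vs : uniq vs -> degenerate vs -> vs =i B ->
  (forall h, h \in heavy e D -> h \in B -> nb e h \subset B) ->
  0 <= K -> osc_on K f -> osc_on ((1 - pass_prob vs) * K) (pass vs f).
Proof.
move=> uvs dvs vsB closed K0 osc x y xp yp xy.
have [tau ht] := tau_ex x y uvs dvs.
have idx u w : u \in vs -> w \in vs -> e u w -> (index u vs <= index w vs)%N ->
    (index u vs < index w vs)%N.
  move=> uv wv uw; rewrite leq_eqVlt => /predU1P[E|//].
  by move: uw; rewrite -(nth_index u uv) E (nth_index u wv) e_irr.
apply: (@pass_coalesce_aux tau) => //.
- by move=> v; rewrite vsB.
- have -> // : [set u in vs] = B by apply/setP => v; rewrite inE vsB.
- move=> v w _ _ vvs wvs vw; case: (leqP (index v vs) (index w vs)) => [le|lt].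
    by have [] := ht v w vvs wvs (idx _ _ vvs wvs vw le) vw.
  by rewrite eq_sym; have [] := ht w v wvs vvs lt ltac:(by rewrite e_sym).
- move=> h w hH hvs hw le.
  have wvs : w \in vs.
    by rewrite vsB; apply: (subsetP (closed h hH ltac:(by rewrite -vsB))); rewrite inE.
  by have [] := ht h w hvs wvs (idx _ _ hvs wvs hw le) hw.
Qed.

End Pass.

(** * Poincare inequality of a single component *)

Section BlockPoincare.
Variables (R : realType) (V C : finType) (e : rel V).
Hypotheses (e_sym : symmetric e) (e_irr : irreflexive e).
Local Notation coloring := {ffun V -> C}.
Local Notation pcol := (pcol C e).
Implicit Types (x y z : coloring) (f g : coloring -> R) (vs us : seq V) (A B : {set V}).

Definition nrm f : R := Num.sqrt (norm2 pcol f).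

Lemma nrm_ge0 f : 0 <= nrm f. Proof. exact: sqrtr_ge0. Qed.

Lemma sqr_nrm f : nrm f ^+ 2 = norm2 pcol f.
Proof. by rewrite sqr_sqrtr // norm2_ge0. Qed.

Lemma eq_nrm f g : {in pcol, f =1 g} -> nrm f = nrm g.
Proof. by move=> h; rewrite /nrm (eq_norm2 h). Qed.

Lemma nrmD f g : nrm (fun x => f x + g x) <= nrm f + nrm g.
Proof.
rewrite -ler_sqr ?nnegrE ?addr_ge0 ?nrm_ge0 // sqrrD !sqr_nrm.
have -> : norm2 pcol (fun x => f x + g x) = norm2 pcol f + inner pcol f g *+ 2 + norm2 pcol g.
  rewrite /norm2 /inner -sumrMnl -!big_split /=.
  by apply: eq_bigr => x _; rewrite sqrrD.
rewrite lerD2r lerD2l lerMn2r /=; apply: le_trans (ler_norm _) _.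
rewrite -ler_sqr ?nnegrE ?mulr_ge0 ?nrm_ge0 // real_normK ?num_real // exprMn !sqr_nrm.
exact: inner_sqr_le.
Qed.

Lemma nrm_cond_le A f : nrm (cond pcol A f) <= nrm f.
Proof. by rewrite ler_wsqrtr // norm2_cond_le. Qed.

Lemma pass_cat us vs f x : x \in pcol -> pass e (us ++ vs) f x = pass e us (pass e vs f) x.
Proof.
elim: us x => [|u us IH] x xp //=.
by apply: eq_cond => y yp; apply: IH.
Qed.

Lemma pass_sym vs f g : inner pcol (pass e vs f) g = inner pcol f (pass e (rev vs) g).
Proof.
elim: vs f g => [|v vs IH] f g //=.
rewrite cond_sym IH; apply: eq_inner => // x xp.
by rewrite rev_cons -cats1 pass_cat.
Qed.

Lemma nrm_pass_sub vs g :
  nrm (fun x => g x - pass e vs g x) <= \sum_(v <- vs) nrm (fun x => g x - cond pcol (~: [set v]) g x).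
Proof.
elim: vs => [|v vs IH].
  rewrite big_nil (@eq_nrm _ (fun=> 0)); last by move=> x _ /=; rewrite subrr.
  by rewrite /nrm /norm2 big1 ?sqrtr0 // => x _; rewrite expr0n.
rewrite big_cons (@eq_nrm _ (fun x => (g x - cond pcol (~: [set v]) g x) +
  cond pcol (~: [set v]) (fun y => g y - pass e vs g y) x)); last first.
  by move=> x _; rewrite condB addrA subrK.
apply: le_trans (nrmD _ _) _; rewrite lerD2l.
by apply: le_trans (nrm_cond_le _ _) IH.
Qed.

Lemma cond_pass B vs f x : {subset vs <= B} -> x \in pcol ->
  cond pcol (~: B) (pass e vs f) x = cond pcol (~: B) f x.
Proof.
move=> + xp; elim: vs => //= v vs IH sub.
rewrite cond_condr; last by rewrite setCS sub1set sub // inE eqxx.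
by apply: IH => u us; apply: sub; rewrite inE us orbT.
Qed.

Variables (B : {set V}) (D N0 D0 : nat).
Hypothesis N0_gt0 : (0 < N0)%N.
Hypothesis colors : (D + N0 <= #|C|)%N.
Hypothesis D0_small : (3 * D0 < N0)%N.
Hypothesis closed : forall h, h \in heavy e D -> h \in B -> nb e h \subset B.

Lemma osc_sup K f x : osc_on e B K f -> x \in pcol -> cond pcol (~: B) f x = 0 -> `|f x| <= K.
Proof.
move=> osc xp f0; rewrite -[X in `|X|]subr0 -f0.
rewrite -{1}(avg_cst (f x) (fiber_n0 (~: B) xp)) /cond -avgB /avg normrM normfV normr_nat.
rewrite ler_pdivrMr ?ltr0n ?card_gt0 ?fiber_n0 //; apply: le_trans (ler_norm_sum _ _ _) _.
rewrite mulr_card; apply: ler_sum => y; rewrite inE => /andP[yp xy].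
exact: osc.
Qed.

Lemma pass_prob_le1 vs : pass_prob R C e D N0 D0 vs <= 1.
Proof.
rewrite /pass_prob; apply: prodr_ile1 => v _; rewrite site_prob_ge0 //=.
rewrite /site_prob; case: ifP => _.
  rewrite invf_le1 ?ltr0n ?ler1n.
    by apply: leq_trans colors; rewrite (leq_trans N0_gt0) // leq_addl.
  by apply: leq_trans colors; rewrite (leq_trans N0_gt0) // leq_addl.
by rewrite gerBl divr_ge0 // mulrn_wge0.
Qed.

(** The reversed sweep followed by the sweep is a symmetric operator [T], and [inner g (T g)] is the
    squared norm of the reversed sweep of [g]. Coalescence bounds the oscillations of the iterates
    of [T], and [sym_iter_bound] transfers the rate to L2. *)
Lemma pass_contract vs g : uniq vs -> degenerate e D0 vs -> vs =i B ->
  {in pcol, cond pcol (~: B) g =1 fun=> 0} ->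
  norm2 pcol (pass e (rev vs) g) <= (1 - pass_prob R C e D N0 D0 vs) * norm2 pcol g.
Proof.
move=> uvs dvs vsB g0; set p := pass_prob _ _ _ _ _ _ _.
have p1 : p <= 1 by apply: pass_prob_le1.
have q0 : 0 <= 1 - p by rewrite subr_ge0.
pose T f := pass e vs (pass e (rev vs) f).
have Tsym f h : inner pcol (T f) h = inner pcol f (T h).
  by rewrite /T pass_sym pass_sym revK.
pose K := \sum_(x in pcol) `|g x| *+ 2.
have K0 : 0 <= K by apply: sumr_ge0 => x _; rewrite mulrn_wge0.
have sub : {subset vs <= B} by move=> v; rewrite vsB.
have subr : {subset rev vs <= B} by move=> v; rewrite mem_rev vsB.
have iter_ok j : {in pcol, cond pcol (~: B) (iter j T g) =1 fun=> 0} /\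
    osc_on e B ((1 - p) ^+ j * K) (iter j T g).
  elim: j => [|j [IH1 IH2]].
    split=> // x y xp yp _; rewrite expr0 mul1r.
    have bnd z : z \in pcol -> `|g z| *+ 2 <= K.
      by move=> zp; rewrite /K (bigD1 z) //= lerDl sumr_ge0 // => w _; rewrite mulrn_wge0.
    apply: le_trans (ler_normB _ _) _.
    by have := bnd x xp; have := bnd y yp; rewrite !mulr2n; lra.
  have Kj : 0 <= (1 - p) ^+ j * K by rewrite mulr_ge0 // exprn_ge0.
  split; first by move=> x xp; rewrite iterS /T cond_pass // cond_pass // IH1.
  rewrite exprS -mulrA iterS.
  by apply: pass_coalesce => //; apply: pass_osc.
have step : norm2 pcol (T g) <= ((1 - p) ^+ 2) * norm2 pcol g.
  apply: (@sym_iter_bound R V C pcol T g (#|pcol|%:R * K ^+ 2)) => //; first exact: sqr_ge0.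
  move=> j; have [h1 h2] := iter_ok j.
  rewrite -mulrA [_%:R * _]mulrC mulr_card; apply: ler_sum => x xp.
  rewrite -[leLHS]real_normK ?num_real // -exprM mulnC exprM -exprMn.
  rewrite ler_sqr ?nnegrE ?mulr_ge0 ?exprn_ge0 // mulrC.
  by apply: osc_sup => //; apply: h1.
rewrite norm2E pass_sym revK -/(T g).
apply: le_trans (ler_norm _) _.
rewrite -ler_sqr ?nnegrE ?mulr_ge0 ?norm2_ge0 // real_normK ?num_real //.
apply: le_trans (inner_sqr_le _ _ _) _.
by rewrite exprMn [_ * norm2 _ g ^+ 2]mulrC expr2 -mulrA ler_wpM2l ?norm2_ge0 // mulrC.
Qed.

(** A sweep that shrinks [g] by [1 - p / 2] moves it by at least [p / 2 * nrm g], yet it moves [g]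
    by no more than the single-site updates do in total. Squaring the sum over sites gives the
    factor [#|B|]. *)
Lemma block_poincare vs f : uniq vs -> degenerate e D0 vs -> vs =i B ->
  (pass_prob R C e D N0 D0 vs) ^+ 2 * Dir pcol B f <=
  4 * #|B|%:R * \sum_(v in B) Dir pcol [set v] f.
Proof.
move=> uvs dvs vsB; set p := pass_prob _ _ _ _ _ _ _.
have p1 : p <= 1 by apply: pass_prob_le1.
have p0 : 0 <= p by apply: pass_prob_ge0.
pose g x := f x - cond pcol (~: B) f x.
have g0 : {in pcol, cond pcol (~: B) g =1 fun=> 0}.
  by move=> x xp; rewrite condB cond_condl // subrr.
have := pass_contract uvs dvs vsB g0; rewrite -/p => contr.
have nc : nrm (pass e (rev vs) g) <= (1 - p / 2) * nrm g.
  rewrite -ler_sqr ?nnegrE ?mulr_ge0 ?nrm_ge0 //; last by lra.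
  rewrite exprMn !sqr_nrm; apply: le_trans contr _.
  rewrite ler_wpM2r ?norm2_ge0 //.
  by have : 0 <= (p / 2) ^+ 2 by [apply: sqr_ge0]; rewrite sqrrB expr1n mul1r; lra.
have low : p / 2 * nrm g <= nrm (fun x => g x - pass e (rev vs) g x).
  have := nrmD (fun x => g x - pass e (rev vs) g x) (pass e (rev vs) g).
  by rewrite (@eq_nrm _ g); [lra|move=> x _; rewrite subrK].
have DE v : v \in B -> nrm (fun x => g x - cond pcol (~: [set v]) g x) ^+ 2 = Dir pcol [set v] f.
  move=> vB; rewrite sqr_nrm; apply: eq_norm2 => x xp.
  rewrite condB cond_condl // ?setCS ?sub1set //.
  by rewrite opprB addrA subrK.
have up := le_trans low (nrm_pass_sub (rev vs) g).
have sumE : \sum_(v <- rev vs) nrm (fun x => g x - cond pcol (~: [set v]) g x) =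
    \sum_(v in B) nrm (fun x => g x - cond pcol (~: [set v]) g x).
  rewrite -[RHS]big_enum /=; apply: perm_big; apply: uniq_perm; rewrite ?rev_uniq ?enum_uniq //.
  by move=> v; rewrite mem_rev mem_enum vsB.
rewrite sumE in up.
have up2 : (p / 2 * nrm g) ^+ 2 <= #|B|%:R * \sum_(v in B) Dir pcol [set v] f.
  apply: (@le_trans _ _ ((\sum_(v in B) nrm (fun x => g x - cond pcol (~: [set v]) g x)) ^+ 2)).
    rewrite ler_sqr ?nnegrE ?mulr_ge0 ?invr_ge0 ?nrm_ge0 //.
    by apply: sumr_ge0 => v _; apply: nrm_ge0.
  apply: le_trans (sqr_sum_le _ _) _; rewrite ler_wpM2l //.
  by apply: ler_sum => v vB; rewrite DE.
have -> : Dir pcol B f = nrm g ^+ 2 by rewrite sqr_nrm.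
have -> : p ^+ 2 * nrm g ^+ 2 = 4 * (p / 2 * nrm g) ^+ 2 by field.
by rewrite -[leRHS]mulrA ler_pM2l.
Qed.

End BlockPoincare.

(** * Splitting into components, and elimination orders *)

Section Tensorization.
Variables (R : realType) (V C : finType) (e : rel V).
Hypotheses (e_sym : symmetric e) (e_irr : irreflexive e).
Local Notation coloring := {ffun V -> C}.
Local Notation pcol := (pcol C e).
Implicit Types (x y z : coloring) (f g : coloring -> R) (A B S T : {set V}).

Definition mix B y x : coloring := [ffun v => if v \in B then y v else x v].

Lemma mix_pcol B x y : x \in pcol -> y \in pcol ->
  (forall a b, a \in B -> b \notin B -> e a b -> x b = y b) -> mix B y x \in pcol.
Proof.
move=> /pcolP xp /pcolP yp h; apply/pcolP => a b ab; rewrite !ffunE.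
case: ifPn => aB; case: ifPn => bB; rewrite ?xp ?yp //.
  by rewrite (h a b) // yp.
by rewrite eq_sym (h b a) // ?yp // e_sym.
Qed.

Definition separated A B := forall u v, u \in A -> v \in B -> ~~ e u v.

(** With no edge between [A] and [B], the colourings allowed on [A] do not depend on the colours in
    [B]; [mix] transplants them bijectively from one fibre to another. *)
Lemma cond_separated A B f x : separated A B -> [disjoint A & B] -> x \in pcol ->
  cond pcol (~: A) (cond pcol (~: B) f) x = cond pcol (~: (A :|: B)) f x.
Proof.
move=> sep dis xp; set h := cond pcol (~: A) (cond pcol (~: B) f).
have nAB v : v \in A -> v \notin B by move/disjointFr: dis => d /d ->.
have stepB y y' : y \in pcol -> y' \in pcol -> agree (~: B) y y' -> h y = h y'.
  move=> yp yp' /agreeP yy.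
  pose F := fiber pcol (~: A) y; pose F' := fiber pcol (~: A) y'.
  have inF (a b z : coloring) : a \in pcol -> b \in pcol ->
      (forall v, v \notin B -> a v = b v) -> z \in fiber pcol (~: A) a ->
      mix A z b \in fiber pcol (~: A) b.
    move=> ap bp ab; rewrite in_set => /andP[zp /agreeP az]; rewrite in_set.
    apply/andP; split; last first.
      by apply/agreeP => v; rewrite inE ffunE => /negPf ->.
    apply: mix_pcol => // u v uA vA uv.
    rewrite -az ?inE // ab //.
    by apply/negP => vB; have := sep u v uA vB; rewrite uv.
  have mixK (a b z : coloring) : z \in fiber pcol (~: A) a -> mix A (mix A z b) a = z.
    rewrite in_set => /andP[_ /agreeP az]; apply/ffunP => v; rewrite !ffunE.
    by case: (boolP (v \in A)) => // vA; rewrite az // inE.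
  have yyB v : v \notin B -> y v = y' v by move=> vB; apply: yy; rewrite inE.
  have yyB' v : v \notin B -> y' v = y v by move=> vB; rewrite yyB.
  have sumE (k : coloring -> R) : \sum_(z in F') k z = \sum_(z in F) k (mix A z y').
    rewrite (reindex_onto (fun z => mix A z y') (fun z => mix A z y)) /=; last first.
      by move=> z zF; apply: mixK zF.
    apply: eq_bigl => z; apply/andP/idP => [[zF /eqP <-]|zF].
      exact: inF _ _ zF.
    split; first exact: inF zF.
    by rewrite (mixK _ _ _ zF).
  rewrite /h /cond /avg -/(avg _ _) -/F -/F' sumE; congr (_ / _); last first.
    by have := sumE (fun=> 1); rewrite !sumr_const.
  apply: eq_bigr => z; rewrite in_set => /andP[zp /agreeP yz].
  apply: cond_agree; apply/agreeP => v; rewrite inE => vB; rewrite ffunE.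
  by case: ifPn => // vA; rewrite -yz ?inE // yyB.
have hm y : y \in pcol -> agree (~: (A :|: B)) x y -> h y = h x.
  move=> yp /agreeP xy; pose w := mix B y x.
  have wp : w \in pcol.
    apply: mix_pcol => // u v uB vB uv; apply: xy; rewrite !inE negb_or vB andbT.
    by apply/negP => vA; have := sep v u vA uB; rewrite e_sym uv.
  rewrite (stepB x w) //; last by apply/agreeP => v; rewrite inE ffunE => /negPf ->.
  apply: cond_agree; apply/agreeP => v; rewrite inE ffunE => vA.
  by case: ifPn => // vB; rewrite xy // !inE negb_or vA.
rewrite -/(h x) -(cond_id xp hm).
have s1 : ~: (A :|: B) \subset ~: A by rewrite setCS subsetUl.
have s2 : ~: (A :|: B) \subset ~: B by rewrite setCS subsetUr.
by rewrite cond_condr // cond_condr.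
Qed.

(** The Efron-Stein inequality for two conditionally independent blocks: the two projections
    commute, and projecting the fluctuation over [A] does not increase its norm. *)
Lemma Dir_setU A B f : separated A B -> [disjoint A & B] ->
  Dir pcol (A :|: B) f <= Dir pcol A f + Dir pcol B f.
Proof.
move=> sep dis.
have sep' : separated B A by move=> u v uB vA; rewrite e_sym sep.
have dis' : [disjoint B & A] by rewrite disjoint_sym.
rewrite !DirE -(eq_norm2 (fun x => cond_separated f sep dis)).
have h1 : norm2 pcol (cond pcol (~: B) f) - norm2 pcol (cond pcol (~: A) (cond pcol (~: B) f)) <=
    norm2 pcol f - norm2 pcol (cond pcol (~: A) f).
  rewrite -!norm2_condB; apply: le_trans (norm2_cond_le pcol (~: B) _).
  rewrite le_eqVlt; apply/orP; left; apply/eqP/eq_norm2 => x xp.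
  rewrite condB; congr (_ - _).
  by rewrite (cond_separated _ sep dis xp) (cond_separated _ sep' dis' xp) setUC.
lra.
Qed.

Lemma Dir_set0 f : Dir pcol set0 f = 0.
Proof.
rewrite /Dir /norm2 big1 // => x xp; rewrite setC0 cond_id ?subrr ?expr0n // => y _ /agreeP xy.
by congr f; apply/ffunP => v; rewrite xy ?inE.
Qed.

Lemma comp_ex S v : v \in S -> exists B,
  [/\ conn e B, v \in B, B \subset S & separated B (S :\: B)].
Proof.
move=> vS.
suff grow n (A : {set V}) : (#|S| - #|A|)%N = n -> conn e A -> v \in A -> A \subset S ->
    exists B, [/\ conn e B, v \in B, B \subset S & separated B (S :\: B)].
  by apply: (grow _ [set v] erefl); rewrite ?inE ?sub1set //; apply: conn1.
elim: n A => [|n IH] A nE cA vA AS.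
  exists A; split=> // a b _; rewrite inE => /andP[bA bS].
  suff SA : S = A by rewrite -SA bS in bA.
  by apply/eqP; rewrite eq_sym eqEcard AS /=; move: nE; clear; lia.
have [/existsP[a /existsP[b /and4P[aA bS bA ab]]]|no] :=
    boolP [exists a, exists b, [&& a \in A, b \in S, b \notin A & e a b]].
  apply: (IH (b |: A)); rewrite ?inE ?vA ?orbT ?subUset ?sub1set ?bS //.
    by rewrite cardsU1 bA; move: nE; clear; lia.
  exact: conn_add cA aA bA ab.
exists A; split=> // a b aA; rewrite inE => /andP[bA bS].
apply: contra no => ab; apply/existsP; exists a; apply/existsP; exists b.
by rewrite aA bS bA.
Qed.

Lemma Dir_comps S f (K : R) :
  (forall B, conn e B -> B \subset S -> separated B (S :\: B) ->
     Dir pcol B f <= K * \sum_(v in B) Dir pcol [set v] f) ->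
  Dir pcol S f <= K * \sum_(v in S) Dir pcol [set v] f.
Proof.
move=> h; suff: forall n S', (#|S'| <= n)%N -> S' \subset S -> separated S' (S :\: S') ->
    Dir pcol S' f <= K * \sum_(v in S') Dir pcol [set v] f.
  by move=> /(_ #|S| S); apply => //; rewrite setDv => a b _; rewrite inE.
elim=> [|n IH] S' cS' sS' sep.
  move: cS'; rewrite leqn0 cards_eq0 => /eqP ->.
  by rewrite Dir_set0 big_set0 mulr0.
have [->|/set0Pn[v vS']] := eqVneq S' set0; first by rewrite Dir_set0 big_set0 mulr0.
have [B [cB vB BS' sepB]] := comp_ex vS'.
have BS : B \subset S by apply: subset_trans sS'.
have sepBS : separated B (S :\: B).
  move=> a b aB; rewrite inE => /andP[bB bS].
  have [bS'|bS'] := boolP (b \in S'); first by apply: sepB; rewrite // inE bB.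
  by apply: sep; rewrite ?inE ?bS' // (subsetP BS').
have sepR : separated (S' :\: B) (S :\: (S' :\: B)).
  move=> a b; rewrite !inE => /andP[aB aS'] /andP[+ bS]; rewrite negb_and negbK => /orP[bB|bS'].
    by rewrite e_sym; apply: sepB; rewrite // inE aB.
  by apply: sep; rewrite // inE bS'.
have SE : S' = B :|: (S' :\: B) by rewrite setDE setUIr setUCr setIT (setUidPr BS').
have dis : [disjoint B & S' :\: B].
  by rewrite disjoint_subset; apply/subsetP => a aB; rewrite !inE aB.
have card : (#|S' :\: B| <= n)%N.
  have := cardsID B S'; have : (0 < #|S' :&: B|)%N.
    by rewrite card_gt0; apply/set0Pn; exists v; rewrite inE vS'.
  by move: cS'; clear; lia.
have sR : S' :\: B \subset S by apply: subset_trans sS'; apply: subsetDl.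
rewrite {1 2}SE; apply: le_trans (Dir_setU f _ dis) _.
  by move=> a b aB; apply: sepB.
rewrite (eq_bigl (mem [predU B & S' :\: B])); last by move=> u; rewrite !inE.
rewrite bigU //= mulrDr; apply: lerD; first exact: h.
exact: IH.
Qed.

Lemma order_ex D0 S : (forall T, T \subset S -> T != set0 ->
    exists2 v, v \in T & (#|nb e v :&: T| <= D0)%N) ->
  exists vs : seq V, [/\ uniq vs, vs =i S & degenerate e D0 vs].
Proof.
move: {2}#|S| (leqnn #|S|) => n; elim: n S => [|n IH] S cS h.
  exists [::]; split=> // v; move: cS; rewrite leqn0 cards_eq0 => /eqP ->.
  by rewrite inE.
have [->|S0] := eqVneq S set0; first by exists [::]; split=> // v; rewrite inE.
have [v vS dv] := h S (subxx _) S0.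
have cS1 : (#|S :\ v| <= n)%N by move: cS; rewrite (cardsD1 v) vS.
have [T TS|vs [uvs vsS dvs]] := IH (S :\ v) cS1.
  by apply: h; apply: subset_trans TS (subsetDl _ _).
exists (v :: vs); split.
- by rewrite /= uvs vsS !inE eqxx.
- move=> u; rewrite inE vsS !inE; case: eqP => [->|] //=.
- rewrite /= dvs andbT; apply: leq_trans dv; apply: subset_leq_card.
  by apply/subsetP => u; rewrite !inE vsS !inE => /and3P[-> _ ->].
Qed.

Lemma low_degree_ex D0 T : T != set0 -> (edges2 e T <= D0 * #|T|)%N ->
  exists2 v, v \in T & (#|nb e v :&: T| <= D0)%N.
Proof.
move=> T0 le; have [/exists_inP//|] := boolP [exists v in T, (#|nb e v :&: T| <= D0)%N].
rewrite negb_exists_in => /forall_inP h.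
have : (\sum_(v in T) D0.+1 <= edges2 e T)%N.
  by apply: leq_sum => v vT; rewrite ltnNge h.
by rewrite sum_nat_const mulnS mulnC => /leq_trans/(_ le); rewrite -card_gt0 in T0; move: T0; clear; lia.
Qed.

(** For a non-empty connected set [#|T| + j0 <= (1 + j0) * #|T|] bounds the average inner degree by
    [2 * (1 + j0)], so some vertex can be eliminated; in a general set it is sought in one
    component. *)
Lemma sparse_order_ex j0 S : (forall T, conn e T -> T \subset S ->
    (edges2 e T <= 2 * (#|T| + j0))%N) ->
  exists vs : seq V, [/\ uniq vs, vs =i S & degenerate e (2 * (1 + j0)) vs].
Proof.
move=> h; apply: order_ex => T TS /set0Pn[t tT].
have [B [cB tB BT sep]] := comp_ex tT.
have B0 : B != set0 by apply/set0Pn; exists t.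
have := h B cB (subset_trans BT TS) => le.
have [|v vB dv] := @low_degree_ex (2 * (1 + j0)) B B0.
  apply: leq_trans le _; have : (0 < #|B|)%N by rewrite card_gt0.
  by clear; nia.
exists v; first exact: (subsetP BT).
apply: leq_trans dv; apply/subset_leq_card/subsetP => u; rewrite !inE => /andP[vu uT].
rewrite vu /=; apply: contraT => uB.
by have := sep v u vB; rewrite inE uB uT vu => /(_ isT).
Qed.

End Tensorization.

(** * From the Poincare inequality to mixing *)

Section Mixing.
Variables (R : realType) (n k : nat) (E : {set 'I_n * 'I_n}).
Hypothesis E_sub : E \subset upper_pairs n.
Hypotheses (n_gt0 : (0 < n)%N) (k_gt0 : (0 < k)%N).
Local Notation e := (adj E).
Local Notation pcol := (pcol (fintype_ordinal__canonical__fintype_Finite k) e).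
Implicit Types (x y : coloring n k) (f g : coloring n k -> R).

Lemma adj_sym : symmetric e.
Proof. by move=> u v; rewrite /adj orbC. Qed.

Lemma adj_irr : irreflexive e.
Proof.
move=> u; rewrite /adj orbb; apply/negP => /(subsetP E_sub).
by rewrite inE ltnn.
Qed.

Lemma proper_pcol x : Defs.proper E x = (x \in pcol).
Proof. by rewrite inE. Qed.

Definition glauber_op f x : R := n%:R^-1 * \sum_v cond pcol (~: [set v]) f x.

Lemma glauber_PE f x : x \in pcol -> \sum_y glauber_P R E x y * f y = glauber_op f x.
Proof.
move=> xp; rewrite /glauber_P /glauber_op.
under eq_bigr do rewrite -mulrA mulr_suml.
rewrite -mulr_sumr exchange_big /=; congr (_ * _); apply: eq_bigr => v _.
rewrite (cond_site adj_sym adj_irr) // /mean mulr_suml.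
have inj : {in free e x v &, injective (upd x v)}.
  by move=> c c' _ _ /ffunP/(_ v); rewrite !ffunE eqxx.
rewrite -(big_imset (fun y => f y / #|free e x v|%:R) inj) /= [RHS]big_mkcond /=.
apply: eq_bigr => y _.
have -> : (y \in upd x v @: free e x v) =
    [forall w, (w != v) ==> (y w == x w)] && (y v \in avail E x v).
  apply/imsetP/andP => [[c cf ->]|[/forallP yx yv]].
    split; last by rewrite ffunE eqxx.
    by apply/forallP => w; apply/implyP => /negPf wv; rewrite ffunE wv.
  exists (y v) => //; apply/ffunP => w; rewrite ffunE; case: eqP => [->//|/eqP wv].
  by move: (yx w); rewrite wv => /eqP.
by case: ifP => _; rewrite ?mul0r // mulrC.
Qed.

Lemma glauber_op_sym f g : inner pcol (glauber_op f) g = inner pcol f (glauber_op g).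
Proof.
have dist f' g' : inner pcol (glauber_op f') g' = n%:R^-1 * \sum_v inner pcol (cond pcol (~: [set v]) f') g'.
  rewrite -inner_suml /inner mulr_sumr; apply: eq_bigr => x _.
  by rewrite /glauber_op mulrA.
rewrite dist [RHS]innerC dist; congr (_ * _); apply: eq_bigr => v _.
by rewrite cond_sym innerC.
Qed.

Lemma eq_glauber_op f g x : {in pcol, f =1 g} -> glauber_op f x = glauber_op g x.
Proof. by move=> h; congr (_ * _); apply: eq_bigr => v _; apply: eq_cond. Qed.

Lemma glauber_op_cst c x : x \in pcol -> glauber_op (fun=> c) x = c.
Proof.
move=> xp; rewrite /glauber_op.
under eq_bigr do rewrite cond_id //.
by rewrite sumr_const card_ord -[c *+ n]mulr_natl mulrA mulVf ?mul1r // pnatr_eq0 -lt0n.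
Qed.

Lemma glauber_opB f g x : glauber_op (fun y => f y - g y) x = glauber_op f x - glauber_op g x.
Proof. by rewrite /glauber_op -mulrBr -sumrB; congr (_ * _); apply: eq_bigr => v _; rewrite condB. Qed.

(** Reversibility with respect to the uniform measure: laws evolve under the same symmetric operator
    as functions. *)
Lemma glauber_dist_step x0 t : x0 \in pcol ->
  (forall y, y \notin pcol -> glauber_dist R E x0 t y = 0) /\
  (forall y, y \in pcol -> glauber_dist R E x0 t.+1 y = glauber_op (glauber_dist R E x0 t) y).
Proof.
move=> x0p; elim: t => [|t [IH1 IH2]].
  split=> [y yp|y yp].
    by rewrite ffunE; case: eqP => // E'; rewrite E' x0p in yp.
  rewrite /= ffunE (bigD1 x0) //= ffunE eqxx mul1r big1 ?addr0; last first.
    by move=> x /negPf xx; rewrite ffunE xx mul0r.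
  have -> : glauber_P R E x0 y = \sum_z glauber_P R E x0 z * (z == y)%:R.
    rewrite (bigD1 y) //= eqxx mulr1 big1 ?addr0 // => z /negPf ->.
    by rewrite mulr0.
  rewrite glauber_PE //.
  have := glauber_op_sym (fun z => (z == x0)%:R) (fun z => (z == y)%:R).
  rewrite /inner (bigD1 y) //= eqxx mulr1 big1 ?addr0; last first.
    by move=> z /andP[_ /negPf ->]; rewrite mulr0.
  rewrite (bigD1 x0) //= eqxx mul1r big1 ?addr0; last first.
    by move=> z /andP[_ /negPf ->]; rewrite mul0r.
  by move=> <-; apply: eq_glauber_op => z _; rewrite ffunE.
have key y : glauber_dist R E x0 t.+1 y =
    inner pcol (glauber_dist R E x0 t) (glauber_op (fun z => (z == y)%:R)).
  rewrite /= ffunE /inner [LHS](bigID (mem pcol)) /= [X in _ + X]big1 ?addr0; last first.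
    by move=> x xp; rewrite IH1 // mul0r.
  apply: eq_bigr => x xp; congr (_ * _); rewrite -glauber_PE //.
  rewrite (bigD1 y) //= eqxx mulr1 big1 ?addr0 // => z /negPf ->.
  by rewrite mulr0.
have supp y : y \notin pcol -> glauber_dist R E x0 t.+1 y = 0.
  move=> yp; rewrite key /inner big1 // => x xp.
  rewrite (@eq_glauber_op _ (fun=> 0)) ?glauber_op_cst ?mulr0 // => z zp.
  by case: eqP => // zy; rewrite -zy zp in yp.
split=> // y yp; move: key supp; set d := glauber_dist R E x0 t.+1 => _ supp.
have -> : glauber_dist R E x0 t.+2 y = \sum_x d x * glauber_P R E x y by rewrite [LHS]/= ffunE.
rewrite (bigID (mem pcol)) /= [X in _ + X]big1 ?addr0; last first.
  by move=> x xp; rewrite supp // mul0r.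
transitivity (inner pcol d (glauber_op (fun z => (z == y)%:R))).
  apply: eq_bigr => x xp; congr (_ * _); rewrite -glauber_PE //.
  rewrite (bigD1 y) //= eqxx mulr1 big1 ?addr0 // => z /negPf ->.
  by rewrite mulr0.
rewrite -glauber_op_sym /inner (bigD1 y) //= eqxx mulr1 big1 ?addr0 //.
by move=> z /andP[_ /negPf ->]; rewrite mulr0.
Qed.

Variable A : R.
Hypothesis A_ge1 : 1 <= A.
Hypothesis poincare : forall f, Dir pcol setT f <= A * \sum_v Dir pcol [set v] f.

Let nA_ge1 : 1 <= n%:R * A.
Proof. by apply: mulr_ege1; rewrite ?ler1n. Qed.

(** One step averages [n] orthogonal projections. By convexity the squared norm is at most the
    average of their squared norms, which is the squared norm of [g] minus the average Dirichlet
    form. *)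
Lemma glauber_contract g : \sum_(x in pcol) g x = 0 ->
  norm2 pcol (glauber_op g) <= (1 - (n%:R * A)^-1) * norm2 pcol g.
Proof.
move=> g0; have np : 0 < n%:R :> R by rewrite ltr0n.
have Ap : 0 < A by apply: lt_le_trans A_ge1.
have h1 : norm2 pcol (glauber_op g) <= n%:R^-1 * \sum_v norm2 pcol (cond pcol (~: [set v]) g).
  rewrite /norm2 exchange_big mulr_sumr /=; apply: ler_sum => x _.
  rewrite exprMn; have := @sqr_sum_le R 'I_n predT (fun v => cond pcol (~: [set v]) g x).
  rewrite cardE -cardE card_ord => h.
  apply: le_trans (ler_wpM2l _ h) _; first exact: sqr_ge0.
  by rewrite expr2 -mulrA [_ * (n%:R * _)]mulrA mulVf ?mul1r ?gt_eqF.
apply: le_trans h1 _.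
have -> : \sum_v norm2 pcol (cond pcol (~: [set v]) g) = n%:R * norm2 pcol g - \sum_v Dir pcol [set v] g.
  rewrite -[X in X%:R * _]card_ord mulr_natl -sumr_const -sumrB.
  by apply: eq_bigr => v _; rewrite DirE subKr.
have D0 : norm2 pcol g <= A * \sum_v Dir pcol [set v] g.
  apply: le_trans (poincare g); rewrite /Dir setCT.
  rewrite le_eqVlt; apply/orP; left; apply/eqP/eq_norm2 => x xp.
  have -> : cond pcol set0 g x = 0; last by rewrite subr0.
  rewrite /cond /avg (eq_bigl (mem pcol)) ?g0 ?mul0r // => y.
  have agr : agree set0 x y by apply/agreeP => v; rewrite inE.
  by rewrite in_set agr andbT.
rewrite mulrBr mulrA mulVf ?gt_eqF // mul1r mulrBl mul1r lerD2l lerN2.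
rewrite invfM -mulrA ler_wpM2l ?invr_ge0 // ?(ltW np) //.
by rewrite ler_pdivrMl.
Qed.

Lemma glauber_dist_l2 x0 t : x0 \in pcol ->
  let u := #|pcol|%:R^-1 in let g x := glauber_dist R E x0 t x - u in
  \sum_(x in pcol) g x = 0 /\ norm2 pcol g <= (1 - (n%:R * A)^-1) ^+ t.
Proof.
move=> x0p u.
have cp : 0 < #|pcol|%:R :> R by rewrite ltr0n; apply/card_gt0P; exists x0.
have ucard : \sum_(x in pcol) u = 1 by rewrite -mulr_card mulVf // gt_eqF.
elim: t => [|t [IH1 IH2]] /=.
  have s1 : \sum_(x in pcol) glauber_dist R E x0 0 x = 1.
    rewrite (bigD1 x0) //= ffunE eqxx big1 ?addr0 // => x /andP[_ /negPf xx].
    by rewrite ffunE xx.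
  split; first by rewrite sumrB s1 ucard subrr.
  rewrite expr0 norm2B.
  have -> : norm2 pcol (glauber_dist R E x0 0) = 1.
    rewrite -s1; apply: eq_bigr => x _; rewrite !ffunE.
    by case: eqP; rewrite ?expr1n ?expr0n.
  have -> : inner pcol (glauber_dist R E x0 0) (fun=> u) = u.
    by rewrite /inner -mulr_suml s1 mul1r.
  have -> : norm2 pcol (fun=> u) = u.
    by rewrite /norm2 -mulr_card expr2 -mulrA mulVf ?mulr1 // gt_eqF.
  have : 0 <= u by rewrite invr_ge0 ltW.
  rewrite mulr2n; lra.
have [_ step] := glauber_dist_step t x0p.
pose g x := glauber_dist R E x0 t x - u.
have gE x : x \in pcol -> glauber_dist R E x0 t.+1 x - u = glauber_op g x.
  by move=> xp; rewrite step // glauber_opB glauber_op_cst.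
split.
  rewrite (eq_bigr (glauber_op g)); last exact: gE.
  transitivity (inner pcol (glauber_op g) (fun=> 1)).
    by apply: eq_bigr => x _; rewrite mulr1.
  rewrite glauber_op_sym -[RHS]IH1; apply: eq_bigr => x xp.
  by rewrite glauber_op_cst // mulr1.
rewrite (eq_norm2 gE) exprS; apply: le_trans (glauber_contract IH1) _.
by rewrite ler_wpM2l // subr_ge0 invf_le1 // (lt_le_trans ltr01).
Qed.

(** Cauchy-Schwarz over at most [k ^ n] colourings passes from L2 to total variation. The term
    [n * ln k] in the time absorbs this count, the 2 leaves [exp (- 2) <= 1 / 4] for the squared L1
    distance, and the final 1 pays for rounding the time to an integer. *)
Lemma poincare_mixing :
  mixing_time_le R n k E (n%:R * A * (n%:R * ln k%:R + 2) + 1).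
Proof.
set r := n%:R * A * (n%:R * ln k%:R + 2).
have nAp : 0 < n%:R * A by apply: lt_le_trans nA_ge1.
have kp : 1 <= k%:R :> R by rewrite ler1n.
have lnk0 : 0 <= ln k%:R :> R by apply: ln_ge0.
have r0 : 0 <= r by rewrite mulr_ge0 ?(ltW nAp) // addr_ge0 // mulr_ge0.
have [T T1 rT] : exists2 T : nat, T%:R <= r + 1 & r <= T%:R.
  have /andP[lo hi] := truncn_itv r0.
  by exists (Num.truncn r).+1; rewrite ?(ltW hi) // -natr1 lerD2r.
exists T; split=> // x0; rewrite proper_pcol => x0p.
have [s0 l2] := glauber_dist_l2 T x0p.
have [supp _] := glauber_dist_step T x0p.
set u : R := #|pcol|%:R^-1 in s0 l2; set g := fun x => glauber_dist R E x0 T x - u.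
have tvE : \sum_y `|glauber_dist R E x0 T y - unif_proper R E y| = \sum_(y in pcol) `|g y|.
  rewrite (bigID (mem pcol)) /= [X in _ + X]big1 ?addr0; last first.
    by move=> y yp; rewrite supp // ffunE proper_pcol (negPf yp) subr0 normr0.
  by apply: eq_bigr => y yp; rewrite ffunE proper_pcol yp.
rewrite /tv_dist tvE.
set S := \sum_(y in pcol) _; have S0 : 0 <= S by apply: sumr_ge0.
suff : S <= 2^-1 by lra.
rewrite -ler_sqr ?nnegrE // ?invr_ge0 //.
apply: le_trans (sqr_sum_le _ _) _.
have -> : \sum_(y in pcol) `|g y| ^+ 2 = norm2 pcol g.
  by apply: eq_bigr => y _; rewrite real_normK ?num_real.
apply: (@le_trans _ _ (k%:R ^+ n * expR (- (n%:R * ln k%:R + 2)))).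
  apply: ler_pM => //; first exact: norm2_ge0.
    rewrite -natrX ler_nat; apply: leq_trans (max_card _) _.
    by rewrite card_ffun !card_ord.
  apply: le_trans l2 _.
  apply: (@le_trans _ _ (expR (- (n%:R * A)^-1) ^+ T)).
    apply: lerXn2r; rewrite ?nnegrE ?expR_ge0 //.
      by rewrite subr_ge0 invf_le1.
    exact: expR_ge1Dx.
  rewrite -expRM_natl ler_expR mulrN lerN2.
  by rewrite ler_pdivlMr // mulrC.
have -> : k%:R ^+ n = expR (n%:R * ln k%:R) :> R.
  by rewrite expRM_natl lnK // posrE (lt_le_trans ltr01).
rewrite -expRD opprD addrA subrr add0r expRN.
rewrite exprVn lef_pV2 ?posrE ?expR_gt0 ?exprn_gt0 //.
have -> : expR 2 = expR 1 ^+ 2 :> R by rewrite -expRM_natl mulr1.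
by rewrite ler_sqr ?nnegrE ?expR_ge0 //; apply: le_trans (expR_ge1Dx _); lra.
Qed.

End Mixing.

(** * First moments in the random graph *)

From mathcomp Require Import boolp.

Section RandomSubset.
Variables (R : realType) (T : finType) (Up : {set T}) (p : R).
Implicit Types (E S : {set T}) (X Y : {set T} -> R).

Definition rweight E : R := p ^+ #|E| * (1 - p) ^+ (#|Up| - #|E|).

Definition rexp X : R := \sum_(E : {set T} | E \subset Up) X E * rweight E.

Lemma sum_subset_prod (F G : T -> R) :
  \sum_(E : {set T} | E \subset Up) (\prod_(e in E) F e) * (\prod_(e in Up :\: E) G e) =
  \prod_(e in Up) (F e + G e).
Proof.
pose F' e := if e \in Up then F e else 0; pose G' e := if e \in Up then G e else 1.
transitivity (\prod_e (F' e + G' e)).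
  rewrite bigA_distr [RHS](bigID (fun J : {set T} => J \subset Up)) /= [X in _ + X]big1 ?addr0.
    apply: eq_bigr => E EU.
    rewrite big_mkcond [X in _ * X = _]big_mkcond -big_split /=.
    apply: eq_bigr => e _; rewrite /F' /G' !inE.
    case eE: (e \in E) => /=; first by rewrite (subsetP EU) ?mulr1.
    by case: (e \in Up); rewrite ?mul1r.
  move=> E /subsetPn[e eE eU]; rewrite (bigD1 e) //= eE /F' (negPf eU) mul0r //.
rewrite [RHS]big_mkcond /=; apply: eq_bigr => e _; rewrite /F' /G'.
by case: (e \in Up); rewrite ?add0r.
Qed.

Lemma rweight_prod E : E \subset Up ->
  rweight E = (\prod_(e in E) p) * (\prod_(e in Up :\: E) (1 - p)).
Proof.
move=> EU; rewrite /rweight !prodr_const; congr (_ * _ ^+ _).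
by rewrite cardsD (setIidPr EU).
Qed.

Lemma rexp_cst c : rexp (fun=> c) = c.
Proof.
rewrite /rexp -mulr_sumr (eq_bigr (fun E => (\prod_(e in E) p) * (\prod_(e in Up :\: E) (1 - p)))).
  by rewrite sum_subset_prod big1 ?mulr1 // => e _; rewrite addrC subrK.
by move=> E; apply: rweight_prod.
Qed.

Hypotheses (p_ge0 : 0 <= p) (p_le1 : p <= 1).

Lemma rweight_ge0 E : 0 <= rweight E.
Proof. by rewrite mulr_ge0 // exprn_ge0 // subr_ge0. Qed.

Lemma rexp_le X Y : (forall E, E \subset Up -> X E <= Y E) -> rexp X <= rexp Y.
Proof. by move=> h; apply: ler_sum => E EU; rewrite ler_wpM2r ?rweight_ge0 ?h. Qed.

Lemma rexp_sum (J : Type) (s : seq J) (P : pred J) (F : J -> {set T} -> R) :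
  rexp (fun E => \sum_(i <- s | P i) F i E) = \sum_(i <- s | P i) rexp (F i).
Proof.
by rewrite /rexp exchange_big; apply: eq_bigr => E _; rewrite mulr_suml.
Qed.

Lemma rexpD X Y : rexp (fun E => X E + Y E) = rexp X + rexp Y.
Proof. by rewrite /rexp -big_split; apply: eq_bigr => E _; rewrite mulrDl. Qed.

Lemma rexpZ c X : rexp (fun E => c * X E) = c * rexp X.
Proof. by rewrite /rexp mulr_sumr; apply: eq_bigr => E _; rewrite mulrA. Qed.

(** Edges are independent, so the expectation is a product. For [c e <= 2] convexity gives
    [z ^ c e - 1 <= (z ^ 2 - 1) / 2 * c e], so the product is at most an exponential in the sum of
    the [c e]. In the application [c e] counts the ends of [e] in a vertex set. *)
Lemma rexp_weight S (c : T -> nat) (z : R) : S \subset Up -> 1 <= z -> (forall e, (c e <= 2)%N) ->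
  rexp (fun E => (S \subset E)%:R * z ^+ (\sum_(e in E) c e)) <=
  p ^+ #|S| * z ^+ (2 * #|S|) * expR (p * ((z ^+ 2 - 1) / 2) * (\sum_(e in Up) c e)%:R).
Proof.
move=> SU z1 c2; have z0 : 0 < z by apply: lt_le_trans z1.
pose F e := p * z ^+ c e; pose G e := if e \in S then 0 else 1 - p.
have -> : rexp (fun E => (S \subset E)%:R * z ^+ (\sum_(e in E) c e)) =
    \prod_(e in Up) (F e + G e).
  rewrite -sum_subset_prod; apply: eq_bigr => E EU.
  have [SE|/subsetPn[e eS eE]] := boolP (S \subset E); last first.
    by rewrite !mul0r [X in _ * X](bigD1 e) ?inE ?eE ?(subsetP SU) //= /G eS mul0r mulr0.
  rewrite mul1r rweight_prod // /F big_split /= -expr_sum mulrA; congr (_ * _).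
    by rewrite mulrC.
  apply: eq_bigr => e; rewrite inE => /andP[eE _]; rewrite /G; case: ifP => // eS.
  by rewrite (subsetP SE) in eE.
have zc e : z ^+ c e <= z ^+ 2 by rewrite ler_weXn2l.
have cE e : z ^+ c e - 1 <= (z ^+ 2 - 1) / 2 * (c e)%:R.
  have := c2 e; case: (c e) => [|[|[|//]]] _.
  - by rewrite expr0 subrr mulr0.
  - rewrite expr1 mulr1 -subr_ge0.
    have -> : (z ^+ 2 - 1) / 2 - (z - 1) = (z - 1) ^+ 2 / 2 by field.
    by rewrite divr_ge0 // sqr_ge0.
  - by rewrite divfK ?pnatr_eq0.
have h : \prod_(e in Up) (F e + G e) <=
    \prod_(e in Up) ((if e \in S then p * z ^+ 2 else 1) *
                     expR (p * ((z ^+ 2 - 1) / 2) * (c e)%:R)).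
  apply: ler_prod => e eU; rewrite /F /G; apply/andP; split.
    rewrite addr_ge0 ?mulr_ge0 ?exprn_ge0 ?(ltW z0) //.
    by case: ifP => // _; rewrite subr_ge0.
  have ep : 1 <= expR (p * ((z ^+ 2 - 1) / 2) * (c e)%:R).
    rewrite -[leLHS]expR0 ler_expR mulr_ge0 // mulr_ge0 // divr_ge0 //.
    by rewrite subr_ge0 exprn_ege1.
  case: ifP => eS.
    rewrite addr0 -[leLHS]mulr1 ler_pM ?mulr_ge0 ?exprn_ge0 ?(ltW z0) //.
    by rewrite ler_wpM2l.
  rewrite mul1r; apply: le_trans (expR_ge1Dx _).
  rewrite addrCA lerD2l -[X in _ - X]mulr1 -mulrBr -mulrA.
  by rewrite ler_wpM2l.
apply: le_trans h _; rewrite big_split /= -expR_sum -mulr_sumr natr_sum.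
rewrite ler_pM2r ?expR_gt0 // -big_mkcondr /=.
rewrite (eq_bigl (mem S)) => [|e]; last first.
  by apply/andP/idP => [[]|eS] //; split=> //; apply: (subsetP SU).
by rewrite prodr_const exprMn -exprM.
Qed.

End RandomSubset.

(** * Edge counts and spanning trees of connected sets *)

Section GraphEdges.
Variable n : nat.
Implicit Types (E S : {set 'I_n * 'I_n}) (T U : {set 'I_n}).

Lemma sum_degree E U : E \subset upper_pairs n ->
  (\sum_(v in U) #|nb (adj E) v| = \sum_(e in E) ((e.1 \in U) + (e.2 \in U)))%N.
Proof.
move=> EU.
have h v : #|nb (adj E) v| = (\sum_(e in E) ((e.1 == v) + (e.2 == v)))%N.
  rewrite big_split /=.
  have -> : nb (adj E) v = [set e.2 | e in [set e in E | e.1 == v]] :|: [set e.1 | e in [set e in E | e.2 == v]].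
    apply/setP => w; rewrite !inE; apply/orP/orP.
      case=> h; [left|right]; apply/imsetP; [exists (v, w)|exists (w, v)];
        by rewrite ?inE ?h ?eqxx.
    by case=> /imsetP[[a b]]; rewrite inE => /andP[ab /eqP /= <-] ->; [left|right].
  rewrite cardsU disjoint_setI0 ?cards0 ?subn0; last first.
    rewrite -setI_eq0; apply/eqP/setP => w; rewrite !inE; apply/negP.
    move=> /andP[/imsetP[[a b]]]; rewrite inE => /andP[ab /eqP /= av] wb.
    move=> /imsetP[[c d]]; rewrite inE => /andP[cd /eqP /= dv] wc.
    have := subsetP EU _ ab; have := subsetP EU _ cd; rewrite !inE /=.
    by rewrite av dv -wb -wc => h1 h2; have := ltn_trans h1 h2; rewrite ltnn.
  rewrite !card_in_imset; last 2 first.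
  - by move=> [a b] [c d]; rewrite !inE /= => /andP[_ /eqP->] /andP[_ /eqP->] ->.
  - by move=> [a b] [c d]; rewrite !inE /= => /andP[_ /eqP->] /andP[_ /eqP->] ->.
  congr (_ + _)%N; rewrite -sum1_card big_mkcond [RHS]big_mkcond /=; apply: eq_bigr => e _;
    by rewrite !inE; case: (e \in E) => //=; case: (_ == v).
under eq_bigr do rewrite h.
rewrite exchange_big /=; apply: eq_bigr => e _; rewrite big_split /=.
have one (x : 'I_n) : (\sum_(v in U) (x == v))%N = (x \in U).
  have [xU|xU] := boolP (x \in U).
    rewrite (bigD1 x) //= eqxx big1 // => v /andP[_ /negPf].
    by rewrite eq_sym => ->.
  by rewrite big1 // => v vU; case: eqP => // xv; rewrite xv vU in xU.
by rewrite !one.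
Qed.

Definition inner_edges E T := [set e in E | (e.1 \in T) && (e.2 \in T)].

Lemma edges2E E T : E \subset upper_pairs n -> edges2 (adj E) T = (2 * #|inner_edges E T|)%N.
Proof.
move=> EU.
have sub : inner_edges E T \subset upper_pairs n.
  by apply/subsetP => e; rewrite inE => /andP[/(subsetP EU)].
have := sum_degree T sub => h.
transitivity (\sum_(v in T) #|nb (adj (inner_edges E T)) v|)%N.
  apply: eq_bigr => v vT; apply: eq_card => w; rewrite !inE /adj /inner_edges !inE /= vT /=.
  by rewrite andbT; case: (w \in T); rewrite ?andbF ?andbT.
rewrite h mulnC -sum_nat_const; apply: eq_bigr => e.
by rewrite inE => /and3P[_ -> ->].
Qed.

(** A tree is encoded by its parent map, with the root and all vertices outside the tree as fixed
    points. This gives [#|T| ^ #|T|] codes for the trees on [T]. *)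
Definition tree_edges (f : {ffun 'I_n -> 'I_n}) :=
  [set e in upper_pairs n | (f e.1 == e.2) || (f e.2 == e.1)].

Definition tree_maps T : pred {ffun 'I_n -> 'I_n} :=
  family (fun v => if v \in T then T else [set v]).

Definition ord_pair (u v : 'I_n) := if (u < v)%N then (u, v) else (v, u).

Lemma spanning_tree E T : E \subset upper_pairs n -> conn (adj E) T ->
  exists f, [/\ f \in tree_maps T, tree_edges f \subset E & (#|tree_edges f|).+1 = #|T|].
Proof.
move=> EU; elim=> {T} [v|T u v _ [f [fT fE fc]] uT vT uv].
  exists [ffun x => x]; split.
  - apply/familyP => x; rewrite ffunE; case: ifP => [|_]; first by rewrite inE.
    by rewrite inE.
  - by apply/subsetP => e; rewrite !inE !ffunE => /andP[lt /orP[]/eqP E']; rewrite E' ltnn in lt.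
  - rewrite cards1; congr _.+1; apply/eqP; rewrite cards_eq0; apply/eqP/setP => e.
    rewrite !inE !ffunE; apply/negP.
    by move=> /andP[lt /orP[]/eqP E']; rewrite E' ltnn in lt.
have fam := familyP fT.
have fv : f v = v by have := fam v; rewrite (negPf vT) inE => /eqP.
have fnv w : w != v -> f w != v.
  move=> wv; have := fam w; case: ifP => [_ fw|_]; first by apply: contraNneq vT => <-.
  by rewrite inE => /eqP ->.
have uv' : u != v by apply: contraNneq vT => <-.
pose f' : {ffun 'I_n -> 'I_n} := [ffun w => if w == v then u else f w].
have pU : ord_pair u v \in upper_pairs n.
  rewrite /ord_pair inE; case: (ltngtP u v) => [//|//|/val_inj E'].
  by rewrite E' eqxx in uv'.
have pE : ord_pair u v \in E.
  have := uv; rewrite /adj /ord_pair; case: (ltngtP u v) => [lt|gt|/val_inj E'] /=.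
  - case/orP => // /(subsetP EU); rewrite inE /= => lt'.
    by have := ltn_trans lt lt'; rewrite ltnn.
  - case/orP => // /(subsetP EU); rewrite inE /= => lt'.
    by have := ltn_trans gt lt'; rewrite ltnn.
  - by rewrite E' eqxx in uv'.
have tE : tree_edges f' = ord_pair u v |: tree_edges f.
  apply/setP => -[a b]; rewrite !inE /= !ffunE /ord_pair.
  have [av|av] := eqVneq a v; have [bv|bv] := eqVneq b v.
  - rewrite av bv ltnn /= orbF.
    by case: ifP => _; rewrite xpair_eqE [v == u]eq_sym (negPf uv') ?andbF.
  - rewrite av fv [v == b]eq_sym (negPf bv) (negPf (fnv _ bv)) !orbF andbF orbF.
    case: (ltngtP u v) => [lt|gt|/val_inj E'].
    + rewrite xpair_eqE [v == u]eq_sym (negPf uv') /=.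
      by case: eqP => [<-|]; rewrite ?andbF // ltnNge (ltnW lt).
    + by rewrite xpair_eqE eqxx /= [u == b]eq_sym; case: eqP => [->|]; rewrite ?andbF ?andbT.
    + by rewrite E' eqxx in uv'.
  - rewrite bv fv [v == a]eq_sym (negPf av) (negPf (fnv _ av)) /= andbF orbF.
    case: (ltngtP u v) => [lt|gt|/val_inj E'].
    + by rewrite xpair_eqE eqxx andbT [u == a]eq_sym; case: eqP => [->|]; rewrite ?andbF ?andbT.
    + rewrite xpair_eqE [v == u]eq_sym (negPf uv') andbF.
      by case: eqP => [<-|]; rewrite ?andbF // ltnNge (ltnW gt).
    + by rewrite E' eqxx in uv'.
  - by case: ifP => _; rewrite xpair_eqE ?(negPf av) ?(negPf bv) ?andbF.
exists f'; split.
- apply/familyP => w; rewrite ffunE !inE; case: (w =P v) => [->|/eqP wv] /=; first by rewrite inE uT orbT.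
  by have := fam w; case: ifP => // wT; rewrite inE => ->; rewrite orbT.
- by rewrite tE subUset sub1set pE.
- rewrite tE cardsU1 cardsU1 vT -fc.
  suff -> : ord_pair u v \notin tree_edges f by [].
  rewrite inE pU /= /ord_pair; have fu := fnv u uv'.
  by case: ifP => _ /=; rewrite fv (negPf fu) [v == u]eq_sym (negPf uv').
Qed.

Lemma card_tree_maps T : #|tree_maps T| = (#|T| ^ #|T|)%N.
Proof.
rewrite card_family foldrE big_map big_enum /=.
rewrite (bigID (mem T)) /= [X in (_ * X)%N]big1 ?muln1.
  by rewrite (eq_bigr (fun=> #|T|)) ?prod_nat_const // => v ->.
by move=> v /negPf ->; rewrite cards1.
Qed.

End GraphEdges.

(** * Expected numbers of connected sets *)

Section ConnectedSetCounts.
Variables (R : realType) (n : nat) (p : R).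
Hypotheses (p_ge0 : 0 <= p) (p_le1 : p <= 1).
Local Notation Up := (upper_pairs n).
Local Notation rexp := (rexp Up p).
Implicit Types (E S : {set 'I_n * 'I_n}) (T U : {set 'I_n}).

Lemma ffact_le_exp m t : (m ^_ t <= m ^ t)%N.
Proof.
elim: t => [|t IH]; first by rewrite ffactn0 expn0.
by rewrite ffactnSr expnSr leq_mul // leq_subr.
Qed.

Lemma pow_self_le t : (t ^ t)%:R <= expR 1 ^+ t * (t`!)%:R :> R.
Proof.
elim: t => [|t IH]; first by rewrite expn0 expr0 fact0 mulr1.
have [->|t0] := posnP t; first by rewrite expn1 expr1 factS fact0 muln1 mulr1 ltW ?expR_gt1.
have tp : 0 < t%:R :> R by rewrite ltr0n.
have h : (t.+1 ^ t)%:R <= expR 1 * (t ^ t)%:R :> R.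
  have -> : (t.+1 ^ t)%:R = (1 + t%:R^-1) ^+ t * (t ^ t)%:R :> R.
    rewrite !natrX -exprMn mulrDl mul1r mulVf ?gt_eqF //.
    by rewrite [_ + 1]addrC nat1r.
  rewrite ler_wpM2r //; have -> : expR 1 = expR (t%:R^-1) ^+ t :> R.
    by rewrite -expRM_natl divff ?gt_eqF.
  by rewrite lerXn2r ?nnegrE ?expR_ge0 ?expR_ge1Dx // addr_ge0 // invr_ge0.
rewrite expnS natrM factS natrM exprS.
have -> : expR 1 * expR 1 ^+ t * (t.+1%:R * t`!%:R) = t.+1%:R * (expR 1 * (expR 1 ^+ t * t`!%:R)) :> R.
  by ring.
rewrite ler_wpM2l //; apply: le_trans h _.
by rewrite ler_wpM2l ?expR_ge0.
Qed.

Lemma bin_pow_self_le t : ('C(n, t) * t ^ t)%:R <= (expR 1 * n%:R) ^+ t :> R.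
Proof.
rewrite natrM exprMn; apply: (@le_trans _ _ ('C(n, t)%:R * (expR 1 ^+ t * (t`!)%:R))).
  by rewrite ler_wpM2l // pow_self_le.
rewrite mulrCA ler_wpM2l ?exprn_ge0 ?expR_ge0 // -natrM bin_ffact -natrX ler_nat.
exact: ffact_le_exp.
Qed.

(** A union bound over [T] and the code of a spanning tree: at most ['C(n, t.+1) * t.+1 ^ t.+1 <= (e
    * n) ^ t.+1] pairs, while [M] bounds the expectation of [Y] on the event that [t] prescribed
    edges are present. *)
Lemma tree_sum_bound (Y : {set 'I_n} -> {set 'I_n * 'I_n} -> R) t (M : R) :
  (forall T E, 0 <= Y T E) -> 0 <= M ->
  (forall T S, #|T| = t.+1 -> S \subset Up -> #|S| = t ->
     rexp (fun E => (S \subset E)%:R * Y T E) <= M) ->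
  rexp (fun E => \sum_(T : {set 'I_n} | (#|T| == t.+1) && `[< conn (adj E) T >]) Y T E) <=
  (expR 1 * n%:R) ^+ t.+1 * M.
Proof.
move=> Y0 M0 h.
apply: (@le_trans _ _ (rexp (fun E => \sum_(T : {set 'I_n} | #|T| == t.+1)
    \sum_(f | (f \in tree_maps T) && (#|tree_edges f| == t)) (tree_edges f \subset E)%:R * Y T E))).
  apply: rexp_le => // E EU; rewrite big_mkcondr; apply: ler_sum => T cT.
  have s0 (P : pred {ffun 'I_n -> 'I_n}) : 0 <= \sum_(f | P f) (tree_edges f \subset E)%:R * Y T E.
    by apply: sumr_ge0 => f _; rewrite mulr_ge0.
  case: ifP => // /asboolP cn.
  have [f [fT fE fc]] := spanning_tree EU cn.
  rewrite (eqP cT) in fc; case: fc => fc.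
  by rewrite (bigD1 f) ?fT ?fc //= fE mul1r lerDl.
rewrite rexp_sum.
apply: (@le_trans _ _ (\sum_(T : {set 'I_n} | #|T| == t.+1) (t.+1 ^ t.+1)%:R * M)).
  apply: ler_sum => T /eqP cT; rewrite rexp_sum.
  apply: (@le_trans _ _ (\sum_(f | (f \in tree_maps T) && (#|tree_edges f| == t)) M)).
    apply: ler_sum => f /andP[_ /eqP fc]; apply: h => //.
    by apply/subsetP => e; rewrite inE => /andP[].
  rewrite big_mkcondr /=; apply: (@le_trans _ _ (\sum_(f in tree_maps T) M)).
    by apply: ler_sum => f _; case: ifP.
  by rewrite sumr_const card_tree_maps cT mulr_natl.
have -> : \sum_(T : {set 'I_n} | #|T| == t.+1) (t.+1 ^ t.+1)%:R * M = ('C(n, t.+1) * t.+1 ^ t.+1)%:R * M.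
  have := card_draws 'I_n t.+1; rewrite card_ord => <-.
  rewrite natrM -mulrA [RHS]mulr_natl -sumr_const; apply: eq_bigl => T.
  by rewrite inE.
by rewrite ler_wpM2r // bin_pow_self_le.
Qed.

Lemma rexp_sub S : S \subset Up -> rexp (fun E => (S \subset E)%:R) <= p ^+ #|S|.
Proof.
move=> SU; have := @rexp_weight R _ Up p p_ge0 p_le1 S (fun=> 0%N) 1 SU (lexx 1) (fun=> isT).
rewrite !expr1n subrr mul0r mulr0 mul0r expR0 !mulr1; apply: le_trans.
by apply: rexp_le => // E _; rewrite expr1n mulr1.
Qed.

Definition dense_count s j E : R := \sum_(t < s)
  \sum_(T : {set 'I_n} | (#|T| == t.+1) && `[< conn (adj E) T >]) (2 * (#|T| + j) < edges2 (adj E) T)%N%:R.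

Lemma subset_of_card (J : finType) (A : {set J}) m : (m <= #|A|)%N ->
  exists2 Q : {set J}, Q \subset A & #|Q| = m.
Proof.
move=> h; have : (0 < #|[set Q : {set J} | Q \subset A & #|Q| == m]|)%N.
  by rewrite cards_draws bin_gt0.
by move=> /card_gt0P[Q]; rewrite inE => /andP[QA /eqP]; exists Q.
Qed.

(** Beside the [t] tree edges a counted set contains [j + 2] further edges, chosen among at most
    [(t + 1) ^ 2] ordered pairs. They bring the extra factor [p ^ (j + 2)], against which the vertex
    choice supplies a single spare [n]. *)
Lemma dense_count_le s j :
  rexp (dense_count s j) <=
  \sum_(t < s) (expR 1 * n%:R) ^+ t.+1 * (((t.+1 ^ 2) ^ j.+2)%:R * p ^+ (t + j.+2)).
Proof.
rewrite rexp_sum; apply: ler_sum => t _; apply: tree_sum_bound => //.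
  by rewrite mulr_ge0 // exprn_ge0.
move=> T S cT SU cS.
pose Qs := [set Q : {set 'I_n * 'I_n} | Q \subset setX T T & #|Q| == j.+2].
apply: (@le_trans _ _ (rexp (fun E => \sum_(Q in Qs | (Q \subset Up) && [disjoint S & Q])
    (S :|: Q \subset E)%:R))).
  apply: rexp_le => // E EU.
  have s0 (P : pred {set 'I_n * 'I_n}) : 0 <= \sum_(Q in Qs | P Q) (S :|: Q \subset E)%:R :> R.
    by apply: sumr_ge0.
  case SE: (S \subset E); last by rewrite mul0r.
  rewrite mul1r; case: ltnP => // big.
  rewrite edges2E // ltn_mul2l /= cT in big.
  have : (j.+2 <= #|inner_edges E T :\: S|)%N.
    have aS : (#|inner_edges E T :&: S| <= t)%N by rewrite -cS subset_leq_card ?subsetIr.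
    rewrite -(leq_add2l #|inner_edges E T :&: S|) cardsID; apply: leq_trans big.
    by rewrite !addnS addSn !ltnS leq_add2r.
  move=> /subset_of_card[Q QI cQ].
  have QE e : e \in Q -> [/\ e \in E, e.1 \in T, e.2 \in T & e \notin S].
    by move=> /(subsetP QI); rewrite !inE => /andP[-> /and3P[-> -> ->]].
  rewrite (bigD1 Q) /=; last first.
    apply/and3P; split; [rewrite inE cQ eqxx andbT| |].
    - by apply/subsetP => -[a b] /QE[_ /= aT bT _]; rewrite inE /= aT bT.
    - by apply/subsetP => e /QE[/(subsetP EU)].
    - by rewrite disjoint_sym disjoint_subset; apply/subsetP => e /QE[_ _ _]; rewrite inE.
  have -> : S :|: Q \subset E by rewrite subUset SE; apply/subsetP => e /QE[].
  by rewrite lerDl sumr_ge0.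
rewrite rexp_sum.
apply: (@le_trans _ _ (\sum_(Q in Qs) p ^+ (t + j.+2))).
  rewrite big_mkcondr; apply: ler_sum => Q; rewrite inE => /andP[_ /eqP cQ].
  case: ifP => [/andP[QU dis]|_]; last by rewrite exprn_ge0.
  apply: le_trans (rexp_sub _) _; first by rewrite subUset SU.
  by rewrite cardsU disjoint_setI0 // cards0 subn0 cS cQ.
rewrite sumr_const -[_ *+ _]mulr_natl ler_wpM2r ?exprn_ge0 // ler_nat.
rewrite cards_draws cardsX cT -mulnn.
apply: leq_trans (_ : _ <= (t.+1 * t.+1) ^_ j.+2)%N (ffact_le_exp _ _).
by rewrite -bin_ffact leq_pmulr // fact_gt0.
Qed.

Definition conn_count s E : R := \sum_(t < s)
  \sum_(T : {set 'I_n} | (#|T| == t.+1) && `[< conn (adj E) T >]) 1.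

Lemma conn_count_le s :
  rexp (conn_count s) <= \sum_(t < s) (expR 1 * n%:R) ^+ t.+1 * p ^+ t.
Proof.
rewrite rexp_sum; apply: ler_sum => t _; apply: tree_sum_bound => //.
  by rewrite exprn_ge0.
move=> T S cT SU cS; rewrite -cS; apply: le_trans (rexp_sub SU).
by apply: rexp_le => // E _; rewrite mulr1.
Qed.

Variables (lam c2 D : R) (x : nat -> R).
Hypotheses (lam_ge0 : 0 <= lam) (c2_ge0 : 0 <= c2) (c2_le : c2 <= lam) (D_ge0 : 0 <= D).
Hypothesis tilt : n%:R * p * ((expR lam ^+ 2 - 1) / 2) <= D * (lam - c2).

(* A Chernoff weight: the term of [T] and [U] is at least [1] as soon as the
   degrees over [U] sum to more than [D] times both [#|U|] and [x #|T|]. *)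
Definition excess_count E : R := \sum_(t < n)
  \sum_(T : {set 'I_n} | (#|T| == t.+1) && `[< conn (adj E) T >])
    \sum_(U : {set 'I_n} | U \subset T)
      expR lam ^+ (\sum_(v in U) #|nb (adj E) v|) * expR (- (lam * D * Num.max #|U|%:R (x t.+1))).

(** The tree edges contribute at most [expR lam ^ (2 * t)]. By [tilt] the remaining edges contribute
    at most [exp (D * (lam - c2) * #|U|)], so that of the Chernoff factor the rate [c2 * D]
    survives; the choice of [U] costs [2 ^ (t + 1)]. *)
Lemma excess_count_le : rexp excess_count <=
  \sum_(t < n) (expR 1 * n%:R) ^+ t.+1 *
    (2 ^+ t.+1 * p ^+ t * expR lam ^+ (2 * t) * expR (- (c2 * D * x t.+1))).
Proof.
have l1 : 1 <= expR lam by rewrite -[leLHS]expR0 ler_expR.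
rewrite rexp_sum; apply: ler_sum => t _; apply: tree_sum_bound => //.
- by move=> T E; apply: sumr_ge0 => U _; rewrite mulr_ge0 ?exprn_ge0 ?expR_ge0.
- by rewrite !mulr_ge0 ?exprn_ge0 ?expR_ge0.
move=> T S cT SU cS.
apply: (@le_trans _ _ (rexp (fun E => \sum_(U : {set 'I_n} | U \subset T)
    expR (- (lam * D * Num.max #|U|%:R (x t.+1))) *
    ((S \subset E)%:R * expR lam ^+ (\sum_(e in E) ((e.1 \in U) + (e.2 \in U))%N))))).
  apply: rexp_le => // E EU; rewrite mulr_sumr; apply: ler_sum => U _.
  by rewrite sum_degree // mulrA mulrC.
rewrite rexp_sum.
have -> : 2 ^+ t.+1 * p ^+ t * expR lam ^+ (2 * t) * expR (- (c2 * D * x t.+1)) =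
    \sum_(U : {set 'I_n} | U \subset T) p ^+ t * expR lam ^+ (2 * t) * expR (- (c2 * D * x t.+1)).
  rewrite -!mulrA -natrX -cT -card_powerset [LHS]mulr_natl -sumr_const.
  by apply: eq_bigl => U; rewrite inE.
apply: ler_sum => U _; rewrite rexpZ.
set c := fun e : 'I_n * 'I_n => ((e.1 \in U) + (e.2 \in U))%N.
have c2' e : (c e <= 2)%N by rewrite /c; do 2!case: (_ \in _).
have := rexp_weight p_ge0 p_le1 SU l1 c2'; rewrite cS => h.
apply: le_trans (ler_wpM2l (expR_ge0 _) h) _.
rewrite mulrCA ler_wpM2l ?mulr_ge0 ?exprn_ge0 ?expR_ge0 // -expRD ler_expR.
have sumU : (\sum_(e in Up) c e)%:R <= #|U|%:R * n%:R :> R.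
  rewrite -sum_degree // -natrM ler_nat -sum_nat_const; apply: leq_sum => v _.
  by rewrite -[X in (_ <= X)%N]card_ord max_card.
set m := Num.max _ _; set w := (expR lam ^+ 2 - 1) / 2.
have Um : #|U|%:R <= m by rewrite le_max lexx.
have xm : x t.+1 <= m by rewrite le_max lexx orbT.
have m0 : 0 <= m by apply: le_trans Um.
have w0 : 0 <= w by rewrite divr_ge0 // subr_ge0 exprn_ege1.
have h1 : p * w * (\sum_(e in Up) c e)%:R <= #|U|%:R * (D * (lam - c2)).
  apply: (@le_trans _ _ (p * w * (#|U|%:R * n%:R))); first by rewrite ler_wpM2l // mulr_ge0.
  have -> : p * w * (#|U|%:R * n%:R) = #|U|%:R * (n%:R * p * w) by ring.
  by rewrite ler_wpM2l.
have h2 : #|U|%:R * (D * (lam - c2)) <= m * (D * (lam - c2)).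
  by rewrite ler_wpM2r // mulr_ge0 // subr_ge0.
have h3 : c2 * D * x t.+1 <= c2 * D * m by rewrite ler_wpM2l // mulr_ge0.
have h4 : m * (D * (lam - c2)) = lam * D * m - c2 * D * m by ring.
lra.
Qed.

Lemma gnp_markov (A : {set 'I_n * 'I_n} -> Prop) (X : {set 'I_n * 'I_n} -> R) :
  (forall E, 0 <= X E) -> (forall E, E \subset Up -> ~ A E -> 1 <= X E) ->
  1 - rexp X <= gnp_prob R n p A.
Proof.
move=> X0 h.
have -> : gnp_prob R n p A = rexp (fun E => `[< A E >]%:R).
  apply: eq_bigr => E _; rewrite /rweight; case: ifP => _; first by rewrite mul1r.
  by rewrite mul0r.
rewrite lerBlDr -[leLHS](rexp_cst Up p) -rexpD; apply: rexp_le => // E EU.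
case: asboolP => hA /=; first by rewrite lerDl.
by rewrite add0r h.
Qed.

Lemma gnp_prob_le1 (A : {set 'I_n * 'I_n} -> Prop) : gnp_prob R n p A <= 1.
Proof.
have -> : gnp_prob R n p A = rexp (fun E => `[< A E >]%:R).
  apply: eq_bigr => E _; rewrite /rweight; case: ifP => _; first by rewrite mul1r.
  by rewrite mul0r.
rewrite -[leRHS](rexp_cst Up p); apply: rexp_le => // E EU.
by case: asboolP.
Qed.

End ConnectedSetCounts.

(** * Poincare inequality for good graphs *)

Section LocalStructure.
Variables (V : finType) (e : rel V).
Hypotheses (e_sym : symmetric e) (e_irr : irreflexive e).
Implicit Types (T B X Z : {set V}) (u v w : V).
Local Open Scope nat_scope.

Lemma conn_star w (N : {set V}) : N \subset nb e w -> conn e (w |: N).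
Proof.
move=> Nw; apply: (conn_grow (conn1 e w)); first by rewrite sub1set setU11.
move=> B; rewrite sub1set => wB /properP[_ [y yN yB]].
exists w, y; split=> //.
move: yN; rewrite !inE => /predU1P[yw|/(subsetP Nw)]; last by rewrite inE.
by rewrite yw wB in yB.
Qed.

Lemma edges2_ge2 T a b : a \in T -> b \in T -> e a b -> 2 <= edges2 e T.
Proof.
move=> aT bT ab; have ba : b != a by apply: contraTneq ab => ->; rewrite e_irr.
rewrite /edges2 (bigD1 a) //= (bigD1 b) /= ?bT //.
have h1 : 0 < #|nb e a :&: T| by rewrite card_gt0; apply/set0Pn; exists b; rewrite !inE ab.
have h2 : 0 < #|nb e b :&: T| by rewrite card_gt0; apply/set0Pn; exists a; rewrite !inE e_sym ab.
by move: h1 h2; clear; lia.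
Qed.

(** The star already has [#|nb e w|] edges, so the bound leaves room for one edge between
    neighbours; [P] takes one of its ends. *)
Lemma locally_sparse_of w : edges2 e (w |: nb e w) <= 2 * #|w |: nb e w| ->
  exists2 P : {set V}, #|P| <= 1 & {in nb e w :\: P &, forall u v, ~~ e u v}.
Proof.
have wn : w \notin nb e w by rewrite inE e_irr.
rewrite edges2U1 // cardsU1 wn setIid => h.
have {}h : edges2 e (nb e w) <= 2 by move: h; clear; lia.
have [/exists_inP[u uw /exists_inP[v vw uv]]|no] :=
    boolP [exists u in nb e w, exists v in nb e w, e u v].
  exists [set u]; first by rewrite cards1.
  move=> a b; rewrite !in_setD !in_set1 => /andP[au aw] /andP[bu bw]; apply/negP => ab.
  have := edges2_ge2 (T := nb e w :\ u) (a := a) (b := b).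
  rewrite !in_setD1 au aw bu bw => /(_ isT isT ab) h2.
  have un : u \notin nb e w :\ u by rewrite !inE eqxx.
  have := edges2U1 e_sym e_irr un; rewrite setD1K // => h3.
  have : 0 < #|nb e u :&: (nb e w :\ u)|.
    rewrite card_gt0; apply/set0Pn; exists v; rewrite in_setI in_setD1 vw inE uv /=.
    by rewrite andbT; apply: contraTneq uv => ->; rewrite e_irr.
  by move: h h2 h3; clear; lia.
exists set0; first by rewrite cards0.
move=> a b; rewrite !setD0 => aw bw; apply: contra no => ab.
by apply/exists_inP; exists a => //; apply/exists_inP; exists b.
Qed.

Lemma card_nb_conn j0 X v : conn e X -> v \notin X ->
  (forall T, conn e T -> #|T| <= #|X|.+1 -> edges2 e T <= 2 * (#|T| + j0)) ->
  #|nb e v :&: X| <= j0 + 2.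
Proof.
move=> cX vX sp.
have [->|/set0Pn[u]] := eqVneq (nb e v :&: X) set0; first by rewrite cards0.
rewrite !inE => /andP[vu uX].
have cvX : conn e (v |: X) by apply: conn_add cX uX vX _; rewrite e_sym.
have cE : #|v |: X| = #|X|.+1 by rewrite cardsU1 vX.
have := sp _ cvX; rewrite cE leqnn => /(_ isT); rewrite edges2U1 //.
by have := conn_edges2_ge e_sym e_irr cX; clear; lia.
Qed.

(* Each step adds one vertex of [Z] at the cost of at most two others: take a
   vertex at distance two from [T] and a neighbour of it in [Z]. *)
Lemma skeleton B Z i : conn e B ->
  (forall v, v \in B -> v \notin Z -> exists h, [/\ h \in B, h \in Z & e v h]) ->
  0 < i -> i <= #|Z :&: B| ->
  exists T, [/\ conn e T, T \subset B, #|T| <= 3 * i & #|T :&: Z| = i].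
Proof.
move=> cB dom; elim: i => // -[|i] IH _ iZ.
  have /card_gt0P[z /setIP[zZ zB]] : 0 < #|Z :&: B| by [].
  exists [set z]; split; rewrite ?sub1set ?cards1 //; first exact: conn1.
  have -> : [set z] :&: Z = [set z]; last by rewrite cards1.
  by apply/setP => x; rewrite !inE; case: eqP => [->|].
have [T [cT TB sT TZ]] := IH isT (ltnW iZ).
have addz z S : conn e S -> S \subset B -> #|S| <= 3 * i.+1 + 2 -> S :&: Z = T :&: Z ->
    z \in Z -> z \in B -> z \notin S -> (exists2 u, u \in S & e u z) ->
    exists T', [/\ conn e T', T' \subset B, #|T'| <= 3 * i.+2 & #|T' :&: Z| = i.+2].
  move=> cS SB sS SZ zZ zB zS [u uS uz].
  exists (z |: S); split.
  - exact: conn_add cS uS zS uz.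
  - by rewrite subUset sub1set zB.
  - by rewrite cardsU1 zS; move: sS; clear; lia.
  - have -> : (z |: S) :&: Z = z |: (T :&: Z).
      by rewrite setIUl SZ; congr (_ :|: _); apply/setIidPl; rewrite sub1set.
    by rewrite cardsU1 -SZ inE (negPf zS) SZ TZ.
have [z zB zT] : exists2 z, z \in Z :&: B & z \notin T.
  apply/exists_inP; apply: contraT; rewrite negb_exists_in => /forall_inP h.
  have : Z :&: B \subset T :&: Z.
    apply/subsetP => x xZB; rewrite inE; have := h x xZB; rewrite negbK => ->.
    by move: xZB => /setIP[].
  by move=> /subset_leq_card; rewrite TZ leqNgt iZ.
have [t tT] := set0Pn _ (conn_n0 cT).
have tB := subsetP TB _ tT.
have [zZ zB'] := setIP zB.
have [/exists_inP[w /setIP[wZ wB] /andP[wT /exists_inP[u uT uw]]]|noZ] :=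
    boolP [exists w in Z :&: B, (w \notin T) && [exists u in T, e u w]].
  by apply: (addz w T) => //; [move: sT; clear; lia|exists u].
pose N := T :|: [set w in B | [exists u in T, e u w]].
have TN x : x \in T -> x \in N by move=> xT; rewrite inE xT.
have zN : z \notin N.
  rewrite !inE (negPf zT) zB' /=; apply: contra noZ => h.
  by apply/exists_inP; exists z => //; rewrite zT.
have [w [x [wB wN xB xN wx]]] := conn_boundary e_sym cB tB (TN _ tT) zB' zN.
have xT : x \notin T by apply: contra xN; apply: TN.
have far u : u \in T -> ~~ e u x.
  move=> uT; apply: contra xN => ux; rewrite !inE xB /=.
  by apply/orP; right; apply/exists_inP; exists u.
have wT : w \notin T by apply/negP => /far; rewrite wx.
have [u uT uw] : exists2 u, u \in T & e u w.
  by apply/exists_inP; move: wN; rewrite !inE (negPf wT) => /andP[].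
have wZ : w \notin Z.
  apply: contra noZ => wZ; apply/exists_inP; exists w; rewrite ?inE ?wZ //.
  by rewrite wT; apply/exists_inP; exists u.
have cT1 : conn e (w |: T) by apply: conn_add cT uT wT uw.
have sT1 : #|w |: T| <= 3 * i.+1 + 1 by rewrite cardsU1 wT; move: sT; clear; lia.
have T1B : w |: T \subset B by rewrite subUset sub1set wB.
have dropZ y S : y \notin Z -> (y |: S) :&: Z = S :&: Z.
  move=> yZ; rewrite setIUl; have -> : [set y] :&: Z = set0; last by rewrite set0U.
  by apply/setP => a; rewrite !inE; case: eqP => [->|]; rewrite ?(negPf yZ).
have xT1 : x \notin w |: T.
  rewrite inE negb_or xT andbT inE; apply: contraTneq wx => ->.
  by rewrite e_irr.
have [xZ|xZ] := boolP (x \in Z).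
  apply: (addz x (w |: T)); rewrite ?dropZ //; first by move: sT1; clear; lia.
  by exists w; rewrite ?setU11.
have [h [hB hZ xh]] := dom x xB xZ.
have hT : h \notin T by apply/negP => /far; rewrite e_sym xh.
have cT2 : conn e (x |: (w |: T)) by apply: conn_add cT1 (setU11 _ _) xT1 wx.
apply: (addz h (x |: (w |: T))); rewrite ?dropZ //.
- by rewrite subUset sub1set xB.
- by rewrite cardsU1 xT1; move: sT1; clear; lia.
- rewrite !inE (negPf hT) orbF; apply/norP; split; first by apply: contraTneq xh => ->; rewrite e_irr.
  by apply: contraTneq hZ => ->.
- by exists x; rewrite ?setU11.
Qed.

End LocalStructure.

(** * Existence of list colourings by greedy choice *)

Section Feasibility.
Variables (V C : finType) (e : rel V).
Hypotheses (e_sym : symmetric e) (e_irr : irreflexive e).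
Local Notation coloring := {ffun V -> C}.
Implicit Types (vs ws : seq V) (L : V -> {set C}) (z : coloring) (F : {set V}).
Local Open Scope nat_scope.

Fixpoint greedy L vs : bool :=
  if vs is v :: vs' then (#|nb e v :&: [set u in vs']| < #|L v|) && greedy L vs' else true.

Lemma greedy_ex L z vs : uniq vs -> greedy L vs -> lcol e [set u in vs] L z != set0.
Proof.
elim: vs => [|v vs IH] /=.
  move=> _ _; apply/set0Pn; exists z; apply/lcolP; split=> // [v|u v]; by rewrite inE.
move=> /andP[vvs uvs] /andP[Lv gvs]; have /set0Pn[x /lcolP[x1 x2 x3]] := IH uvs gvs.
have /subsetPn[c cL cN] : ~~ (L v \subset x @: (nb e v :&: [set u in vs])).
  apply/negP => /subset_leq_card h; have := leq_trans Lv (leq_trans h (leq_imset_card _ _)).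
  by rewrite ltnn.
apply/set0Pn; exists (upd x v c); apply/lcolP; split=> [u|u|a b].
- rewrite !inE negb_or => /andP[uv uvs']; rewrite ffunE (negPf uv) x1 // inE //.
- rewrite !inE ffunE; case: (u =P v) => [-> //|_] /= uvs'.
  by apply: x2; rewrite inE.
- have nbv a' : a' \in vs -> e v a' -> x a' != c.
    by move=> avs va; apply: contraNneq cN => <-; apply: imset_f; rewrite !inE va.
  rewrite !inE !ffunE; case: (a =P v) => [->|_] /=; case: (b =P v) => [->|_] //= avs bvs ab.
  + by rewrite e_irr in ab.
  + by rewrite eq_sym nbv.
  + by rewrite nbv // e_sym.
  + by apply: x3; rewrite ?inE.
Qed.

Lemma greedy_cat L vs ws F : greedy L ws -> {subset vs <= F} -> {subset ws <= F} ->
  (forall v, v \in vs -> #|nb e v :&: F| < #|L v|) -> greedy L (vs ++ ws).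
Proof.
move=> gws; elim: vs => //= v vs IH sub subw h; apply/andP; split.
  apply: leq_ltn_trans (h v (mem_head _ _)); apply/subset_leq_card/subsetP => u.
  rewrite !inE mem_cat => /andP[-> /=]; case/orP => [uvs|/subw //].
  by apply: sub; rewrite inE uvs orbT.
apply: IH => // u uvs; first by apply: sub; rewrite inE uvs orbT.
by apply: h; rewrite inE uvs orbT.
Qed.

Lemma greedy_degenerate L D0 vs : degenerate e D0 vs ->
  (forall v, v \in vs -> D0 < #|L v|) -> greedy L vs.
Proof.
elim: vs => //= v vs IH /andP[dv dvs] h; apply/andP; split.
  exact: leq_ltn_trans dv (h v (mem_head _ _)).
by apply: IH => // u uvs; apply: h; rewrite inE uvs orbT.
Qed.

(** Greedy colouring runs from the end of the list: heavy vertices come first, along their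
    elimination order, where more than [D0] colours suffice. A light vertex can wait until last
    because its degree is below [#|C|]. *)
Lemma feasible D D0 F L z : D < #|C| -> lists_ok e F L ->
  (forall v, v \in F -> v \in heavy e D -> D0 + #|nb e v :\: F| < #|C|) ->
  (exists vs, [/\ uniq vs, vs =i F :&: heavy e D & degenerate e D0 vs]) ->
  lcol e F L z != set0.
Proof.
move=> DC ok hv [ws [uws wsE dws]].
pose vs := enum (F :\: heavy e D).
have vsE v : v \in vs = (v \in F) && (v \notin heavy e D).
  by rewrite mem_enum in_setD andbC.
have -> : F = [set u in vs ++ ws].
  apply/setP => v; rewrite in_set mem_cat vsE wsE in_setI.
  by case: (v \in F) => //=; case: (v \in heavy e D).
apply: greedy_ex.
  rewrite cat_uniq enum_uniq uws andbT /=; apply/hasPn => v.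
  by rewrite wsE in_setI vsE => /andP[_ ->]; rewrite andbF.
have split_nb v : #|nb e v| = #|nb e v :&: F| + #|nb e v :\: F| by rewrite cardsID.
apply: (@greedy_cat _ _ _ F).
- apply: (greedy_degenerate dws) => v; rewrite wsE in_setI => /andP[vF vH].
  by have := hv v vF vH; have := ok v vF; clear; lia.
- by move=> v; rewrite vsE => /andP[].
- by move=> v; rewrite wsE in_setI => /andP[].
- move=> v; rewrite vsE => /andP[vF]; rewrite inE -leqNgt => dv.
  by have := ok v vF; have := split_nb v; move: dv DC; clear; lia.
Qed.

End Feasibility.

(** * Consequences of sparsity and of rare heavy vertices *)

Section GoodGraph.
Variables (R : realType) (V C : finType) (e : rel V).
Hypotheses (e_sym : symmetric e) (e_irr : irreflexive e).
Local Notation coloring := {ffun V -> C}.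
Variables (D N0 j0 l s2 : nat) (gam beta : R).
Local Notation H := (heavy e D).
Local Notation D0 := (2 * (1 + j0))%N.
Implicit Types (T B X La U F : {set V}) (f : coloring -> R).

Hypotheses (D_ge : (32 <= D)%N) (N0_gt1 : (1 < N0)%N) (colors : (D + N0 <= #|C|)%N).
Hypothesis D0_small : (3 * D0 < N0)%N.
Hypotheses (gam_ge0 : 0 <= gam) (gam_le : gam <= 4^-1) (beta_ge0 : 0 <= beta).
Hypothesis sparse_small : forall T, conn e T -> (#|T| <= 3 * l.+2)%N -> (edges2 e T <= 2 * #|T|)%N.
Hypothesis sparse_large : forall T, conn e T -> (#|T| <= s2)%N -> (edges2 e T <= 2 * (#|T| + j0))%N.
Hypothesis light_sum : forall T, conn e T ->
  \sum_(v in T) hw R e H D v <= gam / 2 * #|T|%:R + beta.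
Hypothesis D_l : (D + 2 <= 3 * l.+2)%N.
Hypothesis beta_s2 : 2 * beta <= s2%:R.

Definition far_light := [set v | (v \notin H) && (nb e v :&: H == set0)].
Local Notation M := far_light.

Lemma hw_ge1 v : v \in H -> 1 <= hw R e H D v.
Proof.
move=> vH; rewrite /hw vH ler_pdivlMr ?ltr0n ?(leq_trans _ D_ge) // mul1r ler_nat.
by apply: ltnW; move: vH; rewrite inE.
Qed.

Lemma card_heavy_le T : #|T :&: H|%:R <= \sum_(v in T) hw R e H D v.
Proof.
rewrite -[leLHS]mul1r mulr_card big_mkcond [leRHS]big_mkcond /=; apply: ler_sum => v _.
rewrite in_setI; case: (v \in T) => //=; case: ifP => [/hw_ge1 //|_].
exact: hw_ge0.
Qed.

(** Every heavy vertex weighs at least 1, whereas [light_sum] allows at most 1/2 per vertex beyond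
    [beta]; hence [#|T| <= 2 * beta]. *)
Lemma small_heavy_conn T : conn e T -> T \subset H -> (#|T| <= s2)%N.
Proof.
move=> cT /setIidPl TH; rewrite -(ler_nat R).
have := card_heavy_le T; rewrite TH => h.
have := le_trans h (light_sum cT) => h1.
have : gam / 2 * #|T|%:R <= 2^-1 * #|T|%:R.
  by rewrite ler_wpM2r //; have := gam_le; lra.
have := beta_s2; lra.
Qed.

Lemma locally_sparse w : w \notin H ->
  exists2 P : {set V}, (#|P| <= 1)%N & {in nb e w :\: P &, forall u v, ~~ e u v}.
Proof.
rewrite inE -leqNgt => dw; apply: locally_sparse_of => //.
apply: sparse_small; first exact: conn_star.
by rewrite cardsU1 inE e_irr; move: dw D_l; clear; lia.
Qed.

Variable i : nat.
Hypothesis depth : (i * l.+1 + 2 <= s2)%N.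
Variables (t1 q sig A : R) (G0 : nat).
Local Notation b := (A + 2).
Local Notation K := (A + 1 + b * (2 * beta)).
Hypothesis t1_ge : D%:R <= t1 * (#|C|%:R - 1).
Hypothesis t1_contr : t1 * expR (N0%:R / (N0%:R - 1) * t1) <= q.
Hypothesis q_ge0 : 0 <= q.
Hypothesis N0D : D%:R <= 2 * N0%:R :> R.
Hypotheses (sig_ge1 : 1 <= sig) (sig_le2 : sig <= 2).
Hypothesis A_ge : 6 <= (1 - sig * q) * A.
Hypothesis A_ge2 : 2 <= A.
Hypothesis b_gam : b * gam <= 1.
Hypothesis G0_ge : gam / 2 * l.+2%:R + beta <= G0%:R.
Hypothesis contr_half : sig ^+ G0 * sig ^- l * K <= 2^-1.
Hypothesis contr_pow : (sig ^+ G0 * sig ^- l * K) ^+ i * #|V|%:R <= 1.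

Section Revealed.
Variable La : {set V}.
Hypothesis La_sub : La \subset M.

(** [X] is the set of vertices visited and pinned before [u]. Bounding its size together with the
    remaining depth keeps all sets met during the exploration within the range of [sparse_large]. *)
Definition adm j F u := exists X, [/\ F = ~: (La :|: X), u \notin X, conn e (u |: X) &
  (#|X| + j <= i * l.+1)%N].

(** A heavy vertex has no revealed neighbour, as [La] lies in [M], and sparsity gives it at most
    [j0 + 2] neighbours in the connected set of visited vertices; so it still has more than [D0]
    colours. *)
Lemma adm_feasible j F u : adm j F u -> u \in F ->
  forall (L : V -> {set C}) z, lists_ok e (F :\ u) L -> lcol e (F :\ u) L z != set0.
Proof.
move=> [X [FE uX cX sX]] uF L z ok.
have cardX : #|u |: X| = #|X|.+1 by rewrite cardsU1 uX.
have DC : (D < #|C|)%N by move: colors N0_gt1; clear; lia.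
apply: (feasible e_sym e_irr (D := D) (D0 := D0) z DC ok).
  move=> v vF vH.
  have vX : v \notin u |: X.
    move: vF; rewrite FE !inE => /andP[vu]; rewrite negb_or => /andP[_ vX].
    by rewrite negb_or vu vX.
  have sub : nb e v :\: (F :\ u) \subset nb e v :&: (u |: X).
    apply/subsetP => w; rewrite FE !inE negb_and !negbK => /andP[+ vw].
    rewrite vw /=; case/orP => [->//|/orP[wL|->]]; last by rewrite orbT.
    move: (subsetP La_sub _ wL); rewrite inE => /andP[_ /eqP/setP/(_ v)].
    by rewrite in_setI inE e_sym vw vH inE.
  have hX : (#|nb e v :&: (u |: X)| <= j0 + 2)%N.
    apply: card_nb_conn => //.
    by rewrite cardX => T cT sT; apply: sparse_large => //; move: sT sX depth; clear; lia.
  have := subset_leq_card sub; move: hX colors D0_small D_ge; clear; lia.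
apply: sparse_order_ex => // T cT TS.
apply: sparse_large => //; apply: small_heavy_conn => //.
by apply: subset_trans TS (subsetIr _ _).
Qed.

Lemma adm_next j F u w : adm j.+1 F u -> u \in F -> w \in nb e u :&: (F :\ u) -> adm j (F :\ u) w.
Proof.
move=> [X [FE uX cX sX]] uF; rewrite in_setI inE => /andP[uw wF].
exists (u |: X); split.
- by rewrite FE setDE -setCU setUA [La :|: _]setUC -setUA setUC.
- move: wF; rewrite FE !inE => /andP[wu]; rewrite negb_or => /andP[_ wX].
  by rewrite negb_or wu wX.
- apply: conn_add cX (setU11 _ _) _ uw.
  move: wF; rewrite FE !inE => /andP[wu]; rewrite negb_or => /andP[_ wX].
  by rewrite negb_or wu wX.
- by rewrite cardsU1 uX; move: sX; clear; lia.
Qed.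

(** A block acts on the bottom value as [B -> 1 + K + c * B] with [c <= 1 / 2]. After [i] blocks the
    crude value [#|V|] has shrunk to [c ^ i * #|V| <= 1], and the constants sum to at most
    [2 * (1 + K)]. *)
Lemma infl_le F u : u \in F ->
  infl e (mrate e D N0 q) #|V|%:R (i * l.+1) F u <= 2 * (1 + K) + 1.
Proof.
move=> uF; set m := mrate e D N0 q; set c := sig ^+ G0 * sig ^- l * K.
have ch : c <= 2^-1 := contr_half.
have cp : c ^+ i * #|V|%:R <= 1 := contr_pow.
have m0 F' w : 0 <= m F' w by apply: mrate_ge0.
have b0 : 0 <= b by have := A_ge2; lra.
have K0 : 0 <= K by rewrite addr_ge0 ?mulr_ge0 //; have := A_ge2; lra.
have sp : 0 < sig by apply: lt_le_trans sig_ge1.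
have c0 : 0 <= c by rewrite !mulr_ge0 ?invr_ge0 ?exprn_ge0 // ltW.
have block (B : R) F' w : 0 <= B -> w \in F' -> infl e m B l.+1 F' w <= 1 + K + c * B.
  move=> B0 wF.
  have step := @infl_block R V e e_sym e_irr m H m0 D l G0 N0%:R^-1 q sig A b gam beta.
  have -> : 1 + K + c * B = 1 + (1 + B * (sig ^+ G0 * sig ^- l)) * K by rewrite /c; ring.
  apply: step => //.
  - by move=> F'' v; apply: mrate_heavy.
  - by move=> F'' v; apply: mrate_le.
  - by move=> F'' v; apply: mrate_light.
  - by move=> v; rewrite inE.
  - by move=> v; rewrite inE -leqNgt.
  - by rewrite mulrC ler_pdivrMr // ltr0n; apply: ltnW.
  - move=> T cT sT; rewrite -(ler_nat R); apply: le_trans (card_heavy_le T) _.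
    apply: le_trans (light_sum cT) _; apply: le_trans G0_ge.
    by rewrite lerD2r ler_wpM2l ?divr_ge0 // ler_nat.
have iterP j F' w : w \in F' -> infl e m #|V|%:R (j * l.+1) F' w <= 2 * (1 + K) + c ^+ j * #|V|%:R.
  elim: j F' w => [|j IH] F' w wF.
    by rewrite mul0n expr0 mul1r /= lerDr mulr_ge0 // addr_ge0.
  rewrite mulSn; apply: le_trans (infl_comp m0 _ IH wF) _.
  have B0 : 0 <= 2 * (1 + K) + c ^+ j * #|V|%:R.
    apply: addr_ge0; apply: mulr_ge0 => //; first exact: addr_ge0.
    exact: exprn_ge0.
  apply: le_trans (block _ _ _ B0 wF) _.
  have : c * (2 * (1 + K)) <= 2^-1 * (2 * (1 + K)) by rewrite ler_wpM2r // mulr_ge0 // addr_ge0.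
  rewrite exprS mulrDr; lra.
apply: le_trans (iterP i F u uF) _.
by rewrite lerD2l.
Qed.

Lemma pcol_lcol z : pcol C e = lcol e setT (fun=> setT) z.
Proof.
apply/setP => x; apply/pcolP/lcolP => [h|[_ _ h] u v uv]; last by apply: h; rewrite ?inE.
by split=> [v|v|u v _ _]; rewrite ?inE //; apply: h.
Qed.

Lemma good_influence x f lam u a a' : x \in pcol C e -> lipschitz lam f -> u \in M :\: La ->
  site (fiber (pcol C e) La x) u a != set0 -> site (fiber (pcol C e) La x) u a' != set0 ->
  `|avg (site (fiber (pcol C e) La x) u a) f - avg (site (fiber (pcol C e) La x) u a') f|
    <= lam * (2 * (1 + K) + 1).
Proof.
move=> xp lip; rewrite inE => /andP[uL uM].
rewrite (pcol_lcol x) in xp *; rewrite -[La in fiber _ La]setCK (fiber_lcol e_sym (subsetT _) xp).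
set L := res_lists _ _ _ _ _.
have ok : lists_ok e (~: La) L.
  by apply: lists_ok_res => // v _; rewrite cardsT leq_addr.
have uF : u \in ~: La by rewrite inE.
have inL c : site (lcol e (~: La) L x) u c != set0 -> c \in L u.
  by apply: contraNT => cL; rewrite site_lcol_out.
move=> /inL aL /inL a'L.
have l0 : 0 <= lam by apply: le_trans (lip x u (x u)).
apply: le_trans (ler_wpM2l l0 (infl_le uF)).
have m0 F v : 0 <= mrate e D N0 q F v by apply: mrate_ge0.
apply: (@influence_le R V C e e_sym e_irr _ m0 adm) => //.
- exact: adm_feasible.
- move=> j F v w ad vF wN; split; first exact: adm_next ad vF wN.
  move=> L' z c ok'; apply: (marginal_le e_sym e_irr N0_gt1 colors t1_ge t1_contr) => //.
    exact: locally_sparse.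
  by move: wN; rewrite inE => /andP[].
exists set0; split; rewrite ?setU0 ?inE //; first exact: conn1.
by rewrite cards0.
Qed.

End Revealed.

Variables (J Nb Nh : nat).
Hypothesis J_gt0 : (0 < J)%N.
Hypothesis Nh_ge : gam / 2 * (3 * J)%:R + beta <= Nh%:R.
Hypothesis Nb_ge : J%:R + D%:R * (gam / 2 * (3 * J)%:R + beta) <= Nb%:R.
Hypothesis Nb_s2 : (Nb <= s2)%N.
Local Notation pcol := (pcol C e).

(* The vertices that can dominate a component of the unrevealed set. *)
Definition anchors La := H :|: (M :\: La).

(** By [skeleton], a component with [J] anchors contains a connected set of at most [3 * J] vertices
    with [J] anchors. Excluding such sets thus bounds components, and there are few enough of them
    for a union bound. *)
Definition nice La :=
  ~~ [exists T : {set V}, [&& `[< conn e T >], (#|T| <= 3 * J)%N & (J <= #|T :&: anchors La|)%N]].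

Lemma anchors_dominate La B v : La \subset M -> B \subset ~: La -> separated e B (~: La :\: B) ->
  v \in B -> v \notin anchors La -> exists h, [/\ h \in B :&: H, h \in anchors La & e v h].
Proof.
move=> LM BL sep vB; rewrite in_setU in_setD negb_or negb_and negbK => /andP[vH vM].
have vL : v \notin La by have := subsetP BL _ vB; rewrite inE.
rewrite (negPf vL) /= in_set vH /= in vM.
have /set0Pn[h] := vM; rewrite in_setI inE => /andP[vh hH].
have hL : h \notin La.
  by apply/negP => /(subsetP LM); rewrite in_set hH.
have hB : h \in B.
  apply: contraT => hB; have := sep v h vB; rewrite !inE hB hL => /(_ isT).
  by rewrite vh.
by exists h; rewrite in_setI hB hH /anchors in_setU hH.
Qed.

(** [skeleton] collects all anchors of [B], fewer than [J], in one connected set of less than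
    [3 * J] vertices. [light_sum] for this set bounds the number and the degrees of the heavy
    vertices of [B], and every other vertex of [B] is an anchor or a neighbour of one of them. *)
Lemma component_small La B : La \subset M -> nice La -> conn e B -> B \subset ~: La ->
  separated e B (~: La :\: B) -> (#|B| <= Nb)%N /\ (#|B :&: H| <= Nh)%N.
Proof.
move=> LM nc cB BL sep; set Z := anchors La.
have dom v : v \in B -> v \notin Z -> exists h, [/\ h \in B, h \in Z & e v h].
  move=> vB vZ; have [h [hBH hZ vh]] := anchors_dominate LM BL sep vB vZ.
  by exists h; move: hBH => /setIP[].
have ZB0 : (0 < #|Z :&: B|)%N.
  have /set0Pn[v vB] := conn_n0 cB; rewrite card_gt0; apply/set0Pn.
  have [vZ|vZ] := boolP (v \in Z); first by exists v; rewrite inE vZ.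
  by have [h [hB hZ _]] := dom v vB vZ; exists h; rewrite inE hZ.
have ZJ : (#|Z :&: B| < J)%N.
  rewrite ltnNge; apply/negP => JZ.
  have [T [cT TB sT TZ]] := skeleton e_sym e_irr cB dom J_gt0 JZ.
  move/negP: nc; apply; apply/existsP; exists T.
  by rewrite sT TZ leqnn !andbT; apply/asboolP.
have [T [cT TB sT TZ]] := skeleton e_sym e_irr cB dom ZB0 (leqnn _).
have ZBT : Z :&: B \subset T.
  have sub : T :&: Z \subset Z :&: B.
    by apply/subsetP => v; rewrite !in_setI => /andP[/(subsetP TB) -> ->].
  have /eqP <- : T :&: Z == Z :&: B by rewrite eqEcard sub TZ leqnn.
  exact: subsetIl.
have HT : \sum_(v in B) hw R e H D v <= gam / 2 * (3 * J)%:R + beta.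
  apply: (@le_trans _ _ (\sum_(v in T) hw R e H D v)).
    rewrite big_mkcond [leRHS]big_mkcond /=; apply: ler_sum => v _.
    case vB: (v \in B); last by case: ifP => // _; apply: hw_ge0.
    have [vH|vH] := boolP (v \in H).
      by rewrite (subsetP ZBT) // in_setI vB /Z /anchors in_setU vH.
    by rewrite /hw (negPf vH); case: ifP.
  apply: le_trans (light_sum cT) _; rewrite lerD2r ler_wpM2l ?divr_ge0 // ler_nat.
  by apply: leq_trans sT _; rewrite leq_mul2l ltnW.
have D0p : 0 < D%:R :> R by rewrite ltr0n (leq_trans _ D_ge).
split; rewrite -(ler_nat R); last exact: le_trans (card_heavy_le B) (le_trans HT Nh_ge).
apply: le_trans Nb_ge.
have cover : (#|B| <= #|Z :&: B| + \sum_(h in B :&: H) #|nb e h|)%N.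
  have sub : B \subset (Z :&: B) :|: \bigcup_(h in B :&: H) nb e h.
    apply/subsetP => v vB; rewrite in_setU in_setI vB andbT.
    have [//|vZ] := boolP (v \in Z).
    have [h [hBH hZ vh]] := anchors_dominate LM BL sep vB vZ.
    by apply/bigcupP; exists h => //; rewrite inE e_sym.
  apply: leq_trans (subset_leq_card sub) _; apply: leq_trans (leq_card_setU _ _) _.
  rewrite leq_add2l; elim/big_rec2: _ => [|h m S _ le]; first by rewrite cards0.
  by apply: leq_trans (leq_card_setU _ _) _; rewrite leq_add2l.
apply: (@le_trans _ _ (#|Z :&: B| + \sum_(h in B :&: H) #|nb e h|)%:R); first by rewrite ler_nat.
rewrite natrD; apply: lerD; first by rewrite ler_nat ltnW.
apply: le_trans (ler_wpM2l (ltW D0p) HT).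
rewrite natr_sum mulr_sumr big_mkcond [leRHS]big_mkcond /=; apply: ler_sum => v _.
rewrite in_setI; case: (v \in B) => //=; case: ifP => [vH|_].
  by rewrite /hw vH mulrC divfK ?gt_eqF.
by rewrite mulr_ge0 ?(ltW D0p) ?hw_ge0.
Qed.

Local Notation r := (1 - (D0%:R *+ 2) / N0%:R : R).

Lemma pass_prob_ge vs B : uniq vs -> vs =i B -> (#|B| <= Nb)%N -> (#|B :&: H| <= Nh)%N ->
  r ^+ Nb * #|C|%:R ^- Nh <= pass_prob R C e D N0 D0 vs.
Proof.
move=> uvs vsB sB sH.
have N0p : 0 < N0%:R :> R by rewrite ltr0n ltnW.
have r0 : 0 <= r.
  rewrite subr_ge0 ler_pdivrMr // mul1r -mulrnA ler_nat.
  by move: D0_small; clear; lia.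
have r1 : r <= 1 by rewrite gerBl divr_ge0 // mulrn_wge0.
have Cp : (0 < #|C|)%N by move: colors N0_gt1; clear; lia.
have k1 : #|C|%:R^-1 <= 1 :> R by rewrite invf_le1 ?ltr0n ?ler1n.
have k0 : 0 <= #|C|%:R^-1 :> R by rewrite invr_ge0.
rewrite -exprVn.
apply: (@le_trans _ _ (r ^+ #|B| * #|C|%:R^-1 ^+ #|B :&: H|)).
  apply: ler_pM; rewrite ?exprn_ge0 //; apply: ler_wiXn2l => //.
have -> : pass_prob R C e D N0 D0 vs = \prod_(v in B) site_prob R C e D N0 D0 v.
  rewrite /pass_prob -[RHS]big_enum /=; apply: perm_big; apply: uniq_perm; rewrite ?enum_uniq //.
  by move=> v; rewrite mem_enum vsB.
have -> : r ^+ #|B| * #|C|%:R^-1 ^+ #|B :&: H| =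
    \prod_(v in B) (r * (if v \in H then #|C|%:R^-1 else 1)).
  rewrite big_split /= prodr_const; congr (_ * _).
  rewrite -big_mkcondr /= -prodr_const; apply: eq_bigl => v.
  by rewrite in_setI.
apply: ler_prod => v _; apply/andP; split.
  by rewrite mulr_ge0 //; case: ifP.
rewrite /site_prob; case: ifP => _; last by rewrite mulr1.
by rewrite ger_pMl // ?invr_gt0 ?ltr0n.
Qed.

Lemma nice_poincare La f : La \subset M -> nice La ->
  Dir pcol (~: La) f <=
  4 * Nb%:R / (r ^+ Nb * #|C|%:R ^- Nh) ^+ 2 * \sum_v Dir pcol [set v] f.
Proof.
move=> LM nc; set p0 := r ^+ Nb * _.
have N0p : 0 < N0%:R :> R by rewrite ltr0n ltnW.
have rp : 0 < r.
  rewrite subr_gt0 ltr_pdivrMr // mul1r -mulrnA ltr_nat.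
  by move: D0_small; clear; lia.
have Cp : (0 < #|C|)%N by move: colors N0_gt1; clear; lia.
have p0p : 0 < p0 by rewrite mulr_gt0 ?invr_gt0 ?exprn_gt0 // ltr0n.
have K0 : 0 <= 4 * Nb%:R / p0 ^+ 2 by apply: divr_ge0; [apply: mulr_ge0|apply: sqr_ge0].
apply: (@le_trans _ _ (4 * Nb%:R / p0 ^+ 2 * \sum_(v in ~: La) Dir pcol [set v] f)); last first.
  rewrite ler_wpM2l // [leRHS](bigID (mem (~: La))) /= lerDl sumr_ge0 // => v _.
  exact: Dir_ge0.
apply: Dir_comps => // B cB BL sep.
have [sB sH] := component_small LM nc cB BL sep.
have [vs [uvs vsB dvs]] : exists vs, [/\ uniq vs, vs =i B & degenerate e D0 vs].
  apply: sparse_order_ex => // T cT TB; apply: sparse_large => //.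
  by apply: leq_trans (subset_leq_card TB) _; apply: leq_trans sB Nb_s2.
have closed h : h \in H -> h \in B -> nb e h \subset B.
  move=> hH hB; apply/subsetP => v; rewrite inE => hv; apply: contraT => vB.
  have vL : v \notin La.
    apply/negP => /(subsetP LM); rewrite in_set => /andP[_ /eqP/setP/(_ h)].
    by rewrite in_setI inE e_sym hv hH inE.
  by have := sep h v hB; rewrite !inE vB vL hv => /(_ isT).
have := block_poincare e_sym e_irr (ltnW N0_gt1) colors D0_small closed f uvs dvs vsB.
have pge := pass_prob_ge uvs vsB sB sH; rewrite -/p0 in pge.
set S := \sum_(v in B) _ => h.
have S0 : 0 <= S by apply: sumr_ge0 => v _; apply: Dir_ge0.
rewrite mulrAC ler_pdivlMr ?exprn_gt0 // mulrC.
apply: (@le_trans _ _ (pass_prob R C e D N0 D0 vs ^+ 2 * Dir pcol B f)).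
  by rewrite ler_wpM2r ?Dir_ge0 // lerXn2r ?nnegrE ?(ltW p0p) // (le_trans (ltW p0p)).
apply: le_trans h _; rewrite ler_wpM2r // ler_wpM2l // ler_nat //.
Qed.

Hypothesis V_gt0 : (0 < #|V|)%N.

(** At most [Nh] of the anchors in a set [T] are heavy, so a failure exhibits [J - Nh] vertices of
    [M] in some [T] that all draws have missed. The factor [2 ^ (3 * J)] counts the choices of these
    vertices inside [T]. *)
Lemma not_nice_prob t : (Nh <= J)%N -> (J <= #|V|)%N ->
  edraw M t (fun L => (~~ nice L)%:R) set0 <=
  (\sum_(T : {set V} | `[< conn e T >] && (#|T| <= 3 * J)%N) 1) *
  (2 ^ (3 * J))%:R * (1 - (J - Nh)%:R / #|V|%:R) ^+ t :> R.
Proof.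
move=> NhJ JV.
pose Us (T : {set V}) := [set U : {set V} | (U \subset T) && ((U \subset M) && (#|U| == J - Nh)%N)].
apply: (@le_trans _ _ (edraw M t (fun L => \sum_(T : {set V} | `[< conn e T >] && (#|T| <= 3 * J)%N)
    \sum_(U in Us T) (U :&: L == set0)%:R) set0)).
  apply: edraw_le; first exact: sub0set.
  move=> L LM; rewrite /nice negbK.
  have s1 (T : {set V}) : 0 <= \sum_(U in Us T) (U :&: L == set0)%:R :> R by apply: sumr_ge0.
  case: existsP => [[T /and3P[cT sT JT]]|_]; last by apply: sumr_ge0.
  have cT' : conn e T by apply/asboolP.
  have hT : (#|T :&: H| <= Nh)%N.
    rewrite -(ler_nat R); apply: le_trans (card_heavy_le T) _.
    apply: le_trans (light_sum cT') _; apply: le_trans Nh_ge.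
    by rewrite lerD2r ler_wpM2l ?divr_ge0 // ler_nat.
  have : (J - Nh <= #|T :&: (M :\: L)|)%N.
    rewrite leq_subLR; apply: leq_trans JT _; rewrite /anchors setIUr.
    by apply: leq_trans (leq_card_setU _ _) _; rewrite leq_add2r.
  move=> /subset_of_card[U UT cU].
  have UE v : v \in U -> [/\ v \in T, v \in M & v \notin L].
    by move=> /(subsetP UT); rewrite in_setI in_setD => /and3P[-> -> ->].
  rewrite (bigD1 T) /=; last by rewrite cT sT.
  rewrite (bigD1 U) /=; last first.
    rewrite in_set cU eqxx andbT; apply/andP; split; apply/subsetP => v /UE[] //.
  have -> : U :&: L == set0.
    by apply/eqP/setP => v; rewrite in_setI in_set0; apply/negP => /andP[/UE[_ _ /negPf ->]].
  by rewrite -addrA lerDl addr_ge0 // sumr_ge0.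
rewrite edraw_sum -mulrA mulr_suml; apply: ler_sum => T /andP[_ sT]; rewrite mul1r.
rewrite edraw_sum; apply: (@le_trans _ _ (\sum_(U in Us T) (1 - (J - Nh)%:R / #|V|%:R) ^+ t)).
  apply: ler_sum => U; rewrite in_set => /and3P[_ UM /eqP cU].
  by have := draw_avoid R V_gt0 t set0 UM; rewrite cU.
rewrite sumr_const -[_ *+ _]mulr_natl.
rewrite ler_wpM2r //.
  rewrite exprn_ge0 // subr_ge0 ler_pdivrMr ?ltr0n // mul1r ler_nat.
  exact: leq_trans (leq_subr _ _) JV.
rewrite ler_nat; apply: leq_trans (_ : #|powerset T| <= _)%N.
  by apply/subset_leq_card/subsetP => W; rewrite !in_set => /andP[].
by rewrite card_powerset leq_exp2l.
Qed.

Theorem good_poincare t f (I := 2 * (1 + K) + 1) :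
  (Nh <= J)%N -> (J <= #|V|)%N -> I <= #|V|%:R ->
  (\sum_(T : {set V} | `[< conn e T >] && (#|T| <= 3 * J)%N) 1) *
    (2 ^ (3 * J))%:R * (1 - (J - Nh)%:R / #|V|%:R) ^+ t <= 2^-1 * (1 - I / #|V|%:R) ^+ t ->
  (1 - I / #|V|%:R) ^+ t * Dir pcol setT f <=
  8 * Nb%:R / (r ^+ Nb * #|C|%:R ^- Nh) ^+ 2 * \sum_v Dir pcol [set v] f.
Proof.
move=> NhJ JV IV bad.
have K0 : 0 <= K.
  have b0 : 0 <= b by have := A_ge2; lra.
  by rewrite addr_ge0 ?mulr_ge0 //; have := A_ge2; lra.
have I1 : 1 <= I by rewrite /I lerDr mulr_ge0 // addr_ge0.
set c := _ / _ ^+ 2; set S := \sum_v _.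
have N0p : 0 < N0%:R :> R by rewrite ltr0n ltnW.
have S0 : 0 <= S by apply: sumr_ge0 => v _; apply: Dir_ge0.
have -> : c * S = 2 * (4 * Nb%:R / (r ^+ Nb * #|C|%:R ^- Nh) ^+ 2 * S).
  by rewrite /c; set p0 := (_ ^+ 2)^-1; ring.
apply: (@reveal_final R V C pcol M I V_gt0 I1 IV _ t f nice).
- move=> La LM x g lam u a a' xp lip uM.
  exact: good_influence.
- by move=> La LM nc; apply: nice_poincare.
- exact: le_trans (not_nice_prob t NhJ JV) bad.
- by apply: mulr_ge0 => //; apply: divr_ge0; [apply: mulr_ge0|apply: sqr_ge0].
Qed.

End GoodGraph.

(** * Choice of parameters *)

Section Eventually.
Variable R : realType.

Definition eventually (P : nat -> Prop) := exists N : nat, forall n : nat, (N <= n)%N -> P n.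

Lemma eventually_and (P Q : nat -> Prop) :
  eventually P -> eventually Q -> eventually (fun n => P n /\ Q n).
Proof.
move=> [N hN] [M hM]; exists (maxn N M) => n; rewrite geq_max => /andP[nN nM].
by split; [apply: hN|apply: hM].
Qed.

Lemma ln_large (B : R) : eventually (fun n => B <= ln n%:R).
Proof.
exists (Num.truncn (expR B)).+1 => n hn.
have : expR B <= n%:R.
  apply: le_trans (_ : (Num.truncn (expR B)).+1%:R <= _); last by rewrite ler_nat.
  by apply: ltW; have /andP[] := truncn_itv (expR_ge0 B).
move=> h; rewrite -[B]expRK ler_ln ?posrE ?expR_gt0 //.
exact: lt_le_trans (expR_gt0 B) h.
Qed.

Lemma pos_large : eventually (fun n => (0 < n)%N).
Proof. by exists 1%N. Qed.

Lemma poly_le_exp (C c : R) m : 0 < c -> eventually (fun n => C * ln n%:R ^+ m <= expR (c * ln n%:R)).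
Proof.
move=> c0; set a := c / m.+1%:R.
have a0 : 0 < a by rewrite divr_gt0.
have [N hN] := eventually_and (ln_large 0) (ln_large (C / a ^+ m.+1)).
exists N => n /hN[]; set Y : R := ln n%:R => Y0 hY.
have -> : expR (c * Y) = expR (a * Y) ^+ m.+1.
  by rewrite -expRM_natl mulrA [_ * a]mulrC divfK ?pnatr_eq0.
apply: (@le_trans _ _ ((a * Y) ^+ m.+1)).
  rewrite exprMn [Y ^+ m.+1]exprS mulrA ler_wpM2r ?exprn_ge0 //.
  by rewrite mulrC -ler_pdivrMr ?exprn_gt0.
have aY : 0 <= a * Y by rewrite mulr_ge0 // ltW.
rewrite lerXn2r ?nnegrE ?expR_ge0 //.
by apply: le_trans (expR_ge1Dx _); rewrite lerDr.
Qed.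

Definition up (x : R) : nat := (Num.truncn x).+1.

Lemma up_ge x : 0 <= x -> x <= (up x)%:R.
Proof. by move=> x0; apply: ltW; have /andP[] := truncn_itv x0. Qed.

Lemma up_le x : 0 <= x -> (up x)%:R <= x + 1.
Proof. by move=> x0; rewrite /up -natr1 lerD2r; have /andP[] := truncn_itv x0. Qed.

Lemma one_sub_ge_expR (x : R) : 0 <= x -> x <= 2^-1 -> expR (- (2 * x)) <= 1 - x.
Proof.
move=> x0 x2; have p : 0 < 1 - x by lra.
rewrite expRN -[leRHS]invrK lef_pV2 ?posrE ?expR_gt0 ?invr_gt0 //.
apply: le_trans (expR_ge1Dx _).
rewrite -(ler_pM2r p) mulVf ?gt_eqF //.
nra.
Qed.

Lemma expR_le_quad (x : R) : 0 <= x -> x <= 2^-1 -> expR x <= 1 + x + 2 * x ^+ 2.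
Proof.
move=> x0 x2; have p : 0 < 1 - x by lra.
have : expR x <= (1 - x)^-1.
  rewrite -[expR x]invrK -expRN lef_pV2 ?posrE ?expR_gt0 //.
  exact: expR_ge1Dx.
move=> /le_trans; apply; rewrite -(ler_pM2r p) mulVf ?gt_eqF //.
rewrite !expr2; nra.
Qed.

Lemma ln_pow4_le (M : R) : 0 <= M -> exists x0 : R, 1 <= x0 /\
  forall x, x0 <= x -> M * (ln x + 3) ^+ 4 <= x.
Proof.
move=> M0; pose y0 := 5 ^+ 5 * M.
have y00 : 0 <= y0 by rewrite mulr_ge0 // exprn_ge0.
exists (expR y0); split; first by rewrite -[leLHS]expR0 ler_expR.
move=> x hx; have xp : 0 < x by apply: lt_le_trans hx; apply: expR_gt0.
set y := ln x.
have yy : y0 <= y by rewrite /y -[y0]expRK ler_ln ?posrE ?expR_gt0.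
have y_ge0 : 0 <= y by apply: le_trans yy.
have -> : x = expR (y / 5) ^+ 5 by rewrite -expRM_natl mulrC divfK ?pnatr_eq0 // lnK.
apply: (@le_trans _ _ ((1 + y / 5) ^+ 5)); last first.
  by rewrite lerXn2r ?nnegrE ?expR_ge0 ?expR_ge1Dx // addr_ge0 // divr_ge0.
have -> : (1 + y / 5) ^+ 5 = (y + 5) / 5 ^+ 5 * (y + 5) ^+ 4.
  by field.
apply: ler_pM => //; first by rewrite exprn_ge0 // addr_ge0.
  rewrite ler_pdivlMr ?exprn_gt0 // mulrC -/y0; lra.
by rewrite lerXn2r ?nnegrE ?addr_ge0 // lerD2l ler_nat.
Qed.

End Eventually.

(** * Constants depending on alpha and eps *)

Section Constants.
Variables (R : realType) (alpha eps : R).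
Hypotheses (alpha_gt0 : 0 < alpha) (alphaE : alpha = expR (alpha^-1)) (eps_gt0 : 0 < eps).

Lemma alpha_ge32 : 3 / 2 <= alpha.
Proof.
rewrite leNgt; apply/negP => lt; have a0 := alpha_gt0.
have : 1 + alpha^-1 <= alpha by rewrite [leRHS]alphaE expR_ge1Dx.
have : 2 / 3 < alpha^-1.
  have -> : 2 / 3 = (3 / 2)^-1 :> R by rewrite invf_div.
  by rewrite ltf_pV2 ?posrE ?divr_gt0.
lra.
Qed.

(** [D / k] is close to [1 / (alpha + eps / 2)]; [t1] is slightly larger, to absorb [k - 1] in place
    of [k]. As [t * exp t] increases and equals 1 at [1 / alpha], this leaves [theta < 1]. *)
Local Notation t1 := ((alpha + eps / 4)^-1).
Local Notation theta := (t1 * expR t1).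

Lemma t1_gt0 : 0 < t1.
Proof. by rewrite invr_gt0; have := alpha_gt0; have := eps_gt0; lra. Qed.

Lemma theta_lt1 : theta < 1.
Proof.
have a0 := alpha_gt0; have e0 := eps_gt0; have tp := t1_gt0.
have t1a : t1 < alpha^-1 by rewrite ltf_pV2 ?posrE //; lra.
have aE : alpha^-1 * expR alpha^-1 = 1 by rewrite -alphaE mulVf // gt_eqF.
by rewrite -[ltRHS]aE; apply: ltr_pM; rewrite ?ltr_expR ?expR_ge0 ?(ltW tp).
Qed.

Local Notation q := ((1 + theta) / 2).
Local Notation sig := (1 + (1 - q) / 2).
Local Notation A := (12 / (1 - q)).
(** [eta] is half the relative gap between [k / (alpha + eps / 2)] and [k / (alpha + eps)]; the
    other half pays for rounding in [d <= (1 - eta) * D]. With [lam = eta / 8] the first-order gain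
    [eta * lam] exceeds the second-order loss [4 * lam ^ 2] by [c2]. *)
Local Notation eta := (eps / 2 / (alpha + eps) / 2).
Local Notation lam := (eta / 8).
Local Notation c2 := (eta ^+ 2 / 16).

Lemma eta_bounds : 0 < eta /\ eta <= 4^-1.
Proof.
have a0 := alpha_gt0; have e0 := eps_gt0.
have h0 : 0 < alpha + eps by lra.
split; first by rewrite !divr_gt0.
rewrite -[leRHS](@divfK _ 2) ?pnatr_eq0 //.
have h1 : eps / 2 / (alpha + eps) <= 2^-1 by rewrite ler_pdivrMr //; lra.
lra.
Qed.

Lemma constants_ex : exists Q : R,
  [/\ 1 <= Q, 1 <= c2 * Q, 1 <= ln sig * Q & A + 2 <= Q] /\
  forall (k : nat) (d : R), let D := Num.truncn (k%:R / (alpha + eps / 2)) in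
    (alpha + eps) * d <= k%:R -> Q <= D%:R ->
    [/\ (D <= k)%N, D%:R <= 2 * (k - D)%N%:R :> R, D%:R <= t1 * (k%:R - 1),
        t1 * expR ((k - D)%N%:R / ((k - D)%N%:R - 1) * t1) <= q & d <= D%:R] /\
    (d * ((expR lam ^+ 2 - 1) / 2) <= D%:R * (lam - c2) /\ ln k%:R <= 2 * ln (D%:R : R)).
Proof.
have a0 := alpha_gt0; have e0 := eps_gt0; have a32 := alpha_ge32.
have th1 := theta_lt1; have tp := t1_gt0.
have th0 : 0 < theta by rewrite mulr_gt0 ?expR_gt0.
have t1E : t1 * (alpha + eps / 4) = 1 by rewrite mulVf // gt_eqF //; lra.
have t1le : t1 <= 1 by rewrite invf_le1; lra.
have [et0 et4] := eta_bounds.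
have etE : eta * (alpha + eps) = eps / 4 by field; rewrite gt_eqF //; lra.
set et := eta in et0 et4 etE *; clearbody et.
set tt := t1 in th1 tp th0 t1E t1le *; clearbody tt.
have [th thE] : exists th, th = tt * expR tt by exists (tt * expR tt).
rewrite -thE in th1 th0 *.
set q := (1 + th) / 2; set sg := 1 + (1 - q) / 2; set A' := 12 / (1 - q).
have q1' : 1 - q = (1 - th) / 2 by rewrite /q; field.
have c2p : 0 < et ^+ 2 / 16 by rewrite divr_gt0 ?exprn_gt0.
have q1 : q < 1 by rewrite /q; lra.
have lsp : 0 < ln sg by apply: ln_gt0; rewrite /sg; lra.
have Ap : 0 < A' by rewrite divr_gt0 //; lra.
pose D1 := alpha + eps / 2.
have D1p : 0 < D1 by rewrite /D1; lra.
pose N1 := 8 / (1 - th) + 2.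
have N1p : 0 < N1 by rewrite addr_gt0 // divr_gt0 //; lra.
(* One summand per requirement on [D]. The first three reciprocals and sums are the bounds in the
   statement; [4 / eps] covers [k - 1] in the bound by [t1], [N1] the factor [N0 / (N0 - 1)],
   [et^-1] the rounding in [d <= (1 - et) * D], and [2 * D1] gives [k <= D ^ 2]. *)
pose Q := 1 + (et ^+ 2 / 16)^-1 + (ln sg)^-1 + (A' + 2) + 4 / eps + N1 + et^-1 + 2 * D1.
have i1 : 0 < (et ^+ 2 / 16)^-1 by rewrite invr_gt0.
have i2 : 0 < (ln sg)^-1 by rewrite invr_gt0.
have i3 : 0 < 4 / eps by rewrite divr_gt0.
have i4 : 0 < et^-1 by rewrite invr_gt0.
have Q1 : (et ^+ 2 / 16)^-1 <= Q by rewrite /Q; lra.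
have Q2 : (ln sg)^-1 <= Q by rewrite /Q; lra.
have Q3 : 4 / eps <= Q by rewrite /Q; lra.
have Q4 : N1 <= Q by rewrite /Q; lra.
have Q5 : et^-1 <= Q by rewrite /Q; lra.
have Q6 : 2 * D1 <= Q by rewrite /Q; lra.
have Q7 : A' + 2 <= Q by rewrite /Q; lra.
have Q8 : 1 <= Q by rewrite /Q; lra.
clearbody Q; exists Q; split.
  split=> //; first by rewrite mulrC -ler_pdivrMr // mul1r.
  by rewrite mulrC -ler_pdivrMr // mul1r.
clear Q1 Q2 Q7 i1 i2 i3 i4 lsp Ap c2p => k d D hd QD.
have k0 : 0 <= k%:R / (alpha + eps / 2) :> R by rewrite divr_ge0 //; lra.
have /andP[Dlo Dhi] := truncn_itv k0; rewrite -/D in Dlo Dhi.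
have kD : D%:R * D1 <= k%:R by rewrite -ler_pdivlMr.
have kD1 : k%:R < (D%:R + 1) * D1 by rewrite -ltr_pdivrMr // natr1.
have D1ge : 3 / 2 <= D1 by rewrite /D1; lra.
have Dge1 : 1 <= D%:R :> R by apply: le_trans QD.
have Dk : (D <= k)%N by rewrite -(ler_nat R); nra.
have NE : (k - D)%:R = k%:R - D%:R :> R by rewrite natrB.
have D2N : D%:R <= 2 * (k - D)%:R :> R by rewrite NE; nra.
have De : 1 <= D%:R * (eps / 4).
  by rewrite -ler_pdivrMr ?divr_gt0 // mul1r invf_div; apply: le_trans QD.
have Det : 1 <= D%:R * et by rewrite -ler_pdivrMr // mul1r; apply: le_trans QD.
have dD : d <= (1 - et) * D%:R.
  have ae : 0 < alpha + eps by lra.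
  rewrite -(ler_pM2l ae); apply: le_trans hd _; apply: le_trans (ltW kD1) _.
  have -> : (alpha + eps) * ((1 - et) * D%:R) = (alpha + eps - et * (alpha + eps)) * D%:R by ring.
  have hD : (alpha + eps) * 1 <= (alpha + eps) * (D%:R * et) by rewrite ler_wpM2l // ltW.
  have hE : (alpha + eps) * (D%:R * et) = eps / 4 * D%:R.
    by rewrite -etE; ring.
  rewrite etE /D1; rewrite hE in hD; lra.
split; last split.
- split=> //.
  + have h1 : D%:R * (alpha + eps / 4) <= k%:R - 1.
      have -> : D%:R * (alpha + eps / 4) = D%:R * D1 - D%:R * (eps / 4) by rewrite /D1; field.
      by move: kD De; clear; lra.
    have := ler_wpM2l (ltW tp) h1; rewrite mulrCA t1E mulr1.
    by [].
  + set N : R := (k - D)%:R in D2N NE *.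
    have NQ : N1 <= 2 * N by apply: le_trans Q4 (le_trans QD D2N).
    have NE' : 8 / (1 - th) + 2 <= 2 * N by [].
    have i5 : 0 < 8 / (1 - th) by rewrite divr_gt0 //; lra.
    have Np : 0 < N - 1 by lra.
    have xb : (N - 1)^-1 <= (1 - th) / 4.
      have th1' : 0 < 1 - th by lra.
      rewrite -[leRHS]invf_div lef_pV2 ?posrE ?divr_gt0 //.
      by lra.
    set x := tt / (N - 1).
    have x0 : 0 <= x by rewrite divr_ge0 ?ltW.
    have xle : x <= (1 - th) / 4.
      by apply: le_trans xb; rewrite ger_pMl ?invr_gt0.
    have -> : N / (N - 1) * tt = tt + x by rewrite /x; field; rewrite gt_eqF.
    rewrite expRD mulrA -thE.
    have ex : expR x <= 1 + 2 * x.
      apply: le_trans (expR_le_quad x0 _) _; first by lra.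
      rewrite expr2; nra.
    apply: (@le_trans _ _ (th * (1 + 2 * x))); first by rewrite ler_pM2l.
    have : th * (2 * x) <= 2 * x by apply: ler_piMl; [apply: mulr_ge0|apply: ltW].
    rewrite mulrDr /q; lra.
  + by apply: le_trans dD _; rewrite ger_pMl //; lra.
- have l0 : 0 <= (et / 8) by rewrite divr_ge0 ?ltW.
  have qb : (expR (et / 8) ^+ 2 - 1) / 2 <= (et / 8) + 4 * (et / 8) ^+ 2.
    rewrite -expRM_natl.
    have := @expR_le_quad R (2%:R * (et / 8)); rewrite exprMn => h.
    have := h _ _; lra.
  have qb0 : 0 <= (expR (et / 8) ^+ 2 - 1) / 2.
    by rewrite divr_ge0 // subr_ge0 exprn_ege1 // -[leLHS]expR0 ler_expR.
  apply: (@le_trans _ _ ((1 - et) * D%:R * ((expR (et / 8) ^+ 2 - 1) / 2))).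
    by rewrite ler_wpM2r.
  rewrite -mulrA mulrCA ler_wpM2l //.
  apply: (@le_trans _ _ ((1 - et) * ((et / 8) + 4 * (et / 8) ^+ 2))).
    by rewrite ler_wpM2l //; lra.
  have : 0 <= et * (et / 8) ^+ 2 by rewrite mulr_ge0 ?sqr_ge0 // ltW.
  rewrite !expr2; nra.
- have Dp : 0 < D%:R :> R by lra.
  have kp : 0 < k%:R :> R by rewrite ltr0n (leq_trans _ Dk) // -(ltr0n R).
  have -> : 2 * ln D%:R = ln (D%:R ^+ 2) :> R by rewrite lnXn // mulr_natl.
  rewrite ler_ln ?posrE ?exprn_gt0 //.
  apply: le_trans (ltW kD1) _; rewrite expr2.
  apply: (@le_trans _ _ (2 * D1 * D%:R)).
    by rewrite mulrC [2 * D1]mulrC -mulrA ler_wpM2l ?(ltW D1p) //; lra.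
  by rewrite ler_wpM2r ?(ltW Dp) // (le_trans Q6).
Qed.

Lemma constants_basic : [/\ 0 < c2, 0 <= lam, c2 <= lam & expR lam ^+ 2 <= 2] /\
  [/\ 1 <= sig, sig <= 2, 2 <= A, 6 <= (1 - sig * q) * A & 0 <= q].
Proof.
have th1 := theta_lt1; have tp := t1_gt0.
have th0 : 0 < theta by rewrite mulr_gt0 ?expR_gt0.
have [et0 et4] := eta_bounds.
split; split.
- by rewrite divr_gt0 ?exprn_gt0.
- by rewrite divr_ge0 ?ltW.
- rewrite expr2; nra.
- rewrite -expRM_natl; have := @expR_le_quad R (2%:R * lam); rewrite expr2 => h.
  have := h _ _; nra.
- lra.
- lra.
- by rewrite ler_pdivlMr; lra.
- rewrite mulrA ler_pdivlMr; last lra.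
  by have := sqr_ge0 (1 - theta); rewrite expr2; set x := theta; lra.
- lra.
Qed.

End Constants.

(** * Lengths, sizes and rates as functions of n *)

Section Scales.
Variables (R : realType) (k D : nat) (d c2 sig A Q : R).
Local Notation N0 := (k - D)%N.
Local Notation g := (ln (D%:R : R) + 3).
Hypotheses (d_gt1 : 1 < d) (dD : d <= D%:R) (D2N : D%:R <= 2 * N0%:R :> R).
Hypotheses (c2_gt0 : 0 < c2) (A_ge2 : 2 <= A).
Hypotheses (Q_ge1 : 1 <= Q) (c2Q : 1 <= c2 * Q) (hQ : 1 <= ln sig * Q) (AQ : A + 2 <= Q).
Hypothesis master : 100 * 100 * (Q ^+ 2 * g ^+ 4) <= D%:R.

Let h : R := ln sig.
Let c : R := c2 * D%:R.
Let w : R := Q / D%:R.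
(* A connected set [T] may carry heavy weight [gam / 2 * #|T| + beta_]: these
   are the values for which the union bound over connected sets converges, as
   [c2 * D * gam / 2 = g >= ln (4 * expR 1 * D)] and [c2 * D * beta_ = 3 * Y]. *)
Definition gam : R := 2 * g / (c2 * D%:R).
(** A block of walk steps contracts by [n ^ (- ln sig / (32 * g))], so this many blocks reduce the
    trivial influence bound [n] to 1. *)
Definition depth_blocks : nat := up (32 * g / ln sig).
(** The coefficient of [ln n] in [s2_]: component sizes give [1 + 3 * (g + 1) / c2], the total walk
    length gives [4 / ln sig] plus a small term, and the rest of the 3 is slack. *)
Definition size_rate : R := 3 + 3 * (g + 1) / c2 + 4 / ln sig.
(** Connected sets of [s] vertices with excess above [j] have expected number about
    [(e * d) ^ s / n ^ (j + 1)], which vanishes for [s] near [size_rate * ln n] once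
    [size_rate * (1 + ln d) <= j]. *)
Definition excess_bound : nat := up (size_rate * g).
(** About [ln n / 2] prescribed vertices all stay unseen with probability [n ^ (- draw_rate / 2)].
    The [6 * g] beats the [(2 * e * d) ^ (3 * J)] choices with [J] near [ln n]; the 14 covers the
    factor [n ^ 2] and the surviving fraction of the variance. *)
Definition draw_rate : R := 6 * g + 14.

Lemma D_ge1 : 1 <= D%:R :> R. Proof. by apply: ltW; apply: lt_le_trans dD. Qed.

Lemma g_ge3 : 3 <= g.
Proof. by rewrite lerDr ln_ge0 ?D_ge1. Qed.

Lemma h_gt0 : 0 < h.
Proof.
have := Q_ge1; have := hQ; rewrite -/h => h1 Q1.
by rewrite -(@pmulr_lgt0 _ Q) ?(lt_le_trans _ h1) // (lt_le_trans _ Q1).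
Qed.

Lemma w_gt0 : 0 < w.
Proof. by rewrite divr_gt0 // ?(lt_le_trans _ Q_ge1) // (lt_le_trans _ D_ge1). Qed.

Lemma w_small : 100 * 100 * (w * g ^+ 4 * Q) <= 1.
Proof.
have Dp : 0 < D%:R :> R by apply: lt_le_trans D_ge1.
have -> : 100 * 100 * (w * g ^+ 4 * Q) = 100 * 100 * (Q ^+ 2 * g ^+ 4) / D%:R.
  by rewrite /w expr2; set x := g ^+ 4; ring.
by rewrite ler_pdivrMr // mul1r.
Qed.

Lemma wg3 : 100 * 300 * (w * g ^+ 3 * Q) <= 1 /\ 100 * 100 * (w * g ^+ 3 * Q) * g <= 1.
Proof.
have := w_small; have g3 := g_ge3; have w0 := w_gt0; have Q1 := Q_ge1.
set x := w * g ^+ 3 * Q.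
have -> : w * g ^+ 4 * Q = x * g by rewrite /x exprS; set y := g; ring.
have x0 : 0 <= x by rewrite /x; apply: mulr_ge0; [apply: mulr_ge0; [exact: ltW|apply: exprn_ge0; lra]|lra].
have : x * 3 <= x * g by rewrite ler_wpM2l.
by move=> h1 h2; split; lra.
Qed.

Lemma wg2 : 300 * 300 * (w * g ^+ 2 * Q) <= 1.
Proof.
have [+ _] := wg3; have g3 := g_ge3; have w0 := w_gt0; have Q1 := Q_ge1.
set x := w * g ^+ 2 * Q.
have -> : w * g ^+ 3 * Q = x * g by rewrite /x exprS; set y := g; ring.
have x0 : 0 <= x by rewrite /x; apply: mulr_ge0; [apply: mulr_ge0; [exact: ltW|apply: exprn_ge0; lra]|lra].
have : x * 3 <= x * g by rewrite ler_wpM2l.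
by move=> h1 h2; lra.
Qed.

Lemma wg1 : 300 * 900 * (w * g * Q) <= 1.
Proof.
have := wg2; have g3 := g_ge3; have w0 := w_gt0; have Q1 := Q_ge1.
set x := w * g * Q.
have -> : w * g ^+ 2 * Q = x * g by rewrite /x expr2; set y := g; ring.
have x0 : 0 <= x by rewrite /x; apply: mulr_ge0; [apply: mulr_ge0; [exact: ltW|lra]|lra].
have : x * 3 <= x * g by rewrite ler_wpM2l.
by move=> h1 h2; lra.
Qed.

Lemma wg : 300 * 900 * (w * g) <= 1.
Proof.
have g3 := g_ge3; have w0 := w_gt0; have := wg1; have Q1 := Q_ge1.
have : w * g <= w * g * Q by rewrite ler_peMr //; apply: mulr_ge0; [exact: ltW|lra].
by move=> h1 h2; lra.
Qed.

Lemma c_gt0 : 0 < c.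
Proof. by rewrite mulr_gt0 // (lt_le_trans _ D_ge1). Qed.

Lemma inv_c_le : c^-1 <= w.
Proof.
have Dp : 0 < D%:R :> R by apply: lt_le_trans D_ge1.
rewrite /c /w invfM ler_pM2r ?invr_gt0 // -[leRHS]mul1r -(mulVf (lt0r_neq0 c2_gt0)).
by rewrite -mulrA ler_peMr // invr_ge0 ltW.
Qed.

Lemma gam_bounds : 0 <= gam /\ gam <= 2 * (w * g).
Proof.
have g3 := g_ge3; have cp := c_gt0.
have g0 : 0 <= 2 * g by lra.
rewrite /gam -/c; split; first by rewrite divr_ge0 // ltW.
have -> : 2 * (w * g) = 2 * g * w by set y := g; ring.
by rewrite ler_wpM2l // inv_c_le.
Qed.

Lemma gam_le4 : gam <= 4^-1.
Proof. by have [_] := gam_bounds; have := wg; lra. Qed.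

Lemma A_gam : (A + 2) * gam <= 1.
Proof.
have [g0 gb] := gam_bounds; have W := wg1; have w0 := w_gt0; have g3 := g_ge3.
apply: (@le_trans _ _ (Q * (2 * (w * g)))).
  by apply: ler_pM => //; have := A_ge2; lra.
by have -> : Q * (2 * (w * g)) = 2 * (w * g * Q) by [set y := g; ring]; lra.
Qed.

Lemma size_rate_bounds : 3 <= size_rate /\ size_rate <= 7 * (Q * g).
Proof.
have g3 := g_ge3; have Q1 := Q_ge1; have hp := h_gt0.
have i1 : c2^-1 <= Q by rewrite -[leLHS]mul1r ler_pdivrMr // mulrC.
have i2 : h^-1 <= Q by rewrite -[leLHS]mul1r ler_pdivrMr // mulrC.
have b1 : 3 * (g + 1) / c2 <= 3 * (g + 1) * Q by rewrite ler_wpM2l //; lra.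
have b2 : 4 / h <= 4 * Q by rewrite ler_wpM2l.
have b0 : 0 <= 3 * (g + 1) / c2 by rewrite divr_ge0 ?(ltW c2_gt0) //; lra.
have b0' : 0 <= 4 / h by rewrite divr_ge0 // ltW.
have Qg : Q * 3 <= Q * g by rewrite ler_wpM2l //; lra.
rewrite /size_rate -/h; split; first lra.
have : 3 * (g + 1) * Q = 3 * (Q * g) + 3 * Q by set y := g; ring.
lra.
Qed.

Lemma excess_bounds : size_rate * g <= excess_bound%:R /\ excess_bound%:R <= 8 * (Q * g ^+ 2) - 1.
Proof.
have [s3 s7] := size_rate_bounds; have g3 := g_ge3; have Q1 := Q_ge1.
have s0 : 0 <= size_rate * g by rewrite mulr_ge0 //; lra.
split; first exact: up_ge.
apply: le_trans (up_le s0) _.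
have h1 : size_rate * g <= 7 * (Q * g) * g by rewrite ler_wpM2r //; lra.
have h2 : 9 <= g ^+ 2 by rewrite expr2; nra.
have h3 : g ^+ 2 <= Q * g ^+ 2 by rewrite ler_peMl //; lra.
have h4 : 7 * (Q * g) * g = 7 * (Q * g ^+ 2) by rewrite expr2; set y := g; ring.
lra.
Qed.

Lemma N0_bounds : (1 < N0)%N /\ (3 * (2 * (1 + excess_bound)) < N0)%N.
Proof.
have [_ e8] := excess_bounds; have m := master; have g3 := g_ge3; have Q1 := Q_ge1.
have D2 := D2N.
have h2 : 9 <= g ^+ 2 by rewrite expr2; nra.
have h4 : 9 <= Q * g ^+ 2 by nra.
have h3 : Q * g ^+ 2 <= Q ^+ 2 * g ^+ 4.
  have -> : Q ^+ 2 * g ^+ 4 = (Q * g ^+ 2) * (Q * g ^+ 2).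
    by set y := g; rewrite !expr2 !exprS expr0; ring.
  by rewrite ler_peMr //; lra.
split; first by rewrite -(ltr_nat R); lra.
rewrite -(ltr_nat R) !natrM natrD; lra.
Qed.

Lemma ln_d_bounds : 0 < ln d /\ 1 + ln d <= g - 2.
Proof.
split; first by rewrite ln_gt0.
have d1 := d_gt1; have d2 := dD.
have : ln d <= ln D%:R by rewrite ler_ln ?posrE //; lra.
lra.
Qed.

Section FixedN.
(* [Y] stands for [ln n]. *)
Variable Y : R.
Hypothesis Y_ge1 : 1 <= Y.

Definition beta_ : R := 3 * Y / (c2 * D%:R).
(** Short enough that sets of three times this size have at most one cycle:
    [(e * d) ^ (3 * block_len) <= n ^ (3 / 8)], while a second cycle costs a factor [1 / n]. *)
Definition block_len : nat := Num.truncn (Y / (8 * g)).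
Definition J_ : nat := up Y.
Definition G0_ : nat := up (gam / 2 * block_len.+2%:R + beta_).
Definition Nh_ : nat := up (gam / 2 * (3 * J_)%:R + beta_).
Definition Nb_ : nat := up (J_%:R + D%:R * (gam / 2 * (3 * J_)%:R + beta_)).
Definition s2_ : nat := (Nb_ + depth_blocks * block_len.+1 + 2 + up (2 * beta_))%N.
Definition K_ : R := A + 1 + (A + 2) * (2 * beta_).
Definition I_ : R := 2 * (1 + K_) + 1.

Lemma beta_bounds : 0 <= beta_ /\ beta_ <= 3 * (w * Y).
Proof.
have Y0 : 0 <= 3 * Y by have := Y_ge1; lra.
rewrite /beta_ -/c; split; first by rewrite divr_ge0 // ltW ?c_gt0.
have -> : 3 * (w * Y) = 3 * Y * w by ring.
by rewrite ler_wpM2l // inv_c_le.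
Qed.

Lemma block_len_bounds : block_len%:R <= Y / (8 * g) /\ Y / (8 * g) < block_len%:R + 1.
Proof.
have Y0 : 0 <= Y / (8 * g) by rewrite divr_ge0 //; have := Y_ge1; have := g_ge3; lra.
by have /andP[] := truncn_itv Y0; rewrite natr1.
Qed.

Lemma J_bounds : Y <= J_%:R /\ J_%:R <= Y + 1.
Proof. by have Y0 : 0 <= Y by [have := Y_ge1; lra]; split; [exact: up_ge|exact: up_le]. Qed.

Lemma Nh_bounds : gam / 2 * (3 * J_)%:R + beta_ <= Nh_%:R /\
  Nh_%:R <= 7 * (w * g * Y) + 2.
Proof.
have [b0 b1] := beta_bounds; have [j0 j1] := J_bounds; have [g0 g1] := gam_bounds.
have g3 := g_ge3; have w0 := w_gt0; have wg' := wg; have Y1 := Y_ge1.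
have x0 : 0 <= gam / 2 * (3 * J_)%:R + beta_ by rewrite addr_ge0 // mulr_ge0 // divr_ge0.
split; first exact: up_ge.
apply: le_trans (up_le x0) _.
have h1 : gam / 2 * (3 * J_)%:R <= w * g * (3 * (Y + 1)).
  apply: ler_pM => //; [exact: divr_ge0|lra|rewrite natrM; lra].
have h2 : w * Y <= w * Y * g by rewrite ler_peMr //; [apply: mulr_ge0; [exact: ltW|lra]|lra].
have h3 : w * g * (3 * (Y + 1)) = 3 * (w * g * Y) + 3 * (w * g) by set y := g; ring.
have h4 : w * Y * g = w * g * Y by set y := g; ring.
lra.
Qed.

Lemma Nb_bounds : J_%:R + D%:R * (gam / 2 * (3 * J_)%:R + beta_) <= Nb_%:R /\
  Nb_%:R <= (1 + 3 * (g + 1) / c2) * Y + (2 + 3 * g / c2).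
Proof.
have [b0 _] := beta_bounds; have [j0 j1] := J_bounds; have [g0 _] := gam_bounds.
have g3 := g_ge3; have Y1 := Y_ge1; have Dp : 0 < D%:R :> R by apply: lt_le_trans D_ge1.
have x0 : 0 <= J_%:R + D%:R * (gam / 2 * (3 * J_)%:R + beta_).
  by rewrite addr_ge0 // mulr_ge0 // addr_ge0 // mulr_ge0 // divr_ge0.
split; first exact: up_ge.
apply: le_trans (up_le x0) _.
have -> : D%:R * (gam / 2 * (3 * J_)%:R + beta_) = g / c2 * (3 * J_%:R) + 3 / c2 * Y.
  rewrite /gam /beta_ natrM; set y := g; field.
  by rewrite !gt_eqF.
have gc0 : 0 <= g / c2 by rewrite divr_ge0 ?(ltW c2_gt0) //; lra.
have h1 : g / c2 * (3 * J_%:R) <= g / c2 * (3 * (Y + 1)) by rewrite ler_wpM2l //; lra.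
have h2 : g / c2 * (3 * (Y + 1)) = 3 * g / c2 * Y + 3 * g / c2 by set y := g; ring.
have h3 : (1 + 3 * (g + 1) / c2) * Y = Y + 3 * g / c2 * Y + 3 / c2 * Y by set y := g; ring.
lra.
Qed.

Definition size_const : R := 3 * g / c2 + depth_blocks%:R + 7.

Lemma s2_bounds : 2 * beta_ <= s2_%:R /\ s2_%:R <= size_rate * Y + size_const.
Proof.
have [b0 b1] := beta_bounds; have [l0 _] := block_len_bounds.
have [_ nb] := Nb_bounds; have g3 := g_ge3; have Y1 := Y_ge1; have hp := h_gt0.
have bb : 0 <= 2 * beta_ by rewrite mulr_ge0.
have := up_ge bb; have := up_le bb; rewrite /s2_ !natrD natrM -[block_len.+1%:R]natr1.
set u : R := (up _)%:R => u1 u2.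
have db : depth_blocks%:R <= 32 * g / h + 1.
  by apply: up_le; rewrite divr_ge0 ?(ltW hp) //; lra.
have d0 : 0 <= depth_blocks%:R :> R by [].
have nb0 : 0 <= Nb_%:R :> R by [].
have l1 : depth_blocks%:R * block_len%:R <= (32 * g / h + 1) * (Y / (8 * g)).
  by apply: ler_pM.
have l1' : (32 * g / h + 1) * (Y / (8 * g)) = 4 / h * Y + Y / (8 * g).
  by set y := g in g3 *; field; rewrite !gt_eqF //; lra.
have l2 : Y / (8 * g) <= Y by rewrite ger_pMr ?invf_le1; lra.
have wb : w * Y <= Y.
  have := wg; have w0 := w_gt0; have : w * 1 <= w * g by rewrite ler_wpM2l ?(ltW w0) //; lra.
  by move=> h1 h2; rewrite ler_piMl //; lra.
have dl0 : 0 <= depth_blocks%:R * block_len%:R :> R by rewrite mulr_ge0.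
have wY6 : 2 * beta_ <= Y.
  have := wg; have w0 := w_gt0; have : w * 1 <= w * g by rewrite ler_wpM2l ?(ltW w0) //; lra.
  move=> h1 h2; have : w * Y <= 12^-1 * Y by rewrite ler_wpM2r //; lra.
  lra.
split; first by rewrite mulrDr; lra.
have e1 : size_rate * Y = 3 * Y + 3 * (g + 1) / c2 * Y + 4 / h * Y.
  by rewrite /size_rate -/h; set y := g; ring.
have e2 : (1 + 3 * (g + 1) / c2) * Y = Y + 3 * (g + 1) / c2 * Y by set y := g; ring.
rewrite /size_const mulrDr mulr1 e1; rewrite e2 in nb; lra.
Qed.

Lemma K_bounds : 0 <= K_ /\ K_ <= Q + 6 * (Q * w * Y).
Proof.
have [b0 b1] := beta_bounds; have a2 := A_ge2; have aQ := AQ.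
have p0 : 0 <= (A + 2) * (2 * beta_) by apply: mulr_ge0; lra.
split; first by rewrite /K_; lra.
have : (A + 2) * (2 * beta_) <= Q * (2 * (3 * (w * Y))).
  by apply: ler_pM; lra.
have -> : Q * (2 * (3 * (w * Y))) = 6 * (Q * w * Y) by ring.
rewrite /K_; lra.
Qed.

Lemma J_sub_Nh : 8 <= Y -> (Nh_ <= J_)%N /\ Y / 2 <= (J_ - Nh_)%N%:R.
Proof.
move=> Y8; have [_ nh] := Nh_bounds; have [j0 _] := J_bounds; have wg' := wg; have w0 := w_gt0.
have g3 := g_ge3.
have : w * g * Y <= (300 * 900)^-1 * Y by rewrite ler_wpM2r //; lra.
move=> h1; have NJ : (Nh_ <= J_)%N by rewrite -(ler_nat R); lra.
by split=> //; rewrite natrB //; lra.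
Qed.

End FixedN.

End Scales.

(** The balance of exponents. The coupling probability, entering as an inverse square, and the loss
    of variance both cost order [x * Y], and [x] is at most [1 / (10000 * g)]. Half of the allowed
    [Y / g] remains for the factor [Nb]; the terms without [Y] go into the constant. *)
Lemma exponent_le (R : realType) (g w Q Y Nb Nh : R) (x := w * g ^+ 3 * Q) :
  3 <= g -> 0 < w -> 1 <= Q -> 1 <= Y -> 100 * 100 * x * g <= 1 ->
  0 <= Nb -> Nb <= 5 * (g * Q) * Y + 4 * (g * Q) -> 0 <= Nh -> Nh <= 7 * (w * g * Y) + 2 ->
  Y / (2 * g) + 2 * (128 * (w * g ^+ 2) * Nb + 2 * g * Nh) <=
    110 * (g * Q) + 10 * g + (Y / g - (22 * g * (3 + 2 * Q) + 264 * (w * g * Q) * Y)).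
Proof.
move=> g3 w0 Q1 Y1 W3 Nb0 nb Nh0 nh.
have g0 : 0 <= g by lra.
have Q0 : 0 <= Q by lra.
have Y0 : 0 <= Y by lra.
have wn := ltW w0.
have wg2 : 0 <= w * g ^+ 2 by rewrite mulr_ge0 ?exprn_ge0.
have gg : 1 <= g * g by rewrite -[leLHS]mulr1; apply: ler_pM; lra.
have gQ : g <= g * Q by rewrite ler_peMr.
have gQ1 : 1 <= g * Q by apply: le_trans gQ; lra.
have x0 : 0 <= x by rewrite /x !mulr_ge0 ?exprn_ge0.
have Yg0 : 0 <= Y / g by rewrite divr_ge0.
have xY : 100 * 100 * (x * Y) <= Y / g.
  rewrite ler_pdivlMr; last by apply: lt_le_trans g3.
  have -> : 100 * 100 * (x * Y) * g = (100 * 100 * x * g) * Y by ring.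
  by rewrite ler_piMl.
have xs : 100 * 100 * x <= 1.
  apply: le_trans W3; rewrite ler_peMr ?mulr_ge0 //.
  by apply: le_trans g3; lra.
have B1 : 128 * (w * g ^+ 2) * Nb <= 640 * (x * Y) + 512 * x.
  have -> : 640 * (x * Y) + 512 * x = 128 * (w * g ^+ 2) * (5 * (g * Q) * Y + 4 * (g * Q)).
    by rewrite /x; ring.
  by rewrite ler_wpM2l ?mulr_ge0.
have g2x : w * g ^+ 2 * Y <= x * Y.
  rewrite ler_wpM2r // (_ : x = w * g ^+ 2 * (g * Q)); last by rewrite /x; ring.
  by rewrite ler_peMr.
have B2 : 2 * g * Nh <= 14 * (x * Y) + 4 * g.
  apply: (@le_trans _ _ (14 * (w * g ^+ 2 * Y) + 4 * g)); last by rewrite lerD2r ler_wpM2l.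
  have -> : 14 * (w * g ^+ 2 * Y) + 4 * g = 2 * g * (7 * (w * g * Y) + 2) by ring.
  by rewrite ler_wpM2l ?mulr_ge0.
have L1 : w * g * Q * Y <= x * Y.
  rewrite ler_wpM2r // (_ : x = w * g * Q * (g * g)); last by rewrite /x; ring.
  by rewrite ler_peMr // !mulr_ge0.
have -> : Y / (2 * g) = Y / g / 2 by field; lra.
have -> : 22 * g * (3 + 2 * Q) + 264 * (w * g * Q) * Y =
   66 * g + 44 * (g * Q) + 264 * (w * g * Q * Y) by ring.
move: B1 B2 L1 g3 xs xY gQ Yg0 x0.
set b1 := 128 * _ * _; set b2 := 2 * g * Nh; set b3 := w * g * Q * Y; set b4 := x * Y.
set b5 := Y / g; set b6 := g * Q; clearbody b1 b2 b3 b4 b5 b6 x; clear; lra.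
Qed.

(** * Verification of the numerical conditions for large n *)

Section Numerics.
Variables (R : realType) (k D : nat) (d c2 sig A Q : R).
Local Notation N0 := (k - D)%N.
Local Notation g := (ln (D%:R : R) + 3).
Local Notation w := (Q / D%:R).
Hypotheses (d_gt1 : 1 < d) (dD : d <= D%:R) (Dk : (D <= k)%N) (D2N : D%:R <= 2 * N0%:R :> R).
Hypothesis lnk : ln k%:R <= 2 * ln (D%:R : R).
Hypotheses (c2_gt0 : 0 < c2) (sig_ge1 : 1 <= sig) (A_ge2 : 2 <= A).
Hypotheses (Q_ge1 : 1 <= Q) (c2Q : 1 <= c2 * Q) (hQ : 1 <= ln sig * Q) (AQ : A + 2 <= Q).
Hypothesis master : 100 * 100 * (Q ^+ 2 * g ^+ 4) <= D%:R.

Let g3 := g_ge3 d_gt1 dD.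
Let w0 := w_gt0 d_gt1 dD Q_ge1.
Let wg3' := wg3 d_gt1 dD Q_ge1 master.
Let wg2' := wg2 d_gt1 dD Q_ge1 master.
Let wg1' := wg1 d_gt1 dD Q_ge1 master.
Let wg0' := wg d_gt1 dD Q_ge1 master.

Variable n : nat.
Hypothesis n_gt0 : (0 < n)%N.
Local Notation Y := (ln (n%:R : R)).
Hypotheses (Y_gQ : 200 * (g * Q) <= Y) (Y_gD : 8 * g * D%:R <= Y).
Hypothesis Y_contr : expR (3 * ln sig) * (2 * Q) * Y <= expR (ln sig / (32 * g) * Y).
Hypothesis Y_half : 2 <= expR (ln sig / (32 * g) * Y).
Hypothesis Y_n : 14 * Q * Y <= n%:R.

Local Notation l := (block_len D Y).
Local Notation J := (J_ Y).
Local Notation K := (K_ D c2 A Y).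
Local Notation I := (I_ D c2 A Y).
Local Notation Nh := (Nh_ D c2 Y).
Local Notation Nb := (Nb_ D c2 Y).

Lemma nE : n%:R = expR Y.
Proof. by rewrite lnK // posrE ltr0n. Qed.

Lemma gQ_ge : g <= g * Q /\ 3 * Q <= g * Q.
Proof.
have g3' := g3; have Q1 := Q_ge1; split; first by rewrite ler_peMr //; lra.
by rewrite ler_wpM2r //; lra.
Qed.

Lemma Y_ge8 : 8 <= Y.
Proof. by have [h1 h2] := gQ_ge; have := g3; have := Y_gQ; lra. Qed.

Lemma Y_ge1 : 1 <= Y.
Proof. by have := Y_ge8; lra. Qed.

(** Heavy vertices use up at most half of a block, so [G0 - l <= 3 - Y / (16 * g)]. One half of the
    resulting decay absorbs [K], which is linear in [Y], and the other half remains. *)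
Lemma contraction_le : sig ^+ (G0_ D c2 Y) / sig ^+ l * K <= expR (- (ln sig / (32 * g) * Y)).
Proof.
have sp : 0 < sig by apply: lt_le_trans sig_ge1.
have hp := h_gt0 Q_ge1 hQ; have Y1 := Y_ge1; have g3' := g3.
have [b0 b1] := beta_bounds d_gt1 dD c2_gt0 c2Q Y1.
have [K0 K1] := K_bounds d_gt1 dD c2_gt0 A_ge2 c2Q AQ Y1.
have [l1 l2] := block_len_bounds d_gt1 dD Y1.
have [ga0 ga1] := gam_bounds d_gt1 dD c2_gt0 c2Q.
have W := wg0'; have W0 := w0; have Wp : w <= w * g by rewrite ler_peMr ?(ltW W0) //; lra.
set y : R := Y in Y1 b0 b1 K0 K1 l1 l2 *; set v := w in W W0 ga1 b1 K1 Wp.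
have gl : gam D c2 / 2 * l%:R <= v * y / 8.
  apply: (@le_trans _ _ (v * g * (y / (8 * g)))); last first.
    by rewrite le_eqVlt; apply/orP; left; apply/eqP; set x := g in g3' *; field; lra.
  by apply: ler_pM => //; [apply: divr_ge0|lra].
have x0 : 0 <= gam D c2 / 2 * l.+2%:R + beta_ D c2 y.
  by rewrite addr_ge0 // mulr_ge0 // divr_ge0.
have G0le : (G0_ D c2 y)%:R <= 4 * (v * y) + 2.
  apply: le_trans (up_le x0) _.
  rewrite -[l.+2]addn2 natrD mulrDr; lra.
have vy : 0 <= v * y by rewrite mulr_ge0 ?(ltW W0) //; lra.
have vy' : 4 * (v * y) <= y / (16 * g).
  rewrite ler_pdivlMr; last by rewrite mulr_gt0 //; lra.
  have -> : 4 * (v * y) * (16 * g) = 64 * (v * g) * y by set x := g; ring.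
  by rewrite ler_piMl //; lra.
have e8 : y / (8 * g) = 2 * (y / (16 * g)) by set x := g in g3' *; field; lra.
have K2 : K_ D c2 A y <= 2 * Q * y.
  have : 6 * (Q * v * y) <= Q * y.
    have -> : 6 * (Q * v * y) = Q * y * (6 * v) by ring.
    have Q1 := Q_ge1.
    have v6 : 6 * v <= 1 by lra.
    have Qy : 0 <= Q * y by apply: mulr_ge0; lra.
    exact: ler_piMr.
  have : Q <= Q * y by rewrite ler_peMr //; have := Q_ge1; lra.
  lra.
have e32 : ln sig * (3 - y / (16 * g)) =
    3 * ln sig - (ln sig / (32 * g) * y) - (ln sig / (32 * g) * y).
  by set x := g in g3' *; field; lra.
have h0 : (G0_ D c2 y)%:R - l%:R <= 3 - y / (16 * g) by lra.
have h1 : sig ^+ (G0_ D c2 y) / sig ^+ l <= expR (ln sig * (3 - y / (16 * g))).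
  rewrite -[X in X ^+ _ / X ^+ _](lnK sp) -!expRM_natl -expRN -expRD ler_expR.
  by rewrite -mulNr -mulrDl mulrC ler_pM2l.
apply: (@le_trans _ _ (expR (ln sig * (3 - y / (16 * g))) * (2 * Q * y))).
  by apply: ler_pM => //; rewrite divr_ge0 // exprn_ge0 // ltW.
rewrite e32 !expRD; set z := - _.
have -> : expR (3 * ln sig) * expR z * expR z * (2 * Q * y) =
    expR z * (expR z * (expR (3 * ln sig) * (2 * Q) * y)) by ring.
rewrite ler_piMr ?expR_ge0 // /z expRN mulrC ler_pdivrMr ?expR_gt0 // mul1r.
exact: Y_contr.
Qed.

Lemma contraction_half : sig ^+ (G0_ D c2 Y) / sig ^+ l * K <= 2^-1.
Proof.
apply: le_trans contraction_le _; rewrite expRN lef_pV2 ?posrE ?expR_gt0 //.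
Qed.

Lemma contraction_pow :
  (sig ^+ (G0_ D c2 Y) / sig ^+ l * K) ^+ depth_blocks D sig * n%:R <= 1.
Proof.
have hp := h_gt0 Q_ge1 hQ; have Y1 := Y_ge1; have g3' := g3.
have sp : 0 < sig by apply: lt_le_trans sig_ge1.
have [K0 _] := K_bounds d_gt1 dD c2_gt0 A_ge2 c2Q AQ Y1.
apply: (@le_trans _ _ (expR (- (ln sig / (32 * g) * Y)) ^+ depth_blocks D sig * n%:R)).
  rewrite ler_wpM2r //; apply: lerXn2r; rewrite ?nnegrE ?expR_ge0 ?contraction_le //.
  by rewrite mulr_ge0 // divr_ge0 // exprn_ge0 // ltW.
have x0 : 0 <= 32 * g / ln sig by rewrite divr_ge0 ?(ltW hp) //; lra.
have hi : 32 * g / ln sig <= (depth_blocks D sig)%:R := up_ge x0.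
rewrite -expRM_natl [X in _ * X]nE -expRD -[leRHS]expR0 ler_expR.
have : 32 * g / ln sig * (ln sig / (32 * g) * Y) <= (depth_blocks D sig)%:R * (ln sig / (32 * g) * Y).
  apply: ler_wpM2r; last exact: hi.
  apply: mulr_ge0; last by lra.
  by apply: divr_ge0; [exact: ltW|lra].
have -> : 32 * g / ln sig * (ln sig / (32 * g) * Y) = Y.
  by set x := g in g3' *; set z := Y; field; rewrite ?gt_eqF //; lra.
rewrite mulrN; lra.
Qed.

Lemma size_ok : (D + 2 <= 3 * l.+2)%N.
Proof.
have [_ l2] := block_len_bounds d_gt1 dD Y_ge1.
have : D%:R <= Y / (8 * g) by rewrite ler_pdivlMr ?mulr_gt0 //; have := g3; have := Y_gD; lra.
move=> h1; have : (D < l + 1)%N by rewrite -(ltr_nat R) natrD; lra.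
by clear; lia.
Qed.

Lemma depth_ok : (depth_blocks D sig * l.+1 + 2 <= s2_ D c2 sig Y)%N /\ (Nb <= s2_ D c2 sig Y)%N.
Proof.
rewrite /s2_; set a := Nb; set b := (_ * _)%N; set c := up _.
by move: a b c => a b c; clear; split; lia.
Qed.

Lemma I_bounds : 1 <= I /\ I <= 3 + 2 * Q + 12 * (w * Q * Y) /\ I <= n%:R / 2.
Proof.
have Y1 := Y_ge1; have [K0 K1] := K_bounds d_gt1 dD c2_gt0 A_ge2 c2Q AQ Y1.
have W := wg0'; have W0 := w0; have g3' := g3; have Yn := Y_n; have Q1 := Q_ge1.
have Wp : w <= w * g by rewrite ler_peMr ?(ltW W0) //; lra.
have e : Q * w * Y = w * Q * Y by rewrite [Q * w]mulrC.
rewrite e in K1.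
have QY : Q <= Q * Y by rewrite ler_peMr //; lra.
have : w * Q * Y <= 6^-1 * (Q * Y).
  by rewrite -mulrA ler_wpM2r // ?mulr_ge0 //; lra.
rewrite /I_; split; [lra|split; lra].
Qed.

Lemma J_le_n : (J <= n)%N.
Proof.
have [_ j1] := J_bounds Y_ge1; have := Y_n; have Y1 := Y_ge1; have Q1 := Q_ge1.
have : Y <= Q * Y by rewrite ler_peMl //; lra.
move=> h1 h2; rewrite -(ler_nat R); lra.
Qed.

Local Notation t := (up (draw_rate R D * n%:R)).

Lemma draws_bounds : draw_rate R D * n%:R <= t%:R /\ t%:R <= (11 * g) * n%:R.
Proof.
have g3' := g3; have tau0 : 0 <= draw_rate R D by rewrite /draw_rate; lra.
have x0 : 0 <= draw_rate R D * n%:R by rewrite mulr_ge0.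
split; first exact: up_ge.
apply: le_trans (up_le x0) _.
have n1 : 1 <= n%:R :> R by rewrite ler1n.
have : 15 * n%:R <= 5 * g * n%:R by rewrite ler_wpM2r //; lra.
rewrite /draw_rate; lra.
Qed.

Lemma survival_ge :
  expR (- (22 * g * (3 + 2 * Q) + 264 * (w * g * Q) * Y)) <= (1 - I / n%:R) ^+ t.
Proof.
have [I1 [I2 I3]] := I_bounds; have [_ T] := draws_bounds; have g3' := g3.
have np : 0 < n%:R :> R by rewrite ltr0n.
have x0 : 0 <= I / n%:R by rewrite divr_ge0 //; lra.
have x1 : I / n%:R <= 2^-1 by rewrite ler_pdivrMr //; lra.
apply: (@le_trans _ _ (expR (- (2 * (I / n%:R))) ^+ t)); last first.
  by apply: lerXn2r; rewrite ?nnegrE ?expR_ge0 ?one_sub_ge_expR //; lra.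
rewrite -expRM_natl ler_expR mulrN lerN2.
have : t%:R * (2 * (I / n%:R)) <= 11 * g * n%:R * (2 * (I / n%:R)).
  by rewrite ler_wpM2r // mulr_ge0.
have -> : 11 * g * n%:R * (2 * (I / n%:R)) = 22 * g * I.
  by set x := g; set i := I; field; rewrite gt_eqF.
have : 22 * g * I <= 22 * g * (3 + 2 * Q + 12 * (w * Q * Y)).
  by rewrite ler_wpM2l //; lra.
have -> : 22 * g * (3 + 2 * Q + 12 * (w * Q * Y)) = 22 * g * (3 + 2 * Q) + 264 * (w * g * Q) * Y.
  by set x := g; set v := w; ring.
lra.
Qed.

Lemma draws_exponent : 2 * Y + (3 * J)%:R * (g - 1) - draw_rate R D * (Y / 2) <=
  - 1 - (22 * g * (3 + 2 * Q) + 264 * (w * g * Q) * Y).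
Proof.
have g3' := g3; have Y8 := Y_ge8; have YQ := Y_gQ; have [_ j1] := J_bounds Y_ge1.
have [gQ1 gQ3] := gQ_ge; have W := wg1'.
have h1 : (3 * J)%:R * (g - 1) <= 3 * (Y + 1) * (g - 1).
  by rewrite natrM ler_wpM2r //; lra.
have h2 : 3 * (Y + 1) * (g - 1) = 3 * (g * Y) - 3 * Y + 3 * g - 3 by set x := g; ring.
have h3 : draw_rate R D * (Y / 2) = 3 * (g * Y) + 7 * Y by rewrite /draw_rate; set x := g; field.
have h4 : 264 * (w * g * Q) * Y <= Y by rewrite ler_piMl //; lra.
have h5 : 22 * g * (3 + 2 * Q) = 66 * g + 44 * (g * Q) by set x := g; ring.
lra.
Qed.

Lemma draws_suffice (S : R) : S <= n%:R ^+ 2 * (expR 1 * d) ^+ (3 * J) ->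
  S * (2 ^ (3 * J))%:R * (1 - (J - Nh)%:R / n%:R) ^+ t <= 2^-1 * (1 - I / n%:R) ^+ t.
Proof.
have g3' := g3; have Y8 := Y_ge8.
have [NJ JN] := J_sub_Nh d_gt1 dD c2_gt0 Q_ge1 c2Q master Y_ge1 Y8.
have [T _] := draws_bounds; have [_ ld] := ln_d_bounds d_gt1 dD.
have np : 0 < n%:R :> R by rewrite ltr0n.
have dp : 0 < d by apply: lt_trans d_gt1.
have e1 : 2 <= expR 1 :> R by apply: le_trans (expR_ge1Dx _); lra.
have e2 : expR (- 1) <= 2^-1 :> R by rewrite expRN lef_pV2 ?posrE ?expR_gt0.
have dE : expR 1 * d = expR (1 + ln d) by rewrite expRD lnK.
have g12 : g - 1 = (g - 2) + 1 by lra.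
have x0 : 0 <= (J - Nh)%:R / n%:R :> R by rewrite divr_ge0.
have x1 : (J - Nh)%:R / n%:R <= 1 :> R.
  by rewrite ler_pdivrMr // mul1r ler_nat (leq_trans (leq_subr _ _)) // J_le_n.
have x2 : 0 <= 1 - (J - Nh)%:R / n%:R :> R by lra.
have tau0 : 0 <= draw_rate R D by rewrite /draw_rate; lra.
have Y2 : 0 <= Y / 2 by lra.
have ex : 2 * Y + (3 * J)%:R * (g - 1) + - (draw_rate R D * (Y / 2)) <=
    - 1 + - (22 * g * (3 + 2 * Q) + 264 * (w * g * Q) * Y).
  exact: draws_exponent.
move=> hS.
apply: le_trans (_ : 2^-1 * expR (- (22 * g * (3 + 2 * Q) + 264 * (w * g * Q) * Y)) <= _);
  last by rewrite ler_pM2l ?invr_gt0 ?survival_ge.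
have b1 : S * (2 ^ (3 * J))%:R <= expR (2 * Y + (3 * J)%:R * (g - 1)).
  have -> : expR (2 * Y + (3 * J)%:R * (g - 1)) = n%:R ^+ 2 * expR (g - 1) ^+ (3 * J).
    by rewrite [X in X ^+ 2]nE -!expRM_natl -expRD.
  apply: le_trans (_ : n%:R ^+ 2 * (expR 1 * d) ^+ (3 * J) * (2 ^ (3 * J))%:R <= _).
    by rewrite ler_wpM2r.
  rewrite -mulrA ler_pM2l ?exprn_gt0 // natrX -exprMn.
  apply: lerXn2r; rewrite ?nnegrE ?expR_ge0 ?mulr_ge0 ?expR_ge0 ?(ltW dp) //.
  rewrite g12 expRD; apply: ler_pM => //; first by rewrite dE expR_ge0.
  by rewrite dE ler_expR.
have b2 : (1 - (J - Nh)%:R / n%:R) ^+ t <= expR (- (draw_rate R D * (Y / 2))).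
  apply: (@le_trans _ _ (expR (- ((J - Nh)%:R / n%:R)) ^+ t)).
    by apply: lerXn2r; rewrite ?nnegrE ?expR_ge0 ?expR_ge1Dx.
  rewrite -expRM_natl ler_expR mulrN lerN2.
  apply: (@le_trans _ _ (draw_rate R D * n%:R * ((Y / 2) / n%:R))).
    by rewrite mulrACA mulfV ?gt_eqF // mulr1.
  apply: ler_pM => //; first by rewrite mulr_ge0.
    by rewrite divr_ge0.
  by rewrite ler_wpM2r // invr_ge0.
apply: (@le_trans _ _ (expR (2 * Y + (3 * J)%:R * (g - 1)) * expR (- (draw_rate R D * (Y / 2))))).
  apply: (@le_trans _ _ (expR (2 * Y + (3 * J)%:R * (g - 1)) * (1 - (J - Nh)%:R / n%:R) ^+ t)).
    by rewrite ler_wpM2r // exprn_ge0.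
  by rewrite ler_wpM2l ?expR_ge0.
set X := expR (- (22 * _ * _ + _)).
apply: (@le_trans _ _ (expR (- 1) * X)); last by rewrite ler_wpM2r ?expR_ge0.
by rewrite /X -!expRD ler_expR.
Qed.

Definition mixing_const : R := 144 * (g * g * Q) * expR (110 * (g * Q) + 10 * g).

Lemma poincare_const_le (j0 := excess_bound D c2 sig)
    (r : R := 1 - ((2 * (1 + j0))%N%:R *+ 2) / N0%:R) (P := (1 - I / n%:R) ^+ t) :
  0 < P /\ 8 * Nb%:R / (r ^+ Nb * k%:R ^- Nh) ^+ 2 <= mixing_const * expR (Y / g) * P.
Proof.
have g3' := g3; have Y8 := Y_ge8; have Y1 := Y_ge1; have YQ := Y_gQ; have Q1 := Q_ge1.
have [_ e8] := excess_bounds d_gt1 dD c2_gt0 Q_ge1 c2Q hQ.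
have [_ nb] := Nb_bounds d_gt1 dD c2_gt0 c2Q Y1.
have [_ nh] := Nh_bounds d_gt1 dD c2_gt0 Q_ge1 c2Q master Y1.
have [gQ1 gQ3] := gQ_ge; have W0 := w0; have W2 := wg2'; have [_ W3] := wg3'; have D2 := D2N.
have lk := lnk; have Dp : 0 < D%:R :> R by have := dD; have := d_gt1; lra.
have i1 : c2^-1 <= Q by rewrite -[leLHS]mul1r ler_pdivrMr // mulrC.
have nb1 : Nb%:R <= 5 * (g * Q) * Y + 4 * (g * Q).
  have a1 : 3 * (g + 1) / c2 <= 3 * (g + 1) * Q by rewrite ler_wpM2l //; lra.
  have a2 : 3 * g / c2 <= 3 * g * Q by rewrite ler_wpM2l //; lra.
  have a3 : (1 + 3 * (g + 1) / c2) * Y <= 5 * (g * Q) * Y.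
    rewrite ler_wpM2r //; first by lra.
    have : 3 * (g + 1) * Q = 3 * (g * Q) + 3 * Q by set x := g; ring.
    lra.
  have : 3 * g * Q = 3 * (g * Q) by set x := g; ring.
  lra.
have N0p : 0 < N0%:R :> R by lra.
set u : R := _ / N0%:R in r *.
have u0 : 0 <= u by rewrite divr_ge0 // mulrn_wge0.
have u1 : u <= 64 * (w * g ^+ 2).
  rewrite /u ler_pdivrMr // natrM natrD -/j0 -/(1 : R).
  have : 64 * (w * g ^+ 2) * (D%:R / 2) <= 64 * (w * g ^+ 2) * N0%:R.
    by rewrite ler_wpM2l //; [apply: mulr_ge0 => //; apply: mulr_ge0; [exact: ltW|apply: exprn_ge0; lra]|lra].
  have -> : 64 * (w * g ^+ 2) * (D%:R / 2) = 32 * (Q * g ^+ 2).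
    by set x := g; field; rewrite gt_eqF.
  move: e8; rewrite -/j0 mulr2n; lra.
have Qw : w * g ^+ 2 <= w * g ^+ 2 * Q.
  by rewrite ler_peMr //; apply: mulr_ge0; [exact: ltW|apply: exprn_ge0; lra].
have r1 : expR (- (128 * (w * g ^+ 2))) <= r.
  apply: le_trans (_ : expR (- (2 * u)) <= _); first by rewrite ler_expR; lra.
  by apply: one_sub_ge_expR => //; lra.
have kp : 0 < k%:R :> R by apply: lt_le_trans Dp _; rewrite ler_nat.
set B := 128 * (w * g ^+ 2) * Nb%:R + 2 * g * Nh%:R.
set L := 22 * g * (3 + 2 * Q) + 264 * (w * g * Q) * Y.
have Nb2 : 8 * Nb%:R <= 72 * (g * Q) * Y.
  have : g * Q <= g * Q * Y by rewrite ler_peMr //; lra.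
  lra.
(* The factor [Nb], linear in [ln n], is traded for [n ^ (1 / (2 * g))], half of the permitted
   exponent. *)
have Yg : Y <= 2 * g * expR (Y / (2 * g)).
  have : Y / (2 * g) <= expR (Y / (2 * g)) by apply: le_trans (expR_ge1Dx _); lra.
  by rewrite ler_pdivrMr 1?mulrC; lra.
have Nb3 : 8 * Nb%:R <= 144 * (g * g * Q) * expR (Y / (2 * g)).
  apply: le_trans Nb2 _.
  have -> : 144 * (g * g * Q) * expR (Y / (2 * g)) = 72 * (g * Q) * (2 * g * expR (Y / (2 * g))).
    by set z := g; set e := expR _; ring.
  by rewrite ler_wpM2l //; lra.
have fin : Y / (2 * g) + 2 * B <= 110 * (g * Q) + 10 * g + (Y / g - L).
  exact: exponent_le.
have g0 : 0 <= g := le_trans (ler0n R 3) g3'.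
have gg0 : 0 <= g * g := mulr_ge0 g0 g0.
have Q0 : 0 <= Q := le_trans ler01 Q1.
have lk2 : ln k%:R <= 2 * g by lra.
have ggQ : 0 <= 144 * (g * g * Q) by apply: mulr_ge0 => //; apply: mulr_ge0.
have surv := survival_ge; rewrite -/L -/P in surv.
have Pp : 0 < P by apply: lt_le_trans surv; apply: expR_gt0.
split=> //.
have rb : expR (- (128 * (w * g ^+ 2) * Nb%:R)) <= r ^+ Nb.
  rewrite -mulNr mulrC expRM_natl; apply: lerXn2r; rewrite ?nnegrE ?expR_ge0 //.
  exact: le_trans (expR_ge0 _) r1.
have kb : expR (- (2 * g * Nh%:R)) <= k%:R ^- Nh.
  rewrite -mulNr mulrC expRM_natl -exprVn; apply: lerXn2r; rewrite ?nnegrE ?expR_ge0 ?invr_ge0 //.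
  by rewrite expRN lef_pV2 ?posrE ?expR_gt0 // -[leLHS]lnK ?posrE // ler_expR.
have rk : expR (- B) <= r ^+ Nb * k%:R ^- Nh.
  by rewrite /B opprD expRD; apply: ler_pM; rewrite ?expR_ge0.
have rk2 : expR (- (2 * B)) <= (r ^+ Nb * k%:R ^- Nh) ^+ 2.
  rewrite -mulrN expRM_natl; apply: lerXn2r; rewrite ?nnegrE ?expR_ge0 //.
  exact: le_trans (expR_ge0 _) rk.
have den : 8 * Nb%:R / (r ^+ Nb * k%:R ^- Nh) ^+ 2 <= 8 * Nb%:R * expR (2 * B).
  rewrite ler_wpM2l ?mulr_ge0 // -[expR _]invrK -expRN lef_pV2 ?posrE ?expR_gt0 //.
  exact: lt_le_trans (expR_gt0 _) rk2.
apply: le_trans den _.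
apply: (@le_trans _ _ (mixing_const * expR (Y / g) * expR (- L))); last first.
  by rewrite ler_wpM2l // mulr_ge0 ?expR_ge0 // /mixing_const mulr_ge0 ?expR_ge0.
apply: (@le_trans _ _ (144 * (g * g * Q) * expR (Y / (2 * g)) * expR (2 * B))).
  by rewrite ler_wpM2r ?expR_ge0.
rewrite /mixing_const -!(mulrA (144 * _)) ler_wpM2l // -!expRD ler_expR -addrA.
exact: fin.
Qed.

End Numerics.

(** * Mixing on graphs with the required properties *)

Section GoodGraphs.
Variables (R : realType) (k D : nat) (d c2 sig A t1 q Q : R).
Local Notation N0 := (k - D)%N.
Local Notation g := (ln (D%:R : R) + 3).

Definition good_graph n (E : {set 'I_n * 'I_n}) : Prop :=
  let Y : R := ln n%:R in let e := adj E in
  [/\ forall T : {set 'I_n}, conn e T -> (#|T| <= 3 * (block_len D Y).+2)%N ->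
        (edges2 e T <= 2 * #|T|)%N,
      forall T : {set 'I_n}, conn e T -> (#|T| <= s2_ D c2 sig Y)%N ->
        (edges2 e T <= 2 * (#|T| + excess_bound D c2 sig))%N,
      forall T : {set 'I_n}, conn e T ->
        \sum_(v in T) hw R e (heavy e D) D v <= gam D c2 / 2 * #|T|%:R + beta_ D c2 Y
    & (\sum_(T : {set 'I_n} | `[< conn e T >] && (#|T| <= 3 * J_ Y)%N) 1) <=
        n%:R ^+ 2 * (expR 1 * d) ^+ (3 * J_ Y)].

Hypotheses (d_gt1 : 1 < d) (dD : d <= D%:R) (Dk : (D <= k)%N) (D2N : D%:R <= 2 * N0%:R :> R).
Hypotheses (t1_ge : D%:R <= t1 * (k%:R - 1)) (t1_contr : t1 * expR (N0%:R / (N0%:R - 1) * t1) <= q).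
Hypothesis lnk : ln k%:R <= 2 * ln (D%:R : R).
Hypothesis c2_gt0 : 0 < c2.
Hypotheses (sig_ge1 : 1 <= sig) (sig_le2 : sig <= 2) (A_ge2 : 2 <= A).
Hypotheses (A_ge : 6 <= (1 - sig * q) * A) (q_ge0 : 0 <= q).
Hypotheses (Q_ge1 : 1 <= Q) (c2Q : 1 <= c2 * Q) (hQ : 1 <= ln sig * Q) (AQ : A + 2 <= Q).
Hypothesis master : 100 * 100 * (Q ^+ 2 * g ^+ 4) <= D%:R.

Lemma D_ge32 : (32 <= D)%N.
Proof.
have g3 := g_ge3 d_gt1 dD; have Q1 := Q_ge1; have m := master.
have Q2 : 1 <= Q ^+ 2 by apply: exprn_ege1.
have g4 : 1 <= g ^+ 4 by apply: exprn_ege1; lra.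
have : 1 <= Q ^+ 2 * g ^+ 4 by rewrite -[leLHS]mulr1; apply: ler_pM.
by move=> h; rewrite -(ler_nat R); lra.
Qed.

Lemma mixing_const_ge1 : 1 <= mixing_const D Q.
Proof.
have g3 := g_ge3 d_gt1 dD; have Q1 := Q_ge1.
have gQ0 : 0 <= g * Q by apply: mulr_ge0; lra.
have e1 : 1 <= expR (110 * (g * Q) + 10 * g) by apply: le_trans (expR_ge1Dx _); lra.
rewrite /mixing_const -[leLHS]mulr1; apply: ler_pM => //.
have gg : 1 <= g * g by rewrite -[leLHS]mulr1; apply: ler_pM; lra.
have : 1 <= g * g * Q by rewrite -[leLHS]mulr1; apply: ler_pM => //; lra.
lra.
Qed.

(** One factor [n] is the number of single-site updates averaged in a step, the other comes from the
    logarithm of the number of colourings. Since [g = ln D + 3] exceeds [ln d], the Poincare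
    constant of order [n ^ (1 / g)] fits into [n ^ (1 / ln d)]. *)
Lemma mixing_bound_le (n : nat) : (0 < n)%N ->
  n%:R * (mixing_const D Q * expR (ln n%:R / g)) * (n%:R * ln k%:R + 2) + 1 <=
  (mixing_const D Q * (2 * g + 2) + 1) * (n%:R `^ (2 + (ln d)^-1)).
Proof.
move=> n0; have np : 0 < n%:R :> R by rewrite ltr0n.
have n1 : 1 <= n%:R :> R by rewrite ler1n.
have g3 := g_ge3 d_gt1 dD; have m1 := mixing_const_ge1; have lk := lnk.
have [ld0 ld1] := ln_d_bounds d_gt1 dD.
have Y0 : 0 <= ln n%:R :> R by rewrite ln_ge0.
have gp : 0 < g by lra.
set M := mixing_const D Q in m1 *; set y : R := ln n%:R in Y0 *.
have e1 : 1 <= expR (y / g) by apply: le_trans (expR_ge1Dx _); rewrite lerDl divr_ge0 // ltW.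
have -> : n%:R `^ (2 + (ln d)^-1) = n%:R ^+ 2 * expR (y / ln d).
  rewrite /powR gt_eqF // mulrDl expRD expRM_natl lnK ?posrE //.
  by rewrite [(ln d)^-1 * _]mulrC.
have e2 : expR (y / g) <= expR (y / ln d).
  rewrite ler_expR ler_wpM2l // lef_pV2 ?posrE //; lra.
set x := expR (y / g) in e1 e2 *.
have nn : n%:R <= n%:R ^+ 2 :> R by rewrite expr2 ler_peMr // ltW.
apply: (@le_trans _ _ ((M * (2 * g + 2) + 1) * (n%:R ^+ 2 * x))); last first.
  have M0 : 0 <= M * (2 * g + 2) by apply: mulr_ge0; lra.
  by rewrite ler_wpM2l ?ler_wpM2l ?exprn_ge0 ?addr_ge0.
have b1 : n%:R * ln k%:R + 2 <= n%:R * (2 * g + 2).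
  have : n%:R * ln k%:R <= n%:R * (2 * g) by rewrite ler_wpM2l //; lra.
  lra.
have Mx : 1 <= M * x by rewrite -[leLHS]mulr1; apply: ler_pM.
have b2 : n%:R * (M * x) * (n%:R * ln k%:R + 2) <= n%:R * (M * x) * (n%:R * (2 * g + 2)).
  by rewrite ler_wpM2l // mulr_ge0 //; lra.
have b3 : n%:R * (M * x) * (n%:R * (2 * g + 2)) = M * (2 * g + 2) * (n%:R ^+ 2 * x).
  by rewrite expr2; set z := g; ring.
have b4 : 1 <= n%:R ^+ 2 * x.
  by rewrite -[leLHS]mulr1; apply: ler_pM => //; apply: le_trans nn.
rewrite mulrDl mul1r; lra.
Qed.

Lemma good_graph_mixing : exists C : R, 0 < C /\
  eventually (fun n => forall E : {set 'I_n * 'I_n}, E \subset upper_pairs n -> good_graph E ->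
    mixing_time_le R n k E (C * (n%:R `^ (2 + (ln d)^-1)))).
Proof.
have g3 := g_ge3 d_gt1 dD; have hp := h_gt0 Q_ge1 hQ.
have a0 : 0 < ln sig / (32 * g) by rewrite divr_gt0 //; lra.
exists (mixing_const D Q * (2 * g + 2) + 1); split.
  have m1 := mixing_const_ge1.
  have : 0 <= mixing_const D Q * (2 * g + 2) by apply: mulr_ge0; lra.
  lra.
have ev := eventually_and pos_large (eventually_and (ln_large (200 * (g * Q)))
  (eventually_and (ln_large (8 * g * D%:R)) (eventually_and
  (poly_le_exp (expR (3 * ln sig) * (2 * Q)) 1 a0) (eventually_and (poly_le_exp 2 0 a0)
  (poly_le_exp (14 * Q) 1 (@ltr01 R)))))).
have [N hN] := ev; exists N => n /hN [n0 [Y1 [Y2 [Y3 [Y4 Y5]]]]] E EU [sparse_s sparse_l light count].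
rewrite expr1 in Y3; rewrite expr0 mulr1 in Y4.
rewrite expr1 mul1r lnK ?posrE ?ltr0n // in Y5.
have Yge1 : 1 <= ln n%:R :> R by apply: (Y_ge1 d_gt1 dD Q_ge1 Y1).
have [gam0 _] := gam_bounds d_gt1 dD c2_gt0 c2Q.
have [beta0 _] := beta_bounds d_gt1 dD c2_gt0 c2Q Yge1.
have [N0_gt1 D0_small] := N0_bounds d_gt1 dD D2N c2_gt0 Q_ge1 c2Q hQ master.
have [beta_s2 _] := s2_bounds d_gt1 dD c2_gt0 Q_ge1 c2Q hQ master Yge1.
have k0 : (0 < k)%N by apply: leq_trans Dk; apply: leq_trans D_ge32.
have nI : #|fintype_ordinal__canonical__fintype_Finite n| = n by rewrite card_ord.
have kI : #|fintype_ordinal__canonical__fintype_Finite k| = k by rewrite card_ord.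
have Ysz := Y_ge8 d_gt1 dD Q_ge1 Y1.
have [NJ _] := J_sub_Nh d_gt1 dD c2_gt0 Q_ge1 c2Q master Yge1 Ysz.
have [Nh_ge _] := Nh_bounds d_gt1 dD c2_gt0 Q_ge1 c2Q master Yge1.
have [Nb_ge _] := Nb_bounds d_gt1 dD c2_gt0 c2Q Yge1.
have [s2a s2b] := depth_ok D c2 sig n.
have [I1 [_ I2]] := I_bounds d_gt1 dD c2_gt0 A_ge2 Q_ge1 c2Q AQ master Y1 Y5.
have [Pp Ple] := poincare_const_le d_gt1 dD Dk D2N lnk c2_gt0 A_ge2 Q_ge1 c2Q hQ AQ master n0 Y1 Y5.
move: Ple; set cst := (X in X <= _) => Ple.
have In : I_ D c2 A (ln n%:R) <= n%:R by apply: le_trans I2 _; rewrite ler_pdivrMr // ler_peMr // ler1n.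
have G0_ge : gam D c2 / 2 * (block_len D (ln (n%:R : R))).+2%:R + beta_ D c2 (ln n%:R) <=
    (G0_ D c2 (ln n%:R))%:R.
  by apply: up_ge; rewrite addr_ge0 // mulr_ge0 // divr_ge0.
have main f : Dir (pcol (fintype_ordinal__canonical__fintype_Finite k) (adj E))
    [set: fintype_ordinal__canonical__fintype_Finite n] f <=
    mixing_const D Q * expR (ln n%:R / g) *
    \sum_v Dir (pcol (fintype_ordinal__canonical__fintype_Finite k) (adj E)) [set v] f.
  rewrite -(ler_pM2l Pp) mulrA [_ * (mixing_const _ _ * _)]mulrC.
  apply: le_trans (_ : cst * \sum_v Dir (pcol (fintype_ordinal__canonical__fintype_Finite k) (adj E)) [set v] f <= _);
    last first.
    by rewrite ler_wpM2r //; apply: sumr_ge0 => v _; apply: Dir_ge0.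
  have gp := @good_poincare R (fintype_ordinal__canonical__fintype_Finite n)
    (fintype_ordinal__canonical__fintype_Finite k) (adj E) (@adj_sym n E) (adj_irr EU)
    D N0 (excess_bound D c2 sig) (block_len D (ln (n%:R : R))) (s2_ D c2 sig (ln n%:R))
    (gam D c2) (beta_ D c2 (ln n%:R)) D_ge32 N0_gt1.
  rewrite nI kI in gp.
  apply: (gp _ D0_small gam0 (gam_le4 d_gt1 dD c2_gt0 Q_ge1 c2Q master) beta0 sparse_s sparse_l light
    (size_ok d_gt1 dD Q_ge1 Y1 Y2) beta_s2 (depth_blocks D sig) s2a t1 q sig A (G0_ D c2 (ln n%:R))
    t1_ge t1_contr q_ge0 D2N sig_ge1 sig_le2 A_ge A_ge2
    (A_gam d_gt1 dD c2_gt0 A_ge2 Q_ge1 c2Q AQ master) G0_ge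
    (contraction_half d_gt1 dD c2_gt0 sig_ge1 A_ge2 Q_ge1 c2Q hQ AQ master Y1 Y3 Y4)
    (contraction_pow d_gt1 dD c2_gt0 sig_ge1 A_ge2 Q_ge1 c2Q hQ AQ master n0 Y1 Y3)
    (J_ (ln n%:R)) (Nb_ D c2 (ln n%:R)) (Nh_ D c2 (ln n%:R)) (ltn0Sn _) Nh_ge Nb_ge s2b n0
    (up (draw_rate R D * n%:R)) f NJ (J_le_n d_gt1 dD Q_ge1 Y1 Y5)).
  - by rewrite subnKC.
  - exact: In.
  - exact: (draws_suffice d_gt1 dD c2_gt0 A_ge2 Q_ge1 c2Q AQ master n0 Y1 Y5 count).
have MA : 1 <= mixing_const D Q * expR (ln n%:R / g).
  rewrite -[leLHS]mulr1; apply: ler_pM; rewrite ?mixing_const_ge1 //.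
  by rewrite -[leLHS]expR0 ler_expR divr_ge0 ?(le_trans _ g3) ?(le_trans _ Yge1).
have [T [T1 T2]] := poincare_mixing EU n0 k0 MA main.
by exists T; split=> //; apply: le_trans T1 (mixing_bound_le n0).
Qed.

End GoodGraphs.

(** * Good graphs are likely *)

Section Failure.
Variables (R : realType) (n : nat) (E : {set 'I_n * 'I_n}).

Lemma sum_by_card_ge (s : nat) (F : {set 'I_n} -> R) (T : {set 'I_n}) :
  (forall T, 0 <= F T) -> conn (adj E) T -> (#|T| <= s)%N ->
  F T <= \sum_(t < s) \sum_(T : {set 'I_n} | (#|T| == t.+1) && `[< conn (adj E) T >]) F T.
Proof.
move=> F0 cT sT; have T0 : (0 < #|T|)%N by rewrite card_gt0 (conn_n0 cT).
have lt_s : (#|T|.-1 < s)%N by rewrite prednK.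
rewrite (bigD1 (Ordinal lt_s)) //= (bigD1 T) /=; last by rewrite prednK // eqxx; apply/asboolP.
by rewrite -addrA lerDl addr_ge0 ?sumr_ge0 // => i _; apply: sumr_ge0.
Qed.

Lemma dense_count_ge0 s j : 0 <= dense_count R s j E.
Proof. by apply: sumr_ge0 => t _; apply: sumr_ge0. Qed.

Lemma dense_count_ge1 s j T : conn (adj E) T -> (#|T| <= s)%N ->
  ~~ (edges2 (adj E) T <= 2 * (#|T| + j))%N -> 1 <= dense_count R s j E.
Proof.
rewrite -ltnNge => cT sT dT.
have := sum_by_card_ge (F := fun T => (2 * (#|T| + j) < edges2 (adj E) T)%N%:R) _ cT sT.
by rewrite dT; apply.
Qed.

Lemma excess_count_ge0 lam (D : R) x : 0 <= excess_count lam D x E.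
Proof.
apply: sumr_ge0 => t _; apply: sumr_ge0 => T _; apply: sumr_ge0 => U _.
by rewrite mulr_ge0 ?exprn_ge0 ?expR_ge0.
Qed.

Lemma excess_count_ge1 lam (D : nat) (x : nat -> R) T : 0 <= lam -> (0 < D)%N -> conn (adj E) T ->
  x #|T| <= \sum_(v in T) hw R (adj E) (heavy (adj E) D) D v ->
  1 <= excess_count lam D%:R x E.
Proof.
move=> lam0 D0 cT xT; have Dp : 0 < D%:R :> R by rewrite ltr0n.
have Tn : (#|T| <= n)%N by rewrite -[leqRHS]card_ord max_card.
pose F (T : {set 'I_n}) : R := \sum_(U : {set 'I_n} | U \subset T)
  expR lam ^+ (\sum_(v in U) #|nb (adj E) v|) *
  expR (- (lam * D%:R * Num.max #|U|%:R (x #|T|))).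
have F0 T' : 0 <= F T'.
  by apply: sumr_ge0 => U _; rewrite mulr_ge0 ?exprn_ge0 ?expR_ge0.
have := sum_by_card_ge F0 cT Tn.
have -> : \sum_(t < n) \sum_(T : {set 'I_n} | (#|T| == t.+1) && `[< conn (adj E) T >]) F T =
    excess_count lam D%:R x E.
  by apply: eq_bigr => t _; apply: eq_bigr => T' /andP[/eqP T't _]; rewrite /F T't.
(* The term of [T] and its heavy part already reaches 1: the degrees over [U] sum to at least
   [D * #|U|] because each exceeds [D], and to at least [D * x #|T|] by hypothesis. *)
apply: le_trans; set U := T :&: heavy (adj E) D.
have UT : U \subset T by apply: subsetIl.
rewrite /F (bigD1 U) //=; apply: le_trans (_ : _ <= expR lam ^+ (\sum_(v in U) #|nb (adj E) v|) *
  expR (- (lam * D%:R * Num.max #|U|%:R (x #|T|)))) _; last first.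
  by rewrite lerDl sumr_ge0 // => V _; rewrite mulr_ge0 ?exprn_ge0 ?expR_ge0.
rewrite -expRM_natl -expRD -[leLHS]expR0 ler_expR subr_ge0.
set S := (\sum_(v in U) _)%N.
have SU : \sum_(v in T) hw R (adj E) (heavy (adj E) D) D v = S%:R / D%:R.
  rewrite /S natr_sum mulr_suml /hw -big_mkcondr /=.
  by apply: eq_bigl => v; rewrite /U in_setI.
rewrite SU ler_pdivlMr // in xT.
rewrite [leRHS]mulrC -mulrA ler_wpM2l // mulrC.
have [h|h] := leP (x #|T|) #|U|%:R; last exact: xT.
rewrite -natrM ler_nat /S -sum_nat_const; apply: leq_sum => v; rewrite in_setI => /andP[_].
by rewrite in_set => /ltnW.
Qed.

End Failure.

Section FailureProbability.
Variables (R : realType) (d : R).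
Hypothesis d_gt1 : 1 < d.
Local Notation p n := (d / n%:R).

Lemma edge_prob_bounds n : (0 < n)%N -> ln d <= ln n%:R -> 0 <= p n /\ p n <= 1.
Proof.
move=> n0 dn; have d0 : 0 < d by apply: lt_trans d_gt1.
split; first by rewrite divr_ge0 // ltW.
by rewrite ler_pdivrMr ?ltr0n // mul1r -[d]lnK ?posrE // -[n%:R]lnK ?posrE ?ltr0n // ler_expR.
Qed.

Lemma ed_expR : expR 1 * d = expR (1 + ln d) /\ 1 <= expR 1 * d.
Proof.
have d0 : 0 < d by apply: lt_trans d_gt1.
have E : expR 1 * d = expR (1 + ln d) by rewrite expRD lnK.
by split; rewrite // E -[leLHS]expR0 ler_expR addr_ge0 // ln_ge0 // ltW.
Qed.

(** The expectation is at most a power of [ln n] times [(e * d) ^ s / n ^ (j + 1)]. The condition on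
    [a] bounds [(e * d) ^ s] by a constant times [n ^ (j + 1 / 2)], and the remaining
    [n ^ (- 1 / 2)] beats every power of [ln n]. *)
Lemma dense_count_small (a b delta : R) (s : nat -> nat) j :
  0 <= a -> 0 <= b -> (forall n, 1 <= ln n%:R :> R -> (s n)%:R <= a * ln n%:R + b) ->
  a * (1 + ln d) <= j%:R + 2^-1 -> 0 < delta ->
  eventually (fun n => rexp (upper_pairs n) (p n) (dense_count R (s n) j) <= delta).
Proof.
move=> a0 b0 sle aj delta0; have d0 : 0 < d by apply: lt_trans d_gt1.
have [edE ed1] := ed_expR.
have lnd0 : 0 <= ln d by rewrite ln_ge0 // ltW.
set C := (a + b) ^+ (j.+2.*2.+1) * d ^+ j.+1 * expR ((1 + ln d) * b).
have half0 : 0 < 2^-1 :> R by rewrite invr_gt0.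
have [N hN] := eventually_and pos_large (eventually_and (ln_large (Num.max 1 (ln d)))
  (poly_le_exp (C / delta) (j.+2.*2.+1) half0)).
exists N => n /hN [n0 [+ Y2]]; rewrite ge_max => /andP[Y1 dn].
have [p0 p1] := edge_prob_bounds n0 dn.
have np : 0 < n%:R :> R by rewrite ltr0n.
apply: le_trans (@dense_count_le R n _ p0 p1 (s n) j) _.
move: (sle n Y1) => {sle}; set Y : R := ln n%:R in Y1 Y2 *; set S := s n => hS.
have nY : n%:R = expR Y by rewrite lnK.
apply: (@le_trans _ _ (\sum_(t < S) ((expR 1 * d) ^+ S * d ^+ j.+1 * (S%:R ^+ 2) ^+ j.+2 / n%:R ^+ j.+1))).
  apply: ler_sum => t _.
  have -> : (expR 1 * n%:R) ^+ t.+1 * (((t.+1 ^ 2) ^ j.+2)%:R * p n ^+ (t + j.+2)) =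
      (expR 1 * d) ^+ t.+1 * d ^+ j.+1 * (t.+1%:R ^+ 2) ^+ j.+2 / n%:R ^+ j.+1.
    rewrite addnS -addSn exprD !natrX.
    have -> : expR 1 * d = expR 1 * n%:R * p n by rewrite -mulrA [n%:R * _]mulrC divfK ?gt_eqF.
    rewrite [(_ * p n) ^+ t.+1]exprMn [p n ^+ j.+1]exprMn -exprVn.
    set x1 := _ ^+ t.+1; set x2 := p n ^+ t.+1; set x3 := (_ ^+ 2) ^+ _; set x4 := d ^+ _.
    by set x5 := _ ^+ j.+1; ring.
  rewrite ler_wpM2r ?invr_ge0 ?exprn_ge0 //.
  apply: ler_pM.
  - by rewrite mulr_ge0 // exprn_ge0 ?(le_trans ler01 ed1) // ltW.
  - by rewrite !exprn_ge0.
  - by rewrite ler_wpM2r ?exprn_ge0 ?(ltW d0) // ler_weXn2l.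
  - by apply: lerXn2r; rewrite ?nnegrE ?exprn_ge0 //; apply: lerXn2r; rewrite ?nnegrE ?ler_nat.
rewrite sumr_const card_ord -[_ *+ S]mulr_natl.
have mY : S%:R <= (a + b) * Y.
  apply: le_trans hS _; rewrite mulrDl lerD2l ler_peMr //.
have e1 : (expR 1 * d) ^+ S <= expR ((j%:R + 2^-1) * Y) * expR ((1 + ln d) * b).
  rewrite edE -expRM_natl -expRD ler_expR.
  apply: (@le_trans _ _ ((a * Y + b) * (1 + ln d))); first by rewrite ler_wpM2r ?addr_ge0.
  rewrite mulrDl [b * _]mulrC lerD2r mulrAC ler_wpM2r //; exact: le_trans Y1.
have e2 : S%:R * (S%:R ^+ 2) ^+ j.+2 <= (a + b) ^+ (j.+2.*2.+1) * Y ^+ (j.+2.*2.+1) :> R.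
  rewrite -exprM mulnC muln2 -exprS -exprMn; apply: lerXn2r; rewrite ?nnegrE //.
  by rewrite mulr_ge0 ?addr_ge0 // (le_trans _ Y1).
have -> : S%:R * ((expR 1 * d) ^+ S * d ^+ j.+1 * (S%:R ^+ 2) ^+ j.+2 / n%:R ^+ j.+1) =
   (expR 1 * d) ^+ S * (S%:R * (S%:R ^+ 2) ^+ j.+2) * (d ^+ j.+1 / n%:R ^+ j.+1) :> R.
  set x1 := _ ^+ S; set x2 := (_ ^+ 2) ^+ _; set x3 := d ^+ _; set x4 := (_ ^+ _)^-1; ring.
apply: (@le_trans _ _ (expR ((j%:R + 2^-1) * Y) * expR ((1 + ln d) * b) *
  ((a + b) ^+ (j.+2.*2.+1) * Y ^+ (j.+2.*2.+1)) * (d ^+ j.+1 / n%:R ^+ j.+1))).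
  rewrite ler_wpM2r ?divr_ge0 ?exprn_ge0 ?(ltW d0) //.
  apply: ler_pM e1 e2; first by rewrite exprn_ge0 // (le_trans ler01 ed1).
  by rewrite mulr_ge0 ?exprn_ge0.
have -> : (n%:R ^+ j.+1)^-1 = expR (- ((j%:R + 2^-1) * Y)) * expR (- (2^-1 * Y)) :> R.
  rewrite nY -expRM_natl -expRN -expRD; congr expR; rewrite -natr1; lra.
rewrite expRN; set z := expR ((j%:R + 2^-1) * Y).
have zp : z != 0 by rewrite gt_eqF ?expR_gt0.
have -> : z * expR ((1 + ln d) * b) * ((a + b) ^+ j.+2.*2.+1 * Y ^+ j.+2.*2.+1) *
    (d ^+ j.+1 * (z^-1 * expR (- (2^-1 * Y)))) = C * Y ^+ j.+2.*2.+1 * expR (- (2^-1 * Y)).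
  rewrite /C; set x1 := expR _; set x2 := _ ^+ j.+2.*2.+1; set x3 := Y ^+ _; set x4 := d ^+ _.
  by set x5 := expR _; field.
rewrite expRN ler_pdivrMr ?expR_gt0 // -ler_pdivrMl // mulrA [_^-1 * C]mulrC.
exact: Y2.
Qed.

(** For these thresholds the Chernoff factor of a set of [t + 1] vertices is
    [exp (- (t + 1) * g) / n ^ 3]. The exponential beats [(4 * e * d) ^ t], as [g] exceeds
    [2 + 1 + ln d]; the cube beats the spare factor [n] and the sum over [t < n]. *)
Lemma excess_count_small (D : nat) (c2 lam delta : R) : d <= D%:R ->
  0 < c2 -> 0 <= lam -> c2 <= lam -> expR lam ^+ 2 <= 2 ->
  d * ((expR lam ^+ 2 - 1) / 2) <= D%:R * (lam - c2) -> 0 < delta ->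
  eventually (fun n => rexp (upper_pairs n) (p n)
    (excess_count lam D%:R (fun t => gam D c2 / 2 * t%:R + beta_ D c2 (ln n%:R))) <= delta).
Proof.
move=> dD c20 lam0 c2lam z2 tilt delta0; have d0 : 0 < d by apply: lt_trans d_gt1.
have Dp : 0 < D%:R :> R by apply: lt_le_trans dD.
have [_ ld] := ln_d_bounds d_gt1 dD.
have [N hN] := eventually_and pos_large (eventually_and (ln_large (ln d))
  (poly_le_exp (2 * expR 1 / delta) 0 (@ltr01 R))).
exists N => n /hN [n0 [dn]]; rewrite expr0 mulr1 mul1r lnK ?posrE ?ltr0n // => Y2.
have [p0 p1] := edge_prob_bounds n0 dn.
have np : 0 < n%:R :> R by rewrite ltr0n.
have npd : n%:R * p n = d by rewrite mulrC divfK ?gt_eqF.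
have tilt' : n%:R * p n * ((expR lam ^+ 2 - 1) / 2) <= D%:R * (lam - c2) by rewrite npd.
apply: le_trans (@excess_count_le R n _ p0 p1 _ _ _ _ lam0 (ltW c20) c2lam (ltW Dp) tilt') _.
set g := ln D%:R + 3 in ld *.
have g0 : 0 <= g by have : 0 <= ln d by [rewrite ln_ge0 // ltW]; lra.
have e4 : 4 <= expR 2 :> R.
  have -> : expR 2 = expR 1 ^+ 2 :> R by rewrite -expRM_natl mulr1.
  have e1 : 2 <= expR 1 :> R by apply: le_trans (expR_ge1Dx _); lra.
  by have -> : 4 = 2 ^+ 2 :> R by [lra]; apply: lerXn2r; rewrite ?nnegrE ?expR_ge0.
have base : 2 * expR 1 * d * expR lam ^+ 2 <= expR g.
  apply: (@le_trans _ _ (4 * (expR 1 * d))).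
    have : expR 1 * d * expR lam ^+ 2 <= expR 1 * d * 2.
      by rewrite ler_wpM2l // mulr_ge0 ?expR_ge0 // ltW.
    move=> h; have -> : 2 * expR 1 * d * expR lam ^+ 2 = 2 * (expR 1 * d * expR lam ^+ 2) by ring.
    lra.
  have [-> _] := ed_expR.
  apply: (@le_trans _ _ (expR 2 * expR (1 + ln d))); first by rewrite ler_wpM2r ?expR_ge0.
  by rewrite -expRD ler_expR; lra.
apply: (@le_trans _ _ (\sum_(t < n) (2 * expR 1 / n%:R ^+ 2))); last first.
  rewrite sumr_const card_ord -[_ *+ n]mulr_natl expr2.
  have -> : n%:R * (2 * expR 1 / (n%:R * n%:R)) = 2 * expR 1 / n%:R :> R by field; rewrite gt_eqF.
  by rewrite ler_pdivrMr // -ler_pdivrMl // [_^-1 * _]mulrC.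
apply: ler_sum => t _.
have -> : c2 * D%:R * (gam D c2 / 2 * t.+1%:R + beta_ D c2 (ln n%:R)) = t.+1%:R * g + 3 * ln n%:R.
  rewrite /gam /beta_ -/g; set y := ln _; field.
  by rewrite !gt_eqF.
rewrite opprD expRD expRN expRM_natl expRN expRM_natl lnK ?posrE //.
have gp := expR_gt0 g; have npd' : n%:R * p n = d by [].
have -> : (expR 1 * n%:R) ^+ t.+1 * (2 ^+ t.+1 * p n ^+ t * expR lam ^+ (2 * t) *
   ((expR g ^+ t.+1)^-1 / n%:R ^+ 3)) =
   2 * expR 1 / n%:R ^+ 2 * ((2 * expR 1 * d * expR lam ^+ 2 / expR g) ^+ t / expR g).
  rewrite -[X in 2 * expR 1 * X * _ / _]npd'; move: (p n) (expR 1) => P e.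
  rewrite exprM !exprMn exprVn !(exprS _ t).
  have G0 : expR g ^+ t != 0 by rewrite gt_eqF // exprn_gt0.
  move: G0; set x1 := e ^+ t; set x2 := n%:R ^+ t; set x3 := 2 ^+ t; set x4 := P ^+ t.
  set x5 := (expR lam ^+ 2) ^+ t; set x6 := expR g ^+ t => G0.
  by field; rewrite G0 !gt_eqF.
rewrite ler_piMr ?divr_ge0 ?mulr_ge0 ?expR_ge0 ?exprn_ge0 //.
rewrite ler_pdivrMr // mul1r; apply: (@le_trans _ _ 1); last by rewrite -[leLHS]expR0 ler_expR.
apply: exprn_ile1; last by rewrite ler_pdivrMr // mul1r.
by rewrite divr_ge0 ?(ltW gp) // !mulr_ge0 ?exprn_ge0 ?expR_ge0 // ltW.
Qed.

(** The allowed number of connected sets exceeds its expectation by a factor of order [n / ln n], so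
    a first moment suffices. *)
Lemma conn_count_small (delta : R) (s : nat -> nat) (C : R) :
  (forall n, 1 <= ln n%:R :> R -> (s n)%:R <= C * ln n%:R) -> 0 < delta ->
  eventually (fun n => rexp (upper_pairs n) (p n) (fun E =>
    (n%:R ^+ 2 * (expR 1 * d) ^+ s n)^-1 * conn_count R (s n) E) <= delta).
Proof.
move=> sC delta0; have d0 : 0 < d by apply: lt_trans d_gt1.
have [_ ed1] := ed_expR.
have [N hN] := eventually_and pos_large (eventually_and (ln_large (Num.max 1 (ln d)))
  (poly_le_exp (expR 1 * C / delta) 1 (@ltr01 R))).
exists N => n /hN [n0 [+ +]]; rewrite ge_max => /andP[Y1 dn].
rewrite expr1 mul1r lnK ?posrE ?ltr0n // => Y2.
have [p0 p1] := edge_prob_bounds n0 dn.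
have np : 0 < n%:R :> R by rewrite ltr0n.
have npd : n%:R * p n = d by rewrite mulrC divfK ?gt_eqF.
have edp : 0 < (expR 1 * d) ^+ s n by rewrite exprn_gt0 // (lt_le_trans ltr01 ed1).
have den : 0 < n%:R ^+ 2 * (expR 1 * d) ^+ s n by apply: mulr_gt0 => //; apply: exprn_gt0.
rewrite rexpZ mulrC ler_pdivrMr //.
apply: le_trans (@conn_count_le R n _ p0 p1 (s n)) _.
apply: (@le_trans _ _ (\sum_(t < s n) (expR 1 * n%:R * (expR 1 * d) ^+ s n))).
  apply: ler_sum => t _; rewrite exprS -mulrA -exprMn.
  rewrite (_ : expR 1 * n%:R * p n = expR 1 * d); last by rewrite -mulrA npd.
  by rewrite ler_wpM2l ?mulr_ge0 ?expR_ge0 // ler_weXn2l // ltnW.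
rewrite sumr_const card_ord -[_ *+ s n]mulr_natl.
set X := _ ^+ s n in edp *.
have -> : (s n)%:R * (expR 1 * n%:R * X) = (s n)%:R * expR 1 * (n%:R * X) by ring.
have -> : delta * (n%:R ^+ 2 * X) = delta * n%:R * (n%:R * X) by ring.
rewrite ler_wpM2r ?mulr_ge0 ?(ltW edp) //.
apply: (@le_trans _ _ (C * ln n%:R * expR 1)); first by rewrite ler_wpM2r ?expR_ge0 // sC.
have -> : C * ln n%:R * expR 1 = delta * (expR 1 * C / delta * ln n%:R) by field; rewrite gt_eqF.
by rewrite ler_pM2l.
Qed.

End FailureProbability.

Section GoodGraphLikely.
Variables (R : realType) (D : nat) (d c2 lam sig Q : R).
Local Notation g := (ln (D%:R : R) + 3).
Hypotheses (d_gt1 : 1 < d) (dD : d <= D%:R).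
Hypothesis tilt : d * ((expR lam ^+ 2 - 1) / 2) <= D%:R * (lam - c2).
Hypotheses (c2_gt0 : 0 < c2) (lam_ge0 : 0 <= lam) (c2_le : c2 <= lam) (z2 : expR lam ^+ 2 <= 2).
Hypotheses (Q_ge1 : 1 <= Q) (c2Q : 1 <= c2 * Q) (hQ : 1 <= ln sig * Q).
Hypothesis master : 100 * 100 * (Q ^+ 2 * g ^+ 4) <= D%:R.

Definition failures n (E : {set 'I_n * 'I_n}) : R :=
  let Y : R := ln n%:R in
  dense_count R (3 * (block_len D Y).+2) 0 E +
  dense_count R (s2_ D c2 sig Y) (excess_bound D c2 sig) E +
  excess_count lam D%:R (fun t => gam D c2 / 2 * t%:R + beta_ D c2 Y) E +
  (n%:R ^+ 2 * (expR 1 * d) ^+ (3 * J_ Y))^-1 * conn_count R (3 * J_ Y) E.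

Let d_gt0 : 0 < d. Proof. exact: lt_trans d_gt1. Qed.

Lemma conn_count_ge n (E : {set 'I_n * 'I_n}) s :
  \sum_(T : {set 'I_n} | `[< conn (adj E) T >] && (#|T| <= s)%N) 1 <= conn_count R s E.
Proof.
rewrite /conn_count (exchange_big_dep (fun T : {set 'I_n} =>
  `[< conn (adj E) T >] && (#|T| <= s)%N)) /=; last first.
  by move=> t T _ /andP[/eqP -> ->] /=; apply: ltn_ord.
apply: ler_sum => T /andP[cT sT].
have T0 : (0 < #|T|)%N by rewrite card_gt0; move/asboolP: cT => /conn_n0.
have lt_s : (#|T|.-1 < s)%N by rewrite prednK.
rewrite (bigD1 (Ordinal lt_s)) /=; last by rewrite prednK // eqxx.
by rewrite lerDl sumr_ge0.
Qed.

Lemma count_ge0 n (E : {set 'I_n * 'I_n}) s :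
  0 <= (n%:R ^+ 2 * (expR 1 * d) ^+ s)^-1 * conn_count R s E.
Proof.
apply: mulr_ge0; last by apply: sumr_ge0 => t _; apply: sumr_ge0.
by rewrite invr_ge0 mulr_ge0 ?exprn_ge0 // mulr_ge0 ?expR_ge0 // ltW.
Qed.

Lemma failures_ge0 n (E : {set 'I_n * 'I_n}) : 0 <= failures E.
Proof.
by rewrite /failures !addr_ge0 ?dense_count_ge0 ?excess_count_ge0 ?count_ge0.
Qed.

Lemma not_good_graph n (E : {set 'I_n * 'I_n}) : (0 < n)%N ->
  ~ good_graph D d c2 sig E -> 1 <= failures E.
Proof.
move=> n0 ngood; rewrite /failures.
set x1 := dense_count _ _ 0 _; set x2 := dense_count _ _ _ _; set x3 := excess_count _ _ _ _.
set x4 := _^-1 * _.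
have h1 : 0 <= x1 by apply: dense_count_ge0.
have h2 : 0 <= x2 by apply: dense_count_ge0.
have h3 : 0 <= x3 by apply: excess_count_ge0.
have h4 : 0 <= x4 by apply: count_ge0.
have {ngood} : [\/ 1 <= x1, 1 <= x2, 1 <= x3 | 1 <= x4].
  apply: contrapT => no; apply: ngood; split.
  - by move=> T cT sT; rewrite -[#|T| in leqRHS]addn0; apply/negP => /negP bad; apply: no;
      apply: Or41; apply: dense_count_ge1 cT sT bad.
  - by move=> T cT sT; apply/negP => /negP bad; apply: no;
      apply: Or42; apply: dense_count_ge1 cT sT bad.
  - move=> T cT; apply/negP => /negP; rewrite -ltNge => bad; apply: no; apply: Or43.
    apply: excess_count_ge1 cT (ltW bad) => //.
    by rewrite -(ltr_nat R) (lt_le_trans d_gt0).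
  - apply/negP => /negP; rewrite -ltNge => bad; apply: no; apply: Or44.
    have den : 0 < n%:R ^+ 2 * (expR 1 * d) ^+ (3 * J_ (ln (n%:R : R))).
      by apply: mulr_gt0; apply: exprn_gt0; rewrite ?ltr0n // mulr_gt0 ?expR_gt0.
    rewrite /x4 mulrC ler_pdivlMr // mul1r; apply: le_trans (ltW bad) _.
    exact: conn_count_ge.
by clearbody x1 x2 x3 x4; case; lra.
Qed.

Lemma failures_small delta : 0 < delta ->
  eventually (fun n => rexp (upper_pairs n) (d / n%:R) (@failures n) <= delta).
Proof.
move=> delta0; have dl4 : 0 < delta / 4 by rewrite divr_gt0.
have g3 := g_ge3 d_gt1 dD; have [ld0 ld1] := ln_d_bounds d_gt1 dD.
have [S3 _] := size_rate_bounds d_gt1 dD c2_gt0 Q_ge1 c2Q hQ.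
have [j0 _] := excess_bounds d_gt1 dD c2_gt0 Q_ge1 c2Q hQ.
have a0 : 0 <= 3 / (8 * g) by rewrite divr_ge0 //; lra.
have A1 : 3 / (8 * g) * (1 + ln d) <= 0%:R + 2^-1.
  have : 3 / (8 * g) * (1 + ln d) <= 3 / (8 * g) * g by rewrite ler_wpM2l //; lra.
  have -> : 3 / (8 * g) * g = 3 / 8 by set z := g in g3 *; field; lra.
  lra.
have A2 : size_rate D c2 sig * (1 + ln d) <= (excess_bound D c2 sig)%:R + 2^-1.
  have : size_rate D c2 sig * (1 + ln d) <= size_rate D c2 sig * g by rewrite ler_wpM2l //; lra.
  move: j0; move: (_%:R) => z; lra.
have sc0 : 0 <= size_const D c2 sig.
  by rewrite /size_const !addr_ge0 // divr_ge0 ?(ltW c2_gt0) // mulr_ge0 //; lra.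
have B1 n : 1 <= ln n%:R :> R ->
    (3 * (block_len D (ln (n%:R : R))).+2)%N%:R <= 3 / (8 * g) * ln n%:R + 6.
  move=> Y1; have [l1 _] := block_len_bounds d_gt1 dD Y1; move: l1.
  set l := block_len _ _; set y := ln _; clearbody l y => l1.
  rewrite natrM -[l.+2]addn2 natrD mulrDr.
  have -> : 3 / (8 * g) * y = 3 * (y / (8 * g)) by set z := g in g3 *; field; lra.
  lra.
have B2 n : 1 <= ln n%:R :> R ->
    (s2_ D c2 sig (ln (n%:R : R)))%:R <= size_rate D c2 sig * ln n%:R + size_const D c2 sig.
  by move=> Y1; have [] := s2_bounds d_gt1 dD c2_gt0 Q_ge1 c2Q hQ master Y1.
have B3 n : 1 <= ln n%:R :> R -> (3 * J_ (ln (n%:R : R)))%N%:R <= 6 * ln n%:R :> R.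
  move=> Y1; have [_] := J_bounds Y1; rewrite natrM.
  by set l := J_ _; set y := ln _ in Y1 *; clearbody l y; lra.
have S0 : 0 <= size_rate D c2 sig by lra.
have six : 0 <= 6 :> R by [].
have [N hN] := eventually_and (dense_count_small d_gt1 (j := 0) a0 six B1 A1 dl4)
  (eventually_and (dense_count_small d_gt1 S0 sc0 B2 A2 dl4)
  (eventually_and (excess_count_small d_gt1 dD c2_gt0 lam_ge0 c2_le z2 tilt dl4)
  (conn_count_small d_gt1 B3 dl4))).
exists N => n /hN [b1 [b2 [b3 b4]]].
rewrite /failures !rexpD; move: b1 b2 b3 b4.
set r1 := rexp _ _ _; set r2 := rexp _ _ _; set r3 := rexp _ _ _; set r4 := rexp _ _ _.
by clearbody r1 r2 r3 r4; lra.
Qed.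

End GoodGraphLikely.

From mathcomp Require Import all_classical all_reals all_analysis.
Unset Implicit Arguments.
Import numFieldNormedType.Exports.
Local Open Scope classical_set_scope.
Local Open Scope ring_scope.

Theorem theorem1p1 (R : realType) (alpha : R) :
  0 < alpha -> alpha = expR (alpha^-1) ->
  forall eps : R, 0 < eps ->
  exists d0 : R, forall d : R, d0 < d ->
  forall k : nat, (alpha + eps) * d <= k%:R ->
  exists C : R, 0 < C /\
    (fun n : nat =>
       gnp_prob R n (d / n%:R)
         (fun E => mixing_time_le R n k E (C * (n%:R `^ (2 + (ln d)^-1)))))
      @ \oo --> (1 : R).
Proof.
move=> alpha0 alphaE eps eps0.
have [Q [[Q1 c2Q hQ AQ] HQ]] := constants_ex alpha0 alphaE eps0.
have [[c20 lam0 c2lam z2] [sig1 sig2 A2 A6 q0]] := constants_basic alpha0 alphaE eps0.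
have M0 : 0 <= 100 * 100 * Q ^+ 2 by rewrite mulr_ge0 ?exprn_ge0 // (le_trans _ Q1).
have [x0 [x01 Hx]] := ln_pow4_le M0.
(* Rounding gives [D > d - 1], so the extra 1 puts [D] above both [Q] and [x0]; the latter is the
   threshold of the inequality [master]. *)
exists (Num.max Q x0 + 1) => d dd k kd.
have ae : 0 < alpha + eps / 2 by lra.
set D := Num.truncn (k%:R / (alpha + eps / 2)).
have mQ : Q <= Num.max Q x0 by rewrite le_max lexx.
have mx : x0 <= Num.max Q x0 by rewrite le_max lexx orbT.
have d1 : 1 < d by lra.
have dD1 : d < D%:R + 1.
  have r0 : 0 <= k%:R / (alpha + eps / 2) by rewrite divr_ge0 // ltW.
  have /andP[_] := truncn_itv r0; rewrite -/D => h; rewrite natr1; apply: le_lt_trans h.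
  rewrite ler_pdivlMr //; apply: le_trans kd; rewrite mulrC ler_wpM2r //; lra.
have QD : Q <= D%:R by lra.
have [[Dk D2 t1k t1q dD] [tilt lnk]] := HQ k d kd QD.
have master : 100 * 100 * (Q ^+ 2 * (ln (D%:R : R) + 3) ^+ 4) <= D%:R.
  by rewrite mulrA; apply: Hx; lra.
have [C [C0 [N1 H1]]] := good_graph_mixing d1 dD Dk D2 t1k t1q lnk c20 sig1 sig2 A2 A6 q0
  Q1 c2Q hQ AQ master.
exists C; split=> //; apply/cvgrPdist_le => delta delta0.
have [N2 H2] := failures_small d1 dD tilt c20 lam0 c2lam z2 Q1 c2Q hQ master delta0.
have [N3 H3] := ln_large (ln d).
exists (maxn (maxn N1 N2) (maxn N3 1)) => // n /=.
rewrite !geq_max => /andP[/andP[/H1 mix /H2 fail] /andP[/H3 dn n0]].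
have [p0 p1] := edge_prob_bounds d1 n0 dn.
rewrite ger0_norm ?subr_ge0 ?gnp_prob_le1 // lerBlDr -lerBlDl.
apply: le_trans (lerB (lexx 1) fail) _; apply: gnp_markov => // [E|E EU bad].
  exact: failures_ge0.
by apply: (not_good_graph d1 dD lam0 n0) => good; apply: bad; apply: mix EU good.
Qed.
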